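(* Let $f$ be a (nonzero) real-valued function on $\mathbb{R}^N$, let $\mathrm{C}_{\mathrm{UMITRSK}}f$ be the UMITRSK-CCTFD of $f$ with a real-valued kernel $\phi=\pm1$, let $\mathcal{F}f$ be the Fourier transform of $f$, and suppose $f,\ \lVert\mathbf{x}\rVert_2 f,\ \lVert\mathbf{w}\rVert_2\mathcal{F}f\in L^2(\mathbb{R}^N)$. Assume that $\nabla_{\mathbf{x}}f$ exists at every point $\mathbf{x}\in\mathbb{R}^N$. Then $$\Delta\mathbf{x}_{\mathrm{C}_{\mathrm{UMITRSK}},f}^2\,\Delta\mathbf{w}_{\mathrm{C}_{\mathrm{UMITRSK}},f}^2\ \geq\ \frac14\cdot\frac{N^2}{16\pi^2}.$$ When $f$ is non-zero almost everywhere, equality holds if and only if $f$ is an optimal Gaussian function.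
   Context: Vectors are row vectors in $\mathbb{R}^N$, $\mathrm{T}$ is transpose, $\lVert\cdot\rVert_2$ is the Euclidean norm on $\mathbb{R}^N$, $\lVert\cdot\rVert_{L^2}$ is the $L^2$-norm (for vector-valued $G$, $\lVert G\rVert_{L^2}^2=\int\lVert G\rVert_2^2$). Fourier transform: $\mathcal{F}f(\mathbf{w})=\int_{\mathbb{R}^N}f(\mathbf{x})e^{-2\pi i\mathbf{x}\mathbf{w}^{\mathrm{T}}}\,d\mathbf{x}$. CCTFD: for a kernel $\phi(\mathbf{v},\mathbf{y})$ and $f\in L^2(\mathbb{R}^N)$, the Cohen's class time-frequency distribution is $$\mathrm{C}f(\mathbf{x},\mathbf{w})=\iint f\left(\mathbf{z}+\tfrac{\mathbf{y}}{2}\right)\overline{f\left(\mathbf{z}-\tfrac{\mathbf{y}}{2}\right)}\left(\int\phi(\mathbf{v},\mathbf{y})e^{-2\pi i\mathbf{v}(\mathbf{x}-\mathbf{z})^{\mathrm{T}}}d\mathbf{v}\right)e^{-2\pi i\mathbf{y}\mathbf{w}^{\mathrm{T}}}d\mathbf{z}\,d\mathbf{y}.$$ UMITRSK-CCTFD (denoted $\mathrm{C}_{\mathrm{UMITRSK}}f$): the CCTFD of $f$ with a kernel satisfying $|\phi|=1$ and $\phi(\mathbf{v},2(\mathbf{z}-\mathbf{t}))=\phi(\mathbf{t})$ for $\mathbf{v},\mathbf{z},\mathbf{t}\in\mathbb{R}^N$ (the same letter $\phi$ denotes the function of one variable on the right). The kernel is then independent of $\mathbf{v}$, the inner integral is the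 distribution $\phi(\mathbf{y})\delta(\mathbf{x}-\mathbf{z})$ ($\delta$ the Dirac delta), and $\mathrm{C}_{\mathrm{UMITRSK}}f(\mathbf{x},\mathbf{w})=\int f(\mathbf{x}+\frac{\mathbf{y}}{2})\overline{f(\mathbf{x}-\frac{\mathbf{y}}{2})}\phi(\mathbf{y})e^{-2\pi i\mathbf{y}\mathbf{w}^{\mathrm{T}}}d\mathbf{y}$. Spreads in the UMITRSK-CCTFD domain: with $C=\mathrm{C}_{\mathrm{UMITRSK}}f$ on $\mathbb{R}^N\times\mathbb{R}^N$, $$\Delta\mathbf{x}_{\mathrm{C}_{\mathrm{UMITRSK}},f}^2=\frac{\iint\lVert\mathbf{x}-\mathbf{x}^0\rVert_2^2|C(\mathbf{x},\mathbf{w})|^2d\mathbf{x}d\mathbf{w}}{\lVert C\rVert_{L^2}^2},\quad \mathbf{x}^0=\frac{\iint\mathbf{x}|C|^2d\mathbf{x}d\mathbf{w}}{\lVert C\rVert_{L^2}^2},$$ $$\Delta\mathbf{w}_{\mathrm{C}_{\mathrm{UMITRSK}},f}^2=\frac{\iint\lVert\mathbf{w}-\mathbf{w}^0\rVert_2^2|C(\mathbf{x},\mathbf{w})|^2d\mathbf{x}d\mathbf{w}}{\lVert C\rVert_{L^2}^2},\quad \mathbf{w}^0=\frac{\iint\mathbf{w}|C|^2d\mathbf{x}d\mathbf{w}}{\lVert C\rVert_{L^2}^2}.$$ Optimal Gaussian function: a function of the form $f(\mathbf{x})=e^{-\frac{1}{2\zeta}\lVert\mathbf{x}-\mathbf{x}_f^0\rVert_2^2+\epsilon}$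 with $\zeta>0$, $\epsilon\in\mathbb{R}$, where $\mathbf{x}_f^0=\int\mathbf{x}|f(\mathbf{x})|^2d\mathbf{x}/\lVert f\rVert_{L^2}^2$.
   Formalization: In the equality case, ''f is an optimal Gaussian function'' is replaced by ''f or −f is an optimal Gaussian function'', since the negative of an optimal Gaussian satisfies all hypotheses and also attains equality. *)

(* Defs.v *)
From HB Require Import structures.
From mathcomp Require Import all_boot all_order all_algebra.
From mathcomp Require Import all_classical all_reals all_analysis.
From mathcomp Require Import complex.

Set Implicit Arguments.
Unset Strict Implicit.
Unset Printing Implicit Defensive.

Import Order.TTheory GRing.Theory Num.Theory.
Import numFieldNormedType.Exports.

Local Open Scope classical_set_scope.
Local Open Scope ring_scope.
Local Open Scope complex_scope.

Definition measure_rV_display : measure_display -> measure_display.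
Proof. exact. Qed.

Section measurable_rV.
Context {R : realType} (n : nat).

Let coors : 'I_n -> 'rV[R]_n -> R := fun i x => x ord0 i.

Let rV_set0 : g_sigma_preimage coors set0.
Proof. exact: sigma_algebra0. Qed.

Let rV_setC A : g_sigma_preimage coors A -> g_sigma_preimage coors (~` A).
Proof. exact: sigma_algebraC. Qed.

Let rV_bigcup (F : _^nat) : (forall i, g_sigma_preimage coors (F i)) ->
  g_sigma_preimage coors (\bigcup_i (F i)).
Proof. exact: sigma_algebra_bigcup. Qed.

(* Same construction as the one the library uses for n.-tuple R: the
   sigma-algebra generated by the coordinates. *)
HB.instance Definition _ :=
  @isMeasurable.Build (measure_rV_display default_measure_display)
    'rV[R]_n (g_sigma_preimage coors) rV_set0 rV_setC rV_bigcup.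

End measurable_rV.

Section measurable_fun_rV.
Context {R : realType}.

Lemma measurable_coord n (i : 'I_n) :
  measurable_fun [set: 'rV[R]_n] (fun x : 'rV[R]_n => x ord0 i).
Proof.
move=> _ Y mY; rewrite setTI; apply: sub_sigma_algebra => /=.
rewrite -bigcup_seq/=; exists i => /=; first by rewrite mem_index_enum.
by exists Y => //; rewrite setTI.
Qed.

Lemma measurable_fun_rVP d (T : measurableType d) n (f : T -> 'rV[R]_n) :
  (forall i, measurable_fun [set: T] (fun t => f t ord0 i)) ->
  measurable_fun [set: T] f.
Proof.
move=> mf; apply: (@measurability _ _ _ _ _ _
  (\big[setU/set0]_(i < n)
    preimage_set_system setT (fun x : 'rV[R]_n => x ord0 i) measurable)) => //.
move=> _ [B + <-]; rewrite -bigcup_seq => -[i _ [C mC <-]].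
by rewrite setTI; exact: mf.
Qed.

End measurable_fun_rV.

Section lebesgue_rV.
Context {R : realType}.

Definition rV_cons n (p : measurableTypeR R * 'rV[R]_n) : 'rV[R]_n.+1 :=
  row_mx (const_mx p.1 : 'rV[R]_1) p.2.

Definition rV_uncons n (x : 'rV[R]_n.+1) : measurableTypeR R * 'rV[R]_n :=
  (x ord0 ord0, rsubmx (x : 'rV[R]_(1 + n))).

Lemma rV_consK n : cancel (@rV_cons n) (@rV_uncons n).
Proof.
case=> a x; rewrite /rV_uncons /rV_cons row_mxKr; congr pair => /=.
have -> : @ord0 n = lshift n (@ord0 0) by exact: val_inj.
by rewrite (row_mxEl (const_mx a : 'rV_1) x ord0 ord0) mxE.
Qed.

Lemma measurable_rV_cons n : measurable_fun setT (@rV_cons n).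
Proof.
apply: measurable_fun_rVP => i.
have [j ->|j ->] := split_ordP (i : 'I_(1 + n)).
- rewrite (_ : (fun t => _) = fst); first exact: measurable_fst.
  apply/funext => p.
  exact: etrans (row_mxEl (const_mx p.1 : 'rV_1) p.2 ord0 j) (mxE _ _ _ _).
- rewrite (_ : (fun t => _) = (fun x : 'rV_n => x ord0 j) \o snd).
    exact: measurableT_comp (measurable_coord j) measurable_snd.
  apply/funext => p.
  exact: (row_mxEr (const_mx p.1 : 'rV_1) p.2 ord0 j).
Qed.

Lemma measurable_rV_uncons n : measurable_fun setT (@rV_uncons n).
Proof.
apply/measurable_fun_pairP; split.
  exact: (measurable_coord (ord0 : 'I_n.+1)).
apply: measurable_fun_rVP => i /=.
under eq_fun do rewrite mxE.
exact: measurable_coord.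
Qed.

Section step.
Context n (m : {sigma_finite_measure set 'rV[R]_n -> \bar R}).

Definition lebesgue_rV_step : set 'rV[R]_n.+1 -> \bar R :=
  pushforward (lebesgue_measure \x m)%E (@rV_cons n).

Let pm := measure_function_pushforward__canonical__measure_function_Measure
  (lebesgue_measure \x m)%E (@measurable_rV_cons n).

HB.instance Definition _ := isMeasure.Build _ _ _ lebesgue_rV_step
  (@measure0 _ _ _ pm) (@measure_ge0 _ _ _ pm)
  (@measure_semi_sigma_additive _ _ _ pm).

Let step_sigma_finite : sigma_finite setT lebesgue_rV_step.
Proof.
have /sigma_finiteP[F [TF ndF Foo]] := sigma_finiteT (@lebesgue_measure R).
have /sigma_finiteP[G [TG ndG Goo]] := sigma_finiteT m.
exists (fun i => @rV_uncons n @^-1` (F i `*` G i)).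
  rewrite -preimage_bigcup -[LHS](preimage_setT (@rV_uncons n)).
  congr (_ @^-1` _); rewrite -setXTT TF TG predeqE => -[x y]; split.
    move=> [/= [k _ Fkx] [l _ Gly]]; exists (maxn k l) => //; split.
    - by move: x Fkx; exact/subsetPset/ndF/leq_maxl.
    - by move: y Gly; exact/subsetPset/ndG/leq_maxr.
  by move=> [k _ []/= ? ?]; split; exists k.
move=> i; have [mFi Fioo] := Foo i; have [mGi Gioo] := Goo i.
have mFG : measurable (F i `*` G i) by exact: measurableX.
split; first by rewrite -[X in measurable X]setTI; exact: measurable_rV_uncons.
rewrite /lebesgue_rV_step /pushforward -comp_preimage.
rewrite (_ : @rV_uncons n \o @rV_cons n = id) ?preimage_id; last first.
  by apply/funext => p /=; rewrite rV_consK.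
by rewrite product_measure1E// lte_mul_pinfty// ge0_fin_numE.
Qed.

HB.instance Definition _ :=
  Measure_isSigmaFinite.Build _ _ _ lebesgue_rV_step step_sigma_finite.

End step.

Fixpoint lebesgue_rV (n : nat) : {sigma_finite_measure set 'rV[R]_n -> \bar R} :=
  match n with
  | 0%N => \d_(0 : 'rV[R]_0)
  | n'.+1 => lebesgue_rV_step (lebesgue_rV n')
  end.

End lebesgue_rV.

Section fourier.
Context {R : realType} {n : nat}.
Implicit Types (f g : 'rV[R]_n -> R[i]) (x w : 'rV[R]_n).

Definition dot x w : R := (x *m w^T) ord0 ord0.

Definition norm2 x : R := Num.sqrt (dot x x).

Definition normc (z : R[i]) : R := ComplexField.Normc.normc z.

Definition cis (t : R) : R[i] := cos t +i* sin t.

Definition cintegral f : R[i] :=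
  (\int[lebesgue_rV n]_x complex.Re (f x))
    +i* (\int[lebesgue_rV n]_x complex.Im (f x)).

Definition square_integrable f : Prop :=
  (fun x => complex.Re (f x)) \in Lfun (lebesgue_rV n) 2%:E /\
  (fun x => complex.Im (f x)) \in Lfun (lebesgue_rV n) 2%:E.

Definition fourier f w : R[i] :=
  cintegral (fun x => f x * cis (- (2 * pi * dot x w))).

Definition truncate (r : R) f x : R[i] := if norm2 x <= r then f x else 0.

(* A square integrable f need not be integrable, so its Fourier transform g is
   the L^2-limit of the transforms of its truncations (Plancherel); g is
   determined up to a null set. *)
Definition is_fourier_transform f g : Prop :=
  square_integrable g /\
  (fun k : nat => \int[lebesgue_rV n]_w
      (normc (fourier (truncate k%:R f) w - g w) ^+ 2)%:E)%E @ \oo --> 0%E.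

(* A kernel that is unimodular and invariant under time translation, reversal
   and scaling; phi1 is the one-variable function written with the same letter
   as phi. The second condition forces phi and phi1 to be constant: take
   z := t + y / 2 to get phi v y = phi1 t for all v, y and t. *)
Definition UMITRSK (phi : 'rV[R]_n -> 'rV[R]_n -> R[i])
    (phi1 : 'rV[R]_n -> R[i]) : Prop :=
  (forall v y, `|phi v y| = 1) /\
  (forall v z t, phi v (2 *: (z - t)) = phi1 t).

(* The Cohen class distribution of f once the inner integral over v has been
   evaluated as the distribution phi1 y * delta (x - z). *)
Definition C_UMITRSK (phi1 : 'rV[R]_n -> R[i]) f x w : R[i] :=
  cintegral (fun y => f (x + 2^-1 *: y) * (f (x - 2^-1 *: y))^* * phi1 y
                        * cis (- (2 * pi * dot y w))).

End fourier.

Section spread.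
Context {R : realType} {n : nat} d (T : measurableType d).
Variable m : {measure set T -> \bar R}.
Implicit Types (pos : T -> 'rV[R]_n) (rho : T -> R).

Definition centroid pos rho : 'rV[R]_n :=
  \row_i ((\int[m]_t (pos t ord0 i * rho t)) / (\int[m]_t rho t)).

(* Extended real: a divergent second moment gives +oo, not a default value. *)
Definition spread pos rho : \bar R :=
  ((\int[m]_t (norm2 (pos t - centroid pos rho) ^+ 2 * rho t)%:E)
     / (\int[m]_t (rho t)%:E))%E.

End spread.

Section spread_tf.
Context {R : realType} {n : nat}.
Implicit Type C : 'rV[R]_n -> 'rV[R]_n -> R[i].

Definition spread_x C : \bar R :=
  spread (lebesgue_rV n \x lebesgue_rV n)%E fst
    (fun p => normc (C p.1 p.2) ^+ 2).

Definition spread_w C : \bar R :=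
  spread (lebesgue_rV n \x lebesgue_rV n)%E snd
    (fun p => normc (C p.1 p.2) ^+ 2).

Definition optimal_gaussian (f : 'rV[R]_n -> R) : Prop :=
  exists zeta eps : R, 0 < zeta /\
    forall x, f x = expR (- (1 / (2 * zeta)) *
      norm2 (x - centroid (lebesgue_rV n) id (fun y => `|f y| ^+ 2)) ^+ 2
      + eps).

End spread_tf.

(* Main.v *)
(** The conditions on [phi] make it a constant sign, so that [C x] is, up to
    this sign, the Fourier transform of [y |-> f (x + y/2) * f (x - y/2)].
    With [A h] the autocorrelation of [f], Plancherel and the measure-preserving
    change of variables [(x, y) |-> (x + y/2, x - y/2)] turn the integral of
    [|C|^2] into [(A 0)^2], its x-moments into moments of [f], and give
      [\iint |C|^2 (2 - 2 cos (2 pi h.w)) = 2 ((A 0)^2 - (A (h/2))^2)],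
    which determines the w-moments without differentiating [f].  Expanding the
    square norm of the residual
      [(f (x + t e_i) - f (x - t e_i)) / (2 t) + (x_i - p_i) f x / z],
    letting [t] tend to 0, summing over [i] and choosing the best [z] gives the
    inequality.  Under equality the residuals tend to 0 in [L^2]; integrated
    along the coordinate lines, this says that [f x * exp (|x - p|^2 / (2 z))] is
    almost everywhere invariant under translation, and the continuity of [f]
    along these lines makes it constant.  Conversely, for a Gaussian the moments
    are bounded by Fatou's lemma applied to the same difference quotients. *)

Require Import Defs.
From mathcomp Require Import all_boot all_order all_algebra.
From mathcomp Require Import all_classical all_reals all_analysis.
From mathcomp Require Import measurable_realfun complex ring lra.
Import Order.TTheory GRing.Theory Num.Theory.
Import numFieldNormedType.Exports.

Set Implicit Arguments.
Unset Strict Implicit.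
Unset Printing Implicit Defensive.

Local Open Scope classical_set_scope.
Local Open Scope ring_scope.

(** * Change of variables and null sets in R^n *)

(** Partial derivatives at each point give neither an integrable gradient nor joint continuity, so
    integration by parts has no direct meaning. What survives is the quadratic information in [A]:
    [A 0 - A h] is half the squared norm of [f (x + h) - f x], and pairing a central difference with
    [(x_i - p_i) f x] gives an exact multiple of [A], by translation invariance alone. The w-moments
    may be infinite, so they stay extended reals, and two one-sided estimates replace an identity:
    [2 - 2 cos s <= s ^ 2] bounds increments of [A ^ 2] by the moment, and Fatou's lemma gives the
    other direction. For the constant, let [X] be the sum of the squared norms of [(x_i - p_i) f],
    with [p] the centroid of [|C|^2], and [v] the sum of the integrals of [(2 pi w_i) ^ 2 |C|^2].
    The x-spread is at least [X / (2 A 0)], the w-spread is [v / (4 pi^2 (A 0)^2)], and the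
    residuals give [8 v X >= N^2 (A 0)^3]. The factor 1/4 is made of two halves: [x] is the midpoint
    of two independent copies of the variable of [f], and the square and the half step in
    [(A (h/2))^2] act likewise on frequencies. *)

Lemma rV_cons0 (R : realType) n (a : R) (y : 'rV[R]_n) : rV_cons (a, y) ord0 ord0 = a.
Proof.
have -> : @ord0 n = lshift n (@ord0 0) by exact: val_inj.
by rewrite /rV_cons (row_mxEl (const_mx _ : 'rV_1)) mxE.
Qed.

Lemma rV_consS (R : realType) n (a : R) (y : 'rV[R]_n) i :
  rV_cons (a, y) ord0 (lift ord0 i) = y ord0 i.
Proof.
have -> : lift ord0 i = rshift 1 i by exact: val_inj.
by rewrite /rV_cons (row_mxEr (const_mx _ : 'rV_1)).
Qed.

Definition rV_consE := (rV_cons0, rV_consS).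

Lemma rV_consP (R : realType) n (x : 'rV[R]_n.+1) :
  x = rV_cons (x ord0 ord0, \row_i x ord0 (lift ord0 i)).
Proof.
by apply/rowP => i; case: (unliftP ord0 i) => [j|] ->; rewrite rV_consE// mxE.
Qed.

Lemma ge0_integral_lebesgue_rVS (R : realType) n (F : 'rV[R]_n.+1 -> \bar R) :
  measurable_fun setT F -> (forall x, 0 <= F x)%E ->
  (\int[lebesgue_rV n.+1]_x F x =
   \int[lebesgue_measure]_a \int[lebesgue_rV n]_y F (rV_cons (a, y)))%E.
Proof.
move=> mF F0.
have mFc := measurableT_comp mF (@measurable_rV_cons R n).
rewrite -[RHS](fubini_tonelli1 (F \o (@rV_cons R n)))//; last by move=> ?; exact: F0.
have := ge0_integral_pushforward (@measurable_rV_cons R n)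
  (lebesgue_measure \x lebesgue_rV n)%E measurableT mF (fun y _ => F0 y).
by rewrite preimage_setT.
Qed.

Lemma measurable_affine_rV (R : realType) n (c : R) (h : 'rV[R]_n) :
  measurable_fun setT (fun x : 'rV[R]_n => c *: x + h).
Proof.
apply: measurable_fun_rVP => i.
under eq_fun do rewrite !mxE.
apply: measurable_funD => //; apply: measurable_funM => //.
exact: measurable_coord.
Qed.

(** Lebesgue measure is determined by its values on half-open intervals, and the image measure under
    [a |-> c * a + h], scaled by [|c|], has the same values there. *)
Lemma ge0_integral_affine1 (R : realType) (c h : R) (F : R -> \bar R) :
  c != 0 -> measurable_fun setT F -> (forall x, 0 <= F x)%E ->
  (\int[lebesgue_measure]_a F (c * a + h)%R = `|c|^-1%:E * \int[lebesgue_measure]_a F a)%E.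
Proof.
move=> c0 mF F0.
have mT : measurable_fun setT (fun a : measurableTypeR R => c * a + h : measurableTypeR R).
  by apply: measurable_funD => //; exact: measurable_funM.
have k0 : 0 <= `|c| by [].
pose pm := measure_function_pushforward__canonical__measure_function_Measure
  (@lebesgue_measure R) mT.
pose m := mscale (NngNum k0) pm.
have E A : measurable A -> lebesgue_measure A = m A.
  apply: lebesgue_measure_unique => _ [[a b]] _ <-.
  rewrite /m/= /mscale/= /pm/= /pushforward.
  have [cp|cn] := ltP 0 c.
    rewrite (_ : _ @^-1` _ = `](a - h) / c, (b - h) / c]%classic); last first.
      apply/seteqP; split => x /=; rewrite !in_itv/=.
        by rewrite ltr_pdivrMr// ler_pdivlMr// lerBrDr ltrBlDr mulrC.
      by rewrite ltr_pdivrMr// ler_pdivlMr// lerBrDr ltrBlDr mulrC.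
    rewrite !lebesgue_measure_itv/= !lte_fin ltr_pM2r ?invr_gt0// ltrD2r.
    case: ifP => _; last by rewrite mule0.
    by rewrite -!EFinD -EFinM gtr0_norm//; congr EFin; field.
  (* A negative slope exchanges the ends: the preimage of []a, b]] is closed on the left and open on
     the right. *)
  have {cn}cn : c < 0 by rewrite lt_neqAle c0.
  rewrite (_ : _ @^-1` _ = `[(b - h) / c, (a - h) / c[%classic); last first.
    apply/seteqP; split => x /=; rewrite !in_itv/=.
      by rewrite ler_ndivrMr// ltr_ndivlMr// lerBrDr ltrBlDr mulrC andbC.
    by rewrite ler_ndivrMr// ltr_ndivlMr// lerBrDr ltrBlDr mulrC andbC.
  rewrite !lebesgue_measure_itv/= !lte_fin ltr_nM2r ?invr_lt0// ltrD2r.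
  case: ifP => _; last by rewrite mule0.
  by rewrite -!EFinD -EFinM ltr0_norm//; congr EFin; field.
have -> : (\int[lebesgue_measure]_a F a = \int[m]_a F a)%E.
  by apply: (@eq_measure_integral _ _ _ _ m) => A mA _; exact: E.
rewrite ge0_integral_mscale//= ge0_integral_pushforward//=.
by rewrite muleA -EFinM mulVf ?normr_eq0// mul1e.
Qed.

Lemma ge0_integral_affine (R : realType) n (c : R) (h : 'rV[R]_n) (F : 'rV[R]_n -> \bar R) :
  c != 0 -> measurable_fun setT F -> (forall x, 0 <= F x)%E ->
  (\int[lebesgue_rV n]_x F (c *: x + h)%R = (`|c| ^- n)%:E * \int[lebesgue_rV n]_x F x)%E.
Proof.
move=> c0; elim: n h F => [|n IH] h F mF F0.
  rewrite expr0 invr1 mul1e; apply: eq_integral => x _; congr F.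
  by apply/rowP; case.
rewrite !ge0_integral_lebesgue_rVS//; last first.
  exact: measurableT_comp mF (measurable_affine_rV c h).
have mI : measurable_fun setT (fun a => \int[lebesgue_rV n]_y F (rV_cons (a, y)))%E.
  apply: (measurable_fun_fubini_tonelli_F (F \o (@rV_cons R n))) => [|?].
    exact: measurableT_comp mF (@measurable_rV_cons R n).
  exact: F0.
pose h0 := h ord0 ord0; pose h1 := \row_i h ord0 (lift ord0 i).
have E a y : c *: rV_cons (a, y) + h = rV_cons (c * a + h0, c *: y + h1).
  by apply/rowP => i; case: (unliftP ord0 i) => [j|] ->; rewrite !(rV_consE, mxE).
transitivity (\int[lebesgue_measure]_a ((`|c| ^- n)%:E *
    \int[lebesgue_rV n]_y F (rV_cons ((c * a + h0)%R, y))))%E.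
  apply: eq_integral => a _.
  rewrite -(IH h1 (fun y => F (rV_cons (c * a + h0, y))))//; last first.
    apply: measurableT_comp mF _; apply: measurableT_comp (@measurable_rV_cons R n) _.
    exact: pair1_measurable.
  by apply: eq_integral => y _; rewrite E.
have mIc : measurable_fun setT (fun a : measurableTypeR R =>
    \int[lebesgue_rV n]_y F (rV_cons ((c * a + h0)%R, y)))%E.
  by apply: measurableT_comp mI _; apply: measurable_funD => //; exact: measurable_funM.
rewrite (ge0_integralZl _ measurableT mIc); last 2 first.
- by move=> a _; exact: integral_ge0.
- by rewrite lee_fin invr_ge0 exprn_ge0.
rewrite (ge0_integral_affine1 _ c0 mI); last by move=> a; exact: integral_ge0.
by rewrite muleA -EFinM exprS invfM [X in (X%:E * _)%E]mulrC.
Qed.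

Lemma ge0_integral_shift (R : realType) n (h : 'rV[R]_n) (F : 'rV[R]_n -> \bar R) :
  measurable_fun setT F -> (forall x, 0 <= F x)%E ->
  (\int[lebesgue_rV n]_x F (x + h)%R = \int[lebesgue_rV n]_x F x)%E.
Proof.
move=> mF F0; rewrite -[RHS]mul1e; transitivity (\int[lebesgue_rV n]_x F (1 *: x + h)%R)%E.
  by apply: eq_integral => x _; rewrite scale1r.
by rewrite ge0_integral_affine ?oner_eq0// normr1 expr1n invr1.
Qed.

Lemma ge0_integral_opp (R : realType) n (F : 'rV[R]_n -> \bar R) :
  measurable_fun setT F -> (forall x, 0 <= F x)%E ->
  (\int[lebesgue_rV n]_x F (- x)%R = \int[lebesgue_rV n]_x F x)%E.
Proof.
move=> mF F0; rewrite -[RHS]mul1e; transitivity (\int[lebesgue_rV n]_x F (-1 *: x + 0)%R)%E.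
  by apply: eq_integral => x _; rewrite scaleN1r addr0.
by rewrite ge0_integral_affine ?oppr_eq0 ?oner_eq0// normrN1 expr1n invr1.
Qed.

(** Carries a change of variables from nonnegative to integrable functions: the rule applied to the
    absolute value gives integrability, and applied to the positive and negative parts it gives the
    value. *)
Lemma integral_comp_scale d1 d2 (T1 : measurableType d1) (T2 : measurableType d2)
    (R : realType) (m1 : {measure set T1 -> \bar R}) (m2 : {measure set T2 -> \bar R})
    (T : T1 -> T2) (k : R) :
  measurable_fun setT T -> 0 <= k ->
  (forall F : T2 -> \bar R, measurable_fun setT F -> (forall x, 0 <= F x)%E ->
    \int[m1]_x F (T x) = k%:E * \int[m2]_x F x)%E ->
  forall f : T2 -> R, m2.-integrable setT (EFin \o f) ->
  m1.-integrable setT (EFin \o (f \o T)) /\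
  \int[m1]_x f (T x) = k * \int[m2]_x f x.
Proof.
move=> mT k0 H f /[dup] fi /integrableP[mf flty].
have mfT : measurable_fun setT (EFin \o (f \o T)) by exact: measurableT_comp mf mT.
have fTi : m1.-integrable setT (EFin \o (f \o T)).
  apply/integrableP; split=> //.
  by rewrite (H (abse \o (EFin \o f))) => [||x];
    [exact: lte_mul_pinfty|exact: measurableT_comp|exact: abse_ge0].
split => //.
rewrite /Rintegral.
have -> : (\int[m1]_x (f (T x))%:E = k%:E * \int[m2]_x (f x)%:E)%E.
  rewrite integralE [in RHS]integralE muleBr//; last first.
    exact: integrable_add_def fi.
  have Hp := H (EFin \o f)^\+%E (measurable_funepos mf) (@funepos_ge0 _ _ _).
  have Hn := H (EFin \o f)^\-%E (measurable_funeneg mf) (@funeneg_ge0 _ _ _).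
  by rewrite -Hp -Hn; congr (_ - _)%E; apply: eq_integral => x _; rewrite ?funeposE ?funenegE.
by rewrite fineM//; exact: integrable_fin_num.
Qed.


Lemma integrable_affine (R : realType) n (c : R) (h : 'rV[R]_n) (f : 'rV[R]_n -> R) :
  c != 0 -> (lebesgue_rV n).-integrable setT (EFin \o f) ->
  (lebesgue_rV n).-integrable setT (EFin \o (fun x => f (c *: x + h))) /\
  \int[lebesgue_rV n]_x f (c *: x + h) = `|c| ^- n * \int[lebesgue_rV n]_x f x.
Proof.
move=> c0 fi.
have k0 : 0 <= `|c| ^- n by rewrite invr_ge0 exprn_ge0.
apply: (integral_comp_scale (measurable_affine_rV c h) k0 _ fi) => F mF F0.
exact: ge0_integral_affine.
Qed.

Lemma integrable_shift (R : realType) n (h : 'rV[R]_n) (f : 'rV[R]_n -> R) :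
  (lebesgue_rV n).-integrable setT (EFin \o f) ->
  (lebesgue_rV n).-integrable setT (EFin \o (fun x => f (x + h))).
Proof.
move=> /(integrable_affine h (oner_neq0 R))[+ _].
by under [X in EFin \o X]eq_fun do rewrite scale1r.
Qed.

Lemma Rintegral_shift (R : realType) n (h : 'rV[R]_n) (f : 'rV[R]_n -> R) :
  (lebesgue_rV n).-integrable setT (EFin \o f) ->
  \int[lebesgue_rV n]_x f (x + h) = \int[lebesgue_rV n]_x f x.
Proof.
move=> /(integrable_affine h (oner_neq0 R))[_].
rewrite normr1 expr1n invr1 mul1r => <-.
by apply: eq_Rintegral => x _; rewrite scale1r.
Qed.

(** Tonelli's theorem for the indicator of a null set: the measures of its sections integrate to 0,
    so almost all sections are null. *)
Lemma ae_product d1 d2 (T1 : measurableType d1) (T2 : measurableType d2)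
    (R : realType) (m1 : {sigma_finite_measure set T1 -> \bar R})
    (m2 : {sigma_finite_measure set T2 -> \bar R}) (P : T1 * T2 -> Prop) :
  (\forall z \ae (m1 \x m2)%E, P z) ->
  \forall x \ae m1, \forall y \ae m2, P (x, y).
Proof.
case=> N [mN N0 PN].
have mI : measurable_fun setT (EFin \o (\1_N : _ -> R)).
  by apply/measurable_EFinP; exact: measurable_indic.
have I0 : (\int[m1]_x `|\int[m2]_y (\1_N (x, y))%:E| = 0)%E.
  transitivity (\int[m1 \x m2]_z (\1_N z)%:E)%E; last by rewrite integral_indic// setIT.
  rewrite (fubini_tonelli1 (EFin \o (\1_N : _ -> R)))//; last first.
    by move=> z; rewrite /= lee_fin.
  by apply: eq_integral => x _; rewrite gee0_abs// integral_ge0// => y _; rewrite lee_fin.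
have mF : measurable_fun setT (fun x => \int[m2]_y (\1_N (x, y))%:E)%E.
  apply: (measurable_fun_fubini_tonelli_F (EFin \o (\1_N : _ -> R)))=> // z.
  by rewrite /= lee_fin.
move/(ae_eq_integral_abs m1 measurableT mF) : I0.
apply: filterS => x /(_ I) /= Ix.
exists (xsection N x); split; first exact: measurable_xsection.
  have mNx : measurable (xsection N x) by exact: measurable_xsection.
  rewrite -[X in m2 X]setIT -integral_indic// -[RHS]Ix.
  by apply: eq_integral => y _ /=; rewrite !indicE mem_xsection.
by move=> y /= nP; rewrite /xsection/= inE; exact: PN.
Qed.

Lemma ae_lebesgue_rVS (R : realType) n (P : 'rV[R]_n.+1 -> Prop) :
  (\forall x \ae lebesgue_rV n.+1, P x) ->
  \forall a \ae @lebesgue_measure R, \forall y \ae lebesgue_rV n, P (rV_cons (a, y)).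
Proof.
case=> N [mN N0 PN]; apply: (ae_product (P := P \o @rV_cons R n)).
exists (@rV_cons R n @^-1` N); split => //; last by move=> z; exact: PN.
by rewrite -[X in measurable X]setTI; exact: measurable_rV_cons.
Qed.

Lemma ae_eq0_continuous (R : realType) (g : R -> R) : continuous g ->
  (\forall a \ae @lebesgue_measure R, g a = 0) -> forall a, g a = 0.
Proof.
move=> cg [N [mN N0 gN]] a; apply/eqP/negPn/negP => ga.
have : \forall x \near a, g x != 0.
  exact: (cg a [set y | y != 0] (open_nbhs_nbhs (conj (@open_neq _ _) ga))).
move=> /nbhs_ballP[e /= e0 He].
have : (lebesgue_measure (ball a e) <= lebesgue_measure N)%E.
  apply: le_measure; rewrite ?inE//; first exact: measurable_ball.
  by move=> x /He /eqP gx; exact: gN.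
by rewrite N0 lebesgue_measure_ball ?(ltW e0)// lee_fin leNgt mulrn_wgt0.
Qed.

(* Partial differentiability provides this, but not joint continuity. *)
Definition sepcont (R : realType) n (g : 'rV[R]_n -> R) :=
  forall x i, continuous (fun s : R => g (x + s *: delta_mx ord0 i)).

(** Separate continuity is enough because coordinates are peeled off one at a time: almost every
    slice vanishes almost everywhere, hence everywhere by induction, and continuity in the first
    coordinate reaches the exceptional slices. *)
Lemma ae_eq0_sepcont (R : realType) n (g : 'rV[R]_n -> R) : sepcont g ->
  (\forall x \ae lebesgue_rV n, g x = 0) -> forall x, g x = 0.
Proof.
elim: n g => [|n IH] g cg.
  (* In dimension 0 the measure is the Dirac mass at the only point, so a null set is empty. *)
  move=> [N [mN N0 gN]] x; apply: contrapT => gx.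
  have := gN _ gx; rewrite (_ : x = 0) => [N0'|]; last by apply/rowP; case.
  move: N0; rewrite /= diracE mem_set// => /eqP; rewrite ?eqe oner_eq0//.
move=> /ae_lebesgue_rVS H.
have cons_shift0 a (y : 'rV[R]_n) s :
    rV_cons (a, y) + s *: delta_mx ord0 ord0 = rV_cons (a + s, y).
  apply/rowP => i; case: (unliftP ord0 i) => [j|] ->; rewrite !(rV_consE, mxE).
    by rewrite mulr0 addr0.
  by rewrite mulr1.
have cons_shiftS a (y : 'rV[R]_n) s k :
    rV_cons (a, y) + s *: delta_mx ord0 (lift ord0 k) = rV_cons (a, y + s *: delta_mx ord0 k).
  apply/rowP => i; case: (unliftP ord0 i) => [j|] ->; rewrite !(rV_consE, mxE).
    by rewrite (inj_eq lift_inj).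
  by rewrite mulr0 addr0.
have {H}H : \forall a \ae @lebesgue_measure R, forall y, g (rV_cons (a, y)) = 0.
  apply: filterS H => a; apply: IH => y i.
  by under eq_fun do rewrite -cons_shiftS; exact: cg.
move=> x.
move: (x ord0 ord0) (\row_i _) (rV_consP x) => a y ->.
apply: (@ae_eq0_continuous _ (fun a => g (rV_cons (a, y)))).
  have := cg (rV_cons (0, y)) ord0.
  by under eq_fun do rewrite cons_shift0 add0r.
by apply: filterS H => b; apply.
Qed.

(** * Square integrable functions and autocorrelation *)

Section square_integrable_functions.
Context d (T : measurableType d) (R : realType) (mu : {measure set T -> \bar R}).
Implicit Types f g : T -> R.

Definition L2 f := measurable_fun setT f /\
  mu.-integrable setT (EFin \o (fun x => f x ^+ 2)).

Lemma le_Rintegrable f g : measurable_fun setT f ->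
  (forall x, `|f x| <= g x) -> mu.-integrable setT (EFin \o g) ->
  mu.-integrable setT (EFin \o f).
Proof.
move=> mf fg; apply: le_integrable => //; first exact/measurable_EFinP.
by move=> x _ /=; rewrite lee_fin (le_trans (fg x))// ler_norm.
Qed.

Lemma L2M f g : L2 f -> L2 g -> mu.-integrable setT (EFin \o (fun x => f x * g x)).
Proof.
move=> [mf fi] [mg gi].
apply: (le_Rintegrable (g := fun x => f x ^+ 2 + g x ^+ 2)).
- exact: measurable_funM.
- move=> x; rewrite normrM -(real_normK (num_real (f x))) -(real_normK (num_real (g x))).
  by have := sqr_ge0 (`|f x| - `|g x|); have := sqr_ge0 `|f x|; have := sqr_ge0 `|g x|; lra.
- exact: (integrableD measurableT fi gi).
Qed.

Lemma L2D f g : L2 f -> L2 g -> L2 (fun x => f x + g x).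
Proof.
move=> [mf fi] [mg gi]; split; first exact: measurable_funD.
apply: (le_Rintegrable (g := fun x => 2 * (f x ^+ 2 + g x ^+ 2))).
- by apply: measurable_funX; exact: measurable_funD.
- by move=> x; rewrite ger0_norm ?sqr_ge0//; have := sqr_ge0 (f x - g x); lra.
- exact: (integrableZl measurableT 2 (integrableD measurableT fi gi)).
Qed.

Lemma L2Z f k : L2 f -> L2 (fun x => k * f x).
Proof.
move=> [mf fi]; split; first exact: measurable_funM.
under [X in EFin \o X]eq_fun do rewrite exprMn.
exact: (integrableZl measurableT (k ^+ 2) fi).
Qed.

Lemma L2B f g : L2 f -> L2 g -> L2 (fun x => f x - g x).
Proof.
move=> lf lg; have := L2D lf (L2Z (-1) lg).
by under [X in L2 X]eq_fun do rewrite mulN1r.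
Qed.

Definition ip f g := \int[mu]_x (f x * g x).

Lemma ipC f g : ip f g = ip g f.
Proof. by apply: eq_Rintegral => x _; rewrite mulrC. Qed.

Lemma ip_ge0 f : 0 <= ip f f.
Proof. by apply: Rintegral_ge0 => x _; rewrite -expr2 sqr_ge0. Qed.

Lemma ipDl f g k : L2 f -> L2 g -> L2 k -> ip (fun x => f x + g x) k = ip f k + ip g k.
Proof.
move=> lf lg lk; rewrite /ip -RintegralD//; [|exact: L2M..].
by apply: eq_Rintegral => x _; rewrite mulrDl.
Qed.

Lemma ipZl f g a : L2 f -> L2 g -> ip (fun x => a * f x) g = a * ip f g.
Proof.
move=> lf lg; rewrite /ip -RintegralZl//; last exact: L2M.
by apply: eq_Rintegral => x _; rewrite mulrA.
Qed.

Lemma ip_sqrD f g a b : L2 f -> L2 g ->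
  ip (fun x => a * f x + b * g x) (fun x => a * f x + b * g x) =
  a ^+ 2 * ip f f + 2 * a * b * ip f g + b ^+ 2 * ip g g.
Proof.
move=> lf lg; have laf := L2Z a lf; have lbg := L2Z b lg.
have lab := L2D laf lbg.
rewrite (ipDl laf lbg lab) (ipZl a lf lab) (ipZl b lg lab) (ipC f) (ipC g).
rewrite (ipDl laf lbg lf) (ipDl laf lbg lg) !(ipZl a lf) // !(ipZl b lg) //.
rewrite (ipC g f); ring.
Qed.

Lemma ip_sqr f : L2 f -> (\int[mu]_x (f x ^+ 2)%:E = (ip f f)%:E)%E.
Proof.
move=> [_ fi]; rewrite /ip /Rintegral fineK//.
exact: integrable_fin_num.
Qed.

(** Fatou's lemma in a form where the integrals are only bounded by a convergent sequence; their own
    convergence is not asked for. *)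
Lemma fatou_cvg (F : (T -> R)^nat) (G : T -> R) (c : R^nat) (l : R) :
  (forall k, measurable_fun setT (F k)) -> (forall k x, 0 <= F k x) ->
  (forall x, F ^~ x @ \oo --> G x) ->
  (forall k, \int[mu]_x (F k x)%:E <= (c k)%:E)%E -> c @ \oo --> l ->
  (\int[mu]_x (G x)%:E <= l%:E)%E.
Proof.
move=> mF F0 FG Fc cl.
have := fatou mu measurableT (f := fun k x => (F k x)%:E)
  (fun k => (measurable_EFinP _ _).2 (mF k)) (fun k x _ => F0 k x).
under eq_integral => x _.
  rewrite (_ : limn_einf _ = (G x)%:E); last first.
    have /cvg_limn_einf_sup[-> _]// : (fun k => (F k x)%:E) @ \oo --> (G x)%:E.
    by apply: cvg_EFin; [exact: nearW|exact: FG].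
  over.
move/le_trans; apply.
have /cvg_limn_einf_sup[<- _] : (fun k => (c k)%:E) @ \oo --> l%:E.
  by apply: cvg_EFin; [exact: nearW|exact: cl].
rewrite !limn_einf_lim; apply: lee_lim; [exact: is_cvg_einfs..|].
apply: nearW => k; apply: le_ereal_inf_tmp => _ [m /= km <-].
by apply: le_trans (Fc m); apply: ereal_inf_lbound; exists m.
Qed.

End square_integrable_functions.


Section autocorrelation.
Context (R : realType) (n : nat).
Local Notation mu := (@lebesgue_rV R n).
Implicit Types (f : 'rV[R]_n -> R) (h : 'rV[R]_n).

Lemma measurable_shift_rV h : measurable_fun setT (fun x : 'rV[R]_n => x + h).
Proof.
have := measurable_affine_rV 1 h.
by under eq_fun do rewrite scale1r.
Qed.

Lemma L2_affine (c : R) h f : c != 0 -> L2 mu f -> L2 mu (fun x => f (c *: x + h)).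
Proof.
move=> c0 [mf fi]; split; first exact: measurableT_comp mf (measurable_affine_rV c h).
by have [] := integrable_affine h c0 fi.
Qed.

Lemma L2_shift h f : L2 mu f -> L2 mu (fun x => f (x + h)).
Proof.
move=> /(L2_affine h (oner_neq0 R)).
by under [X in L2 _ X]eq_fun do rewrite scale1r.
Qed.

Lemma ip_shift h f g : L2 mu f -> L2 mu g ->
  ip mu (fun x => f (x + h)) (fun x => g (x + h)) = ip mu f g.
Proof.
by move=> lf lg; exact: (Rintegral_shift h (L2M lf lg)).
Qed.

Definition corr f h := ip mu (fun x => f (x + h)) f.

Lemma corr0 f : corr f 0 = ip mu f f.
Proof. by rewrite /corr; under [X in ip _ X]eq_fun do rewrite addr0. Qed.

Lemma ip_shifts f a b : L2 mu f ->
  ip mu (fun x => f (x + a)) (fun x => f (x + b)) = corr f (a - b).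
Proof.
move=> lf; rewrite -(ip_shift (- b)); [|exact: L2_shift..].
rewrite /corr; congr ip; apply/funext => x; first by rewrite addrAC addrA.
by rewrite subrK.
Qed.

Lemma corrN f h : L2 mu f -> corr f (- h) = corr f h.
Proof.
move=> lf; rewrite -[- h]add0r -ip_shifts// ipC /corr.
by congr ip; apply/funext => x; rewrite addr0.
Qed.

Lemma ip_diff f a b : L2 mu f ->
  ip mu (fun x => f (x + a) - f (x + b)) (fun x => f (x + a) - f (x + b)) =
  2 * (corr f 0 - corr f (a - b)).
Proof.
move=> lf.
have E := ip_sqrD 1 (-1) (L2_shift a lf) (L2_shift b lf).
rewrite !ip_shifts// !subrr in E.
transitivity (1 ^+ 2 * corr f 0 + 2 * 1 * -1 * corr f (a - b) + (-1) ^+ 2 * corr f 0).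
  by rewrite -E; congr ip; apply/funext => x; rewrite mul1r mulN1r.
ring.
Qed.

(** Cauchy-Schwarz for two translates of equal norm, read off from the squared norms of their sum
    and difference. *)
Lemma normr_corr f h : L2 mu f -> `|corr f h| <= corr f 0.
Proof.
move=> lf.
have P b : 0 <= corr f 0 + b * corr f h * 2 + b ^+ 2 * corr f 0.
  have lfh := L2_shift h lf.
  have := ip_ge0 mu (fun x => 1 * f (x + h) + b * f x).
  rewrite ip_sqrD// ip_shifts// subrr -(corr0 f) -/(corr f h); lra.
by rewrite ler_norml; have := P 1; have := P (-1); lra.
Qed.

(** Continuity of translation in [L2] without approximation by regular functions. Along a coordinate
    line the translates converge pointwise, so Fatou's lemma bounds the lower limit of the squared
    norm [2 A 0 + 2 A (u k e_i)] of [f + f (. + u k e_i)] below by [4 A 0]; Cauchy-Schwarz is the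
    matching upper bound. *)
Lemma corr_cvg1 f i (u : R^nat) : sepcont f -> L2 mu f -> u @ \oo --> 0 ->
  corr f (u k *: delta_mx ord0 i) @[k --> \oo] --> corr f 0.
Proof.
move=> cf lf u0; pose e : 'rV[R]_n := delta_mx ord0 i.
pose v k := ((2 * corr f 0 + 2 * corr f (u k *: e))%:E)%E.
have vE k : v k = (\int[mu]_x ((f x + f (x + (u k *: e))) ^+ 2)%:E)%E.
  have lfk := L2_shift (u k *: e) lf.
  rewrite ip_sqr; last exact: L2D.
  rewrite /v; congr EFin.
  have := ip_sqrD 1 1 lf lfk.
  rewrite ip_shifts// subrr -(corr0 f) (ipC _ f) -/(corr f _) => E.
  rewrite [RHS](_ : _ = ip mu (fun x => 1 * f x + 1 * f (x + u k *: e))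
      (fun x => 1 * f x + 1 * f (x + u k *: e))).
    rewrite E; ring.
  by congr ip; apply/funext => x; rewrite !mul1r.
(* The sign change turns the lower limit of Fatou's lemma into the upper limit that
   [limn_esup_le_cvg] expects. *)
suff : (fun k => - v k)%E @ \oo --> (- (4 * corr f 0)%:E)%E.
  move=> /cvgeN; rewrite oppeK; under eq_fun do rewrite oppeK.
  move=> /fine_cvg vc.
  have -> : (fun k => corr f (u k *: e)) = (fun k => 2^-1 * (fine (v k)) - corr f 0).
    by apply/funext => k; rewrite /v /=; field.
  have : (fun k => 2^-1 * fine (v k) - corr f 0) @ \oo --> 2^-1 * (4 * corr f 0) - corr f 0.
    by apply: cvgB; [apply: cvgM; [exact: cvg_cst|exact: vc]|exact: cvg_cst].
  by rewrite (_ : 2^-1 * (4 * corr f 0) - corr f 0 = corr f 0)//; field.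
apply: limn_esup_le_cvg; last first.
  move=> k; rewrite leeN2 lee_fin.
  by have := normr_corr (u k *: e) lf; rewrite ler_norml; lra.
rewrite (limn_esupN v) leeN2.
rewrite (_ : v = fun k => (\int[mu]_x ((f x + f (x + (u k *: e))) ^+ 2)%:E)%E); last first.
  by apply/funext => k; exact: vE.
apply: le_trans (fatou _ measurableT _ _); last 2 first.
- move=> k; apply/measurable_EFinP; apply: measurable_funX.
  apply: measurable_funD; first exact: lf.1.
  by case: (L2_shift (u k *: e) lf).
- by move=> k x _; rewrite lee_fin sqr_ge0.
rewrite corr0 -[4](_ : 2 ^+ 2 = _); last by ring.
under [leRHS]eq_integral => x _.
  rewrite (_ : limn_einf _ = ((2 * f x) ^+ 2)%:E); last first.
    have /cvg_limn_einf_sup[-> _]// :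
        (fun k => ((f x + f (x + u k *: e)) ^+ 2)%:E) @ \oo --> ((2 * f x) ^+ 2)%:E.
    apply: cvg_EFin; first exact: nearW.
    rewrite (_ : 2 * f x = f x + f (x + 0 *: e)); last by rewrite scale0r addr0; ring.
    have Hc : f x + f (x + u k *: e) @[k --> \oo] --> f x + f (x + 0 *: e).
      apply: cvgD; first exact: cvg_cst.
      exact: (cvg_comp u (fun s => f (x + s *: e)) u0 (cf x i 0)).
    by rewrite expr2; under eq_fun do rewrite expr2; exact: cvgM.
  over.
rewrite ip_sqr; last exact: L2Z.
rewrite ipZl//; last exact: L2Z.
by rewrite ipC ipZl// mulrA expr2.
Qed.

(** As [corr f 0 - corr f h] is half the squared norm of an increment of [f], this is
    [|p + q|^2 <= 2 |p|^2 + 2 |q|^2] for two consecutive increments. *)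
Lemma corr_defect_subadd f a b : L2 mu f ->
  corr f 0 - corr f (a + b) <= 2 * (corr f 0 - corr f a) + 2 * (corr f 0 - corr f b).
Proof.
move=> lf.
pose p x := f (x + (a + b)) - f (x + b); pose q x := f (x + b) - f (x + 0).
have lp : L2 mu p by apply: L2B; exact: L2_shift.
have lq : L2 mu q by apply: L2B; exact: L2_shift.
have E1 := ip_sqrD 1 1 lp lq; have E2 := ip_sqrD 1 (-1) lp lq.
have Ep := ip_diff (a + b) b lf; have Eq := ip_diff b 0 lf.
have Epq := ip_diff (a + b) 0 lf.
rewrite addrK in Ep; rewrite subr0 in Eq; rewrite subr0 in Epq.
have := ip_ge0 mu (fun x => 1 * p x + -1 * q x).
rewrite E2.
have {}E1 : 2 * (corr f 0 - corr f (a + b)) =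
    1 ^+ 2 * ip mu p p + 2 * 1 * 1 * ip mu p q + 1 ^+ 2 * ip mu q q.
  rewrite -Epq -E1; congr ip; apply/funext => x; rewrite /p /q; ring.
rewrite Ep Eq in E1 *; lra.
Qed.

(** Separate continuity controls only moves along the axes; subadditivity of the defect chains these
    moves, one coordinate of [s] after another. *)
Lemma corr_cvg f (s : 'rV[R]_n) (u : R^nat) : sepcont f -> L2 mu f -> u @ \oo --> 0 ->
  corr f (u k *: s) @[k --> \oo] --> corr f 0.
Proof.
move=> cf lf u0.
suff : corr f 0 - corr f (u k *: s) @[k --> \oo] --> 0.
  move=> /(cvgB (cvg_cst (corr f 0))); rewrite subr0.
  by under [X in X @ _ --> _ -> _]eq_fun do rewrite subKr.
rewrite (row_sum_delta s).
under eq_fun do rewrite scaler_sumr.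
elim: (index_enum _) => [|i r IH].
  under eq_fun do rewrite big_nil subrr.
  exact: cvg_cst.
under eq_fun do rewrite big_cons.
apply: (@squeeze_cvgr _ _ _ _ (cst 0) (fun k =>
   2 * (corr f 0 - corr f (u k *: (s ord0 i *: delta_mx ord0 i)))
   + 2 * (corr f 0 - corr f (\sum_(j <- r) u k *: (s ord0 j *: delta_mx ord0 j))))).
- apply: nearW => k; rewrite corr_defect_subadd// andbT subr_ge0.
  by apply: le_trans (normr_corr _ lf); exact: ler_norm.
- exact: cvg_cst.
- have us0 : u k * s ord0 i @[k --> \oo] --> 0.
    by rewrite -[0](mul0r (s ord0 i)); apply: cvgM; [exact: u0|exact: cvg_cst].
  have : 2 * (corr f 0 - corr f ((u k * s ord0 i) *: delta_mx ord0 i))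
   + 2 * (corr f 0 - corr f (\sum_(j <- r) u k *: (s ord0 j *: delta_mx ord0 j)))
     @[k --> \oo] --> 2 * (corr f 0 - corr f 0) + 2 * 0.
    apply: cvgD; apply: cvgM => //; first exact: cvg_cst.
      by apply: cvgB; [exact: cvg_cst|exact: corr_cvg1].
    exact: cvg_cst.
  rewrite subrr !mulr0 addr0.
  by under eq_fun do rewrite -scalerA.
Qed.

End autocorrelation.

(** * Plancherel's formula, by Poisson-kernel summation *)

Lemma EFin_Rintegral d (T : measurableType d) (R : realType)
    (m : {measure set T -> \bar R}) (f : T -> R) : m.-integrable setT (EFin \o f) ->
  (\int[m]_x f x)%:E = (\int[m]_x (f x)%:E)%E.
Proof. by move=> fi; rewrite /Rintegral fineK//; exact: integrable_fin_num. Qed.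

(** * Fubini's theorem for real-valued integrals *)

Section product_integrals.
Context d1 d2 (T1 : measurableType d1) (T2 : measurableType d2) (R : realType).
Variables (m1 : {sigma_finite_measure set T1 -> \bar R})
          (m2 : {sigma_finite_measure set T2 -> \bar R}).

(** [Rintegral] is [fine] of a difference of two Tonelli integrals, so it is measurable also where
    it takes a default value. *)
Lemma measurable_Rintegral (f : T1 * T2 -> R) : measurable_fun setT f ->
  measurable_fun setT (fun x => \int[m2]_y f (x, y)).
Proof.
move=> /measurable_EFinP mf.
apply: (measurableT_comp (fine_measurable measurableT)).
under eq_fun do rewrite integralE.
apply: emeasurable_funB.
- rewrite (_ : (fun x => _) = fubini_F m2 (EFin \o f)^\+%E); last first.
    by apply/funext => x; apply: eq_integral => y _; rewrite !funeposE.
  apply: measurable_fun_fubini_tonelli_F; first exact: measurable_funepos.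
  by move=> ?; exact: funepos_ge0.
- rewrite (_ : (fun x => _) = fubini_F m2 (EFin \o f)^\-%E); last first.
    by apply/funext => x; apply: eq_integral => y _; rewrite !funenegE.
  apply: measurable_fun_fubini_tonelli_F; first exact: measurable_funeneg.
  by move=> ?; exact: funeneg_ge0.
Qed.

(** Fubini's theorem produces extended-real inner integrals that are finite only almost everywhere;
    this replaces them by a real-valued function. *)
Lemma ae_eq_Rintegral d (T : measurableType d) (m : {measure set T -> \bar R})
    (F : T -> \bar R) (g : T -> R) :
  m.-integrable setT F -> measurable_fun setT g ->
  (\forall x \ae m, F x = (g x)%:E) ->
  m.-integrable setT (EFin \o g) /\ \int[m]_x g x = fine (\int[m]_x F x).
Proof.
move=> iF /measurable_EFinP mg Fg.
have mF := measurable_int _ iF.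
split.
  apply/integrableP; split => //.
  have /integrableP[_] := iF; congr (_ < _)%E.
  apply: ae_eq_integral => //; [exact: measurableT_comp..|].
  by apply: filterS Fg => x + _; move=> /= ->.
congr fine; apply/esym/ae_eq_integral => //.
by apply: filterS Fg => x + _; move=> /= ->.
Qed.

Lemma Rintegral12 (f : T1 * T2 -> R) : (m1 \x m2)%E.-integrable setT (EFin \o f) ->
  m1.-integrable setT (EFin \o (fun x => \int[m2]_y f (x, y))) /\
  \int[m1]_x \int[m2]_y f (x, y) = \int[(m1 \x m2)%E]_z f z.
Proof.
move=> fi.
have mf : measurable_fun setT f by apply/measurable_EFinP; exact: measurable_int fi.
rewrite [X in _ /\ _ = X]/Rintegral -(integral12_prod_meas1 fi).
apply: ae_eq_Rintegral; [exact: integrable_fubini_F|exact: measurable_Rintegral|].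
apply: filterS (ae_integrable1 fi) => x ix.
by rewrite /fubini_F EFin_Rintegral.
Qed.

End product_integrals.

Section product_integrals_swap.
Context d1 d2 (T1 : measurableType d1) (T2 : measurableType d2) (R : realType).
Variables (m1 : {sigma_finite_measure set T1 -> \bar R})
          (m2 : {sigma_finite_measure set T2 -> \bar R}).

Lemma Rintegral21 (f : T1 * T2 -> R) : (m1 \x m2)%E.-integrable setT (EFin \o f) ->
  m2.-integrable setT (EFin \o (fun y => \int[m1]_x f (x, y))) /\
  \int[m2]_y \int[m1]_x f (x, y) = \int[(m1 \x m2)%E]_z f z.
Proof.
move=> fi.
pose sw (z : T2 * T1) := (z.2, z.1).
have msw : measurable_fun setT sw.
  by apply/measurable_fun_pairP; split; [exact: measurable_snd|exact: measurable_fst].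
have H (F : T1 * T2 -> \bar R) : measurable_fun setT F -> (forall z, 0 <= F z)%E ->
    (\int[m2 \x m1]_z F (sw z) = 1%:E * \int[m1 \x m2]_z F z)%E.
  move=> mF F0; rewrite mul1e (fubini_tonelli2 F)//.
  rewrite (fubini_tonelli1 (F \o sw))//; last by move=> z; exact: F0.
  exact: measurableT_comp mF msw.
have [swi swE] := integral_comp_scale msw ler01 H fi.
by have := Rintegral12 swi; rewrite /= swE mul1r.
Qed.

Lemma integrable_tensor (u : T1 -> R) (v : T2 -> R) :
  m1.-integrable setT (EFin \o u) -> m2.-integrable setT (EFin \o v) ->
  (m1 \x m2)%E.-integrable setT (EFin \o (fun z => u z.1 * v z.2)) /\
  \int[(m1 \x m2)%E]_z (u z.1 * v z.2) = (\int[m1]_x u x) * (\int[m2]_y v y).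
Proof.
move=> iu iv.
have mu : measurable_fun setT u by apply/measurable_EFinP; exact: measurable_int iu.
have mv : measurable_fun setT v by apply/measurable_EFinP; exact: measurable_int iv.
have iuv : (m1 \x m2)%E.-integrable setT (EFin \o (fun z => u z.1 * v z.2)).
  apply/integrable12ltyP.
    apply/measurable_EFinP; apply: measurable_funM; exact: measurableT_comp.
  have iu' := integrable_norm iu; have iv' := integrable_norm iv.
  rewrite (_ : (\int[m1]_x _ = (\int[m1]_x `|u x|)%:E * (\int[m2]_y `|v y|)%:E)%E) ?ltry//.
  rewrite [X in (_ * X)%E]EFin_Rintegral// muleC EFin_Rintegral// -ge0_integralZl//; last 2 first.
  - by apply/measurable_EFinP; exact: measurableT_comp.
  - exact: integral_ge0.
  apply: eq_integral => x _; rewrite muleC -ge0_integralZl//; last first.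
    by apply/measurable_EFinP; exact: measurableT_comp.
  by apply: eq_integral => y _; rewrite /= normrM.
split => //.
rewrite -(Rintegral12 iuv).2 /=.
under eq_Rintegral => x _ do rewrite RintegralZl//.
by rewrite RintegralZr.
Qed.

End product_integrals_swap.


(** * The exponential and Poisson kernels on the line *)

Section poisson_kernel1.
Context {R : realType}.
Local Notation mu := (@lebesgue_measure R).

Lemma continuous_is_derive (F f : R -> R) :
  (forall x, is_derive (x : R) (1 : R) F (f x)) -> continuous F.
Proof.
move=> dF x; apply: differentiable_continuous; apply/derivable1_diffP.
by have [] := dF x.
Qed.

Section exp_cos.
Variables (a b : R).
Hypothesis a0 : 0 < a.

Let D := a ^+ 2 + b ^+ 2.
Let D0 : 0 < D. Proof. by rewrite ltr_pwDl ?exprn_gt0 ?sqr_ge0. Qed.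
(* [1 + cos] keeps the integrand nonnegative, so that the FTC on a half-line applies. *)
Let F w := expR (- a * w) * ((b * sin (b * w) - a * cos (b * w)) / D - a^-1).
Let f w := expR (- a * w) * (1 + cos (b * w)).

Let dF (x : R) : is_derive x (1 : R) F (f x).
Proof.
rewrite /F /f.
apply: is_derive_eq.
rewrite /GRing.scale /= /D.
field.
apply/andP; split; first exact: lt0r_neq0.
by have := lt0r_neq0 D0.
Qed.

(** [F] is a primitive of [f] that tends to 0 at infinity, so the integral is [- F 0]. The
    hypothesis [0 < a] gives the decay. *)
Lemma integral_exp_cos :
  (\int[mu]_(x in `[0%R, +oo[) (f x)%:E = (a^-1 + a / D)%:E)%E.
Proof.
have cF := continuous_is_derive dF.
have cexp : continuous (fun w => expR (- a * w)).
  move=> x; apply: continuous_comp; last exact: continuous_expR.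
  by apply: cvgM; [exact: cvg_cst|exact: cvg_id].
have ccos : continuous (fun w => cos (b * w)).
  move=> x; apply: continuous_comp; last exact: continuous_cos.
  by apply: cvgM; [exact: cvg_cst|exact: cvg_id].
rewrite (ge0_continuous_FTC2y (F := F) (l := 0)).
- rewrite /F !mulr0 expR0 cos0 sin0 -EFinD; congr EFin.
  ring.
- by move=> x _; rewrite mulr_ge0 ?expR_ge0// -[X in X <= _](subrr 1) lerD2l cos_geN1.
- apply: continuous_subspaceT => x.
  by apply: cvgM; [exact: cexp|apply: cvgD; [exact: cvg_cst|exact: ccos]].
- pose M := (`|b| + a) / D + a^-1.
  have e0 : expR (- a * x) * M @[x --> +oo] --> 0.
    rewrite -[0](mul0r M); apply: cvgM; last exact: cvg_cst.
    under eq_fun do rewrite mulNr.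
    apply: (cvg_comp (fun x => a * x) (fun y => expR (- y))); last exact: cvgr_expR.
    exact: gt0_cvgMry.
  have e0' : - (expR (- a * x) * M) @[x --> +oo] --> 0.
    by rewrite -[0]oppr0; exact: cvgN.
  apply: (squeeze_cvgr _ e0' e0); apply: nearW => x.
  rewrite -ler_norml /F normrM (ger0_norm (expR_ge0 _)).
  apply: ler_wpM2l; first exact: expR_ge0.
  apply: le_trans (ler_normB _ _) _; apply: lerD; last by rewrite gtr0_norm ?invr_gt0.
  rewrite normrM (gtr0_norm (x := D^-1)) ?invr_gt0//.
  apply: ler_wpM2r; first by rewrite invr_ge0 ltW.
  apply: le_trans (ler_normB _ _) _; apply: lerD; rewrite normrM.
    by rewrite ler_piMr// ler_norml sin_geN1 sin_le1.
  rewrite (gtr0_norm a0); apply: ler_piMr; first exact: ltW.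
  by rewrite ler_norml cos_geN1 cos_le1.
- by move=> x _; have [] := dF x.
- by apply: cvg_at_right_filter; exact: cF.
- by move=> x _; rewrite derive1E; have [_] := dF x.
Qed.

End exp_cos.

(** A Fourier pair: [poi], the Poisson kernel at height 1, is the transform of [lapl]. With [lapl]
    as damping factor the transform comes from an elementary primitive. *)
Definition lapl (t : R) := expR (- (2 * pi) * `|t|).
Definition poi (t : R) : R := (pi * (1 + t ^+ 2))^-1.

Lemma pi_neq0 : pi != 0 :> R.
Proof. by rewrite lt0r_neq0// pi_gt0. Qed.

Lemma pi2_gt0 : 0 < 2 * pi :> R.
Proof. by rewrite mulr_gt0 ?pi_gt0. Qed.

Lemma continuous_lapl : continuous lapl.
Proof.
move=> x; apply: continuous_comp; last exact: continuous_expR.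
by apply: cvgM; [exact: cvg_cst|exact: norm_continuous].
Qed.

Lemma continuous_cosM (b : R) : continuous (fun w => cos (b * w)).
Proof.
move=> x; apply: continuous_comp; last exact: continuous_cos.
by apply: cvgM; [exact: cvg_cst|exact: cvg_id].
Qed.

Lemma integral_lapl_1cos b :
  (\int[mu]_t (lapl t * (1 + cos (2 * pi * b * t)))%:E = (pi^-1 + poi b)%:E)%E.
Proof.
rewrite ge0_symfun_integralT.
- rewrite -set_itvcy.
  rewrite [X in (_ * X)%E](_ : _ = \int[mu]_(x in `[0%R, +oo[)
      (expR (- (2 * pi) * x) * (1 + cos (2 * pi * b * x)))%:E)%E; last first.
    apply: eq_integral => x; rewrite inE/= in_itv/= andbT => x0.
    by rewrite /lapl ger0_norm.
  rewrite (integral_exp_cos _ pi2_gt0) -EFinM; congr EFin; rewrite /poi.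
  have := pi_gt0 R; move: (@pi R) => p p0.
  have p0' : p != 0 by exact: lt0r_neq0.
  have b1 : 1 + b ^+ 2 != 0 by rewrite lt0r_neq0// ltr_pwDl// sqr_ge0.
  have b2 : (2 * p) ^+ 2 + (2 * p * b) ^+ 2 != 0.
    by rewrite (_ : _ + _ = 4 * p ^+ 2 * (1 + b ^+ 2)); [rewrite !mulf_neq0 ?expf_neq0|ring].
  by field; rewrite p0' b1 b2.
- by move=> x; rewrite mulr_ge0 ?expR_ge0// -[X in X <= _](subrr 1) lerD2l cos_geN1.
- move=> x; apply: cvgM; first exact: continuous_lapl.
  by apply: cvgD; [exact: cvg_cst|exact: continuous_cosM].
- by move=> x /=; rewrite /lapl normrN mulrN cosN.
Qed.

Lemma integrable_lapl_1cos b :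
  mu.-integrable setT (EFin \o (fun t => lapl t * (1 + cos (2 * pi * b * t)))).
Proof.
apply/integrableP; split.
  apply/measurable_EFinP; apply: continuous_measurable_fun => x.
  apply: cvgM; first exact: continuous_lapl.
  by apply: cvgD; [exact: cvg_cst|exact: continuous_cosM].
rewrite (_ : (\int[mu]_t _ = (pi^-1 + poi b)%:E)%E) ?ltry// -integral_lapl_1cos.
apply: eq_integral => x _ /=; rewrite ger0_norm//.
by rewrite mulr_ge0 ?expR_ge0// -[X in X <= _](subrr 1) lerD2l cos_geN1.
Qed.

Lemma integrable_lapl : mu.-integrable setT (EFin \o lapl).
Proof.
apply: (@eq_integrable _ _ _ mu _ measurableT
    (EFin \o (fun t => 2^-1 * (lapl t * (1 + cos (2 * pi * 0 * t)))))).
  by move=> t _ /=; congr EFin; rewrite mulr0 mul0r cos0; field.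
exact: (integrableZl measurableT 2^-1 (integrable_lapl_1cos 0)).
Qed.

Lemma Rintegral_lapl : \int[mu]_t lapl t = pi^-1.
Proof.
transitivity (\int[mu]_t (2^-1 * (lapl t * (1 + cos (2 * pi * 0 * t))))).
  by apply: eq_Rintegral => t _; rewrite mulr0 mul0r cos0; field.
rewrite RintegralZl//; last exact: integrable_lapl_1cos.
rewrite /Rintegral integral_lapl_1cos /= /poi expr0n addr0 mulr1.
by have := pi_neq0; move: (@pi R) => p p0; field.
Qed.

Lemma integrable_lapl_mul (g : R -> R) : measurable_fun setT g -> (forall t, `|g t| <= 1) ->
  mu.-integrable setT (EFin \o (fun t => lapl t * g t)).
Proof.
move=> mg g1; apply: (@le_Rintegrable _ _ _ mu _ lapl) => //; last exact: integrable_lapl.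
  apply: measurable_funM => //; apply: continuous_measurable_fun; exact: continuous_lapl.
by move=> t; rewrite normrM (ger0_norm (expR_ge0 _)) ler_piMr ?expR_ge0.
Qed.

Lemma measurable_cosM (b : R) : measurable_fun setT (fun w : R => cos (b * w)).
Proof. by apply: continuous_measurable_fun; exact: continuous_cosM. Qed.

Lemma measurable_sinM (b : R) : measurable_fun setT (fun w : R => sin (b * w)).
Proof.
apply: continuous_measurable_fun => x; apply: continuous_comp; last exact: continuous_sin.
by apply: cvgM; [exact: cvg_cst|exact: cvg_id].
Qed.

Lemma normr_cos (x : R) : `|cos x| <= 1.
Proof. by rewrite ler_norml cos_geN1 cos_le1. Qed.

Lemma normr_sin (x : R) : `|sin x| <= 1.
Proof. by rewrite ler_norml sin_geN1 sin_le1. Qed.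

Lemma Rintegral_lapl_cos b : \int[mu]_t (lapl t * cos (2 * pi * b * t)) = poi b.
Proof.
transitivity (\int[mu]_t (lapl t * (1 + cos (2 * pi * b * t)) - lapl t)).
  by apply: eq_Rintegral => t _; move: (cos _) => c; ring.
rewrite RintegralB//; [|exact: integrable_lapl_1cos|exact: integrable_lapl].
by rewrite /Rintegral integral_lapl_1cos -/(Rintegral _ _ _) Rintegral_lapl /= addrAC subrr add0r.
Qed.

(** The reflection [t |-> - t] preserves the integral and changes the sign of the integrand. *)
Lemma Rintegral_lapl_sin b : \int[mu]_t (lapl t * sin (2 * pi * b * t)) = 0.
Proof.
have i := integrable_lapl_mul (measurable_sinM (2 * pi * b)) (fun t => normr_sin _).
have mopp : measurable_fun setT (fun t : measurableTypeR R => - t : measurableTypeR R).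
  exact: measurable_funN.
have H (F : R -> \bar R) : measurable_fun setT F -> (forall z, 0 <= F z)%E ->
    (\int[mu]_z F (- z)%R = 1%:E * \int[mu]_z F z)%E.
  move=> mF F0.
  have n1 : -1 != 0 :> R by rewrite oppr_eq0 oner_eq0.
  have := ge0_integral_affine1 0 n1 mF F0; rewrite normrN1 invr1 => <-.
  by apply: eq_integral => z _; rewrite mulN1r addr0.
have [_] := integral_comp_scale mopp ler01 H i.
rewrite mul1r => E.
have : \int[mu]_t (lapl t * sin (2 * pi * b * t)) = - \int[mu]_t (lapl t * sin (2 * pi * b * t)).
  rewrite -[in LHS]E -mulN1r -RintegralZl//; apply: eq_Rintegral => t _.
  by rewrite /lapl normrN mulrN sinN mulrN mulN1r.
lra.
Qed.

Lemma poi_ge0 t : 0 <= poi t.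
Proof. by rewrite invr_ge0 mulr_ge0 ?pi_ge0// addr_ge0 ?sqr_ge0. Qed.

Lemma continuous_poi : continuous poi.
Proof.
move=> x; apply: cvgV; first by rewrite mulf_neq0 ?lt0r_neq0 ?pi_gt0// ltr_pwDl// sqr_ge0.
by apply: cvgM; [exact: cvg_cst|exact: (@continuous_oneDsqr R)].
Qed.

Lemma integral_poi : (\int[mu]_t (poi t)%:E = 1)%E.
Proof.
rewrite ge0_symfun_integralT.
- rewrite -set_itvcy.
  rewrite [X in (_ * X)%E](_ : _ = (pi^-1)%:E * \int[mu]_(x in `[0%R, +oo[) (oneDsqr x)^-1%:E)%E.
    rewrite integral0y_oneDsqr -!EFinM; congr EFin.
    by have := pi_neq0; move: (@pi R) => p p0; field.
  rewrite -ge0_integralZl//.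
  + by apply: eq_integral => x _; rewrite /poi invfM EFinM.
  + apply/measurable_EFinP; apply: measurable_funTS; apply: continuous_measurable_fun.
    exact: (@continuous_oneDsqrV R).
  + by rewrite lee_fin invr_ge0 pi_ge0.
- exact: poi_ge0.
- exact: continuous_poi.
- by move=> x /=; rewrite /poi sqrrN.
Qed.

Lemma integrable_poi : mu.-integrable setT (EFin \o poi).
Proof.
apply/integrableP; split.
  by apply/measurable_EFinP; apply: continuous_measurable_fun; exact: continuous_poi.
rewrite (_ : (\int[mu]_t _ = 1%:E)%E) ?ltry// -integral_poi.
by apply: eq_integral => x _ /=; rewrite ger0_norm// poi_ge0.
Qed.

Lemma Rintegral_poi : \int[mu]_t poi t = 1.
Proof. by rewrite /Rintegral integral_poi. Qed.

End poisson_kernel1.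


Section rV_kernels.
Context {R : realType}.

Lemma dotE n (x w : 'rV[R]_n) : dot x w = \sum_i x ord0 i * w ord0 i.
Proof. by rewrite /dot mxE; apply: eq_bigr => i _; rewrite mxE. Qed.

Lemma measurable_prodr d (T : measurableType d) (I : Type) (r : seq I) (h : I -> T -> R) :
  (forall i, measurable_fun setT (h i)) ->
  measurable_fun setT (fun x => \prod_(i <- r) h i x).
Proof.
move=> mh; elim: r => [|i r IH]; first by under eq_fun do rewrite big_nil; exact: measurable_cst.
by under eq_fun do rewrite big_cons; apply: measurable_funM.
Qed.

Lemma measurable_dot n d (T : measurableType d) (p q : T -> 'rV[R]_n) :
  measurable_fun setT p -> measurable_fun setT q ->
  measurable_fun setT (fun t => dot (p t) (q t)).
Proof.
move=> mp mq; under eq_fun do rewrite dotE.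
apply: measurable_sum => i; apply: measurable_funM.
  exact: measurableT_comp (measurable_coord i) mp.
exact: measurableT_comp (measurable_coord i) mq.
Qed.

Lemma Rintegral_rVS_tensor n (u : R -> R) (v : 'rV[R]_n -> R) (F : 'rV[R]_n.+1 -> R) :
  measurable_fun setT F -> (forall a y, F (rV_cons (a, y)) = u a * v y) ->
  (@lebesgue_measure R).-integrable setT (EFin \o u) ->
  (lebesgue_rV n).-integrable setT (EFin \o v) ->
  (lebesgue_rV n.+1).-integrable setT (EFin \o F) /\
  \int[lebesgue_rV n.+1]_x F x = (\int[lebesgue_measure]_a u a) * \int[lebesgue_rV n]_y v y.
Proof.
move=> mF FE iu iv.
have [iuv uvE] := integrable_tensor iu iv.
have FcE : F \o @rV_cons R n = (fun z => u z.1 * v z.2).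
  by apply/funext => -[a y] /=; rewrite FE.
have H (G : 'rV[R]_n.+1 -> \bar R) : measurable_fun setT G -> (forall z, 0 <= G z)%E ->
    (\int[lebesgue_measure \x lebesgue_rV n]_z G (rV_cons z) =
     1%:E * \int[lebesgue_rV n.+1]_z G z)%E.
  move=> mG G0; rewrite mul1e ge0_integral_lebesgue_rVS//.
  apply: (fubini_tonelli1 (G \o @rV_cons R n)) => [|z]; last exact: G0.
  exact: measurableT_comp mG (@measurable_rV_cons R n).
have iF : (lebesgue_rV n.+1).-integrable setT (EFin \o F).
  apply/integrableP; split; first exact/measurable_EFinP.
  rewrite -[X in (X < _)%E]mul1e -H//; last first.
    by apply: measurableT_comp => //; exact/measurable_EFinP.
  have /integrableP[_] := iuv; congr (_ < _)%E.
  by apply: eq_integral => -[a y] _ /=; rewrite FE.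
split => //.
have [_] := integral_comp_scale (@measurable_rV_cons R n) ler01 H iF.
rewrite mul1r => <-; rewrite -uvE.
by apply: eq_Rintegral => -[a y] _ /=; rewrite FE.
Qed.

Lemma lebesgue_rV0T : @lebesgue_rV R 0 setT = 1%E.
Proof. exact: diracT. Qed.

Lemma Rintegral_rV0 (c : R) : \int[@lebesgue_rV R 0]_x c = c.
Proof.
rewrite Rintegral_cst// -[RHS]mulr1; congr (_ * _).
exact: (congr1 fine lebesgue_rV0T).
Qed.

Lemma integrable_prod_rV n (u : R -> R) : measurable_fun setT u ->
  (@lebesgue_measure R).-integrable setT (EFin \o u) ->
  (lebesgue_rV n).-integrable setT (EFin \o (fun x : 'rV[R]_n => \prod_i u (x ord0 i))) /\
  \int[lebesgue_rV n]_x \prod_i u (x ord0 i) = (\int[lebesgue_measure]_a u a) ^+ n.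
Proof.
move=> mu iu.
have mP k : measurable_fun setT (fun x : 'rV[R]_k => \prod_i u (x ord0 i)).
  by apply: measurable_prodr => i; exact: measurableT_comp mu (measurable_coord i).
elim: n => [|n [iP PE]].
  have E : (fun x : 'rV[R]_0 => \prod_i u (x ord0 i)) = cst 1.
    by apply/funext => x; rewrite big_ord0.
  rewrite E expr0; split.
    apply/integrableP; split; first by apply/measurable_EFinP; exact: measurable_cst.
    rewrite (_ : (fun x => _) = cst 1%E); last by apply/funext => x /=; rewrite normr1.
    rewrite integral_cst// mul1e; apply: le_lt_trans (ltry 1).
    by move: lebesgue_rV0T => /= ->.
  by rewrite Rintegral_rV0.
rewrite exprS -PE; apply: Rintegral_rVS_tensor => // a y.
rewrite big_ord_recl rV_consE; congr (_ * _).
by apply: eq_bigr => i _; rewrite rV_consE.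
Qed.

Definition laplN n (w : 'rV[R]_n) : R := \prod_i lapl (w ord0 i).
Definition poiN n (z : 'rV[R]_n) : R := \prod_i poi (z ord0 i).

Lemma laplN_ge0 n (w : 'rV[R]_n) : 0 <= laplN w.
Proof. by apply: prodr_ge0 => i _; exact: expR_ge0. Qed.

Lemma poiN_ge0 n (w : 'rV[R]_n) : 0 <= poiN w.
Proof. by apply: prodr_ge0 => i _; exact: poi_ge0. Qed.

Lemma measurable_lapl : measurable_fun setT (@lapl R).
Proof. by apply: continuous_measurable_fun; exact: continuous_lapl. Qed.

Lemma measurable_poi : measurable_fun setT (@poi R).
Proof. by apply: continuous_measurable_fun; exact: continuous_poi. Qed.

Lemma measurable_laplN n : measurable_fun setT (@laplN n).
Proof.
by apply: measurable_prodr => i; exact: measurableT_comp measurable_lapl (measurable_coord i).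
Qed.

Lemma integrable_laplN n : (lebesgue_rV n).-integrable setT (EFin \o @laplN n).
Proof. exact: (integrable_prod_rV n measurable_lapl integrable_lapl).1. Qed.

Lemma integrable_poiN n : (lebesgue_rV n).-integrable setT (EFin \o @poiN n).
Proof. exact: (integrable_prod_rV n measurable_poi integrable_poi).1. Qed.

Lemma Rintegral_poiN n : \int[lebesgue_rV n]_z poiN z = 1.
Proof. by rewrite (integrable_prod_rV n measurable_poi integrable_poi).2 Rintegral_poi expr1n. Qed.

Lemma measurable_cos_dot d (T : measurableType d) n (p q : T -> 'rV[R]_n) :
  measurable_fun setT p -> measurable_fun setT q ->
  measurable_fun setT (fun t => cos (2 * pi * dot (p t) (q t))).
Proof.
move=> mp mq; apply: measurableT_comp (measurable_cosM _) _; exact: measurable_dot.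
Qed.

Lemma measurable_sin_dot d (T : measurableType d) n (p q : T -> 'rV[R]_n) :
  measurable_fun setT p -> measurable_fun setT q ->
  measurable_fun setT (fun t => sin (2 * pi * dot (p t) (q t))).
Proof.
move=> mp mq; apply: measurableT_comp (measurable_sinM _) _; exact: measurable_dot.
Qed.

Lemma integrableMbounded d (T : measurableType d) (m : {measure set T -> \bar R})
    (f g : T -> R) :
  m.-integrable setT (EFin \o f) -> measurable_fun setT g -> (forall x, `|g x| <= 1) ->
  m.-integrable setT (EFin \o (fun x => f x * g x)).
Proof.
move=> fi mg g1; apply: (@le_Rintegrable _ _ _ m _ (fun x => `|f x|)).
- apply: measurable_funM => //; apply/measurable_EFinP; exact: measurable_int fi.
- by move=> x; rewrite normrM ler_piMr.
- exact: integrable_norm.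
Qed.

(** Cosine and sine go through the induction together, since the addition formulas mix them when a
    coordinate is split off. *)
Lemma Rintegral_laplN n (z : 'rV[R]_n) :
  \int[lebesgue_rV n]_w (laplN w * cos (2 * pi * dot w z)) = poiN z /\
  \int[lebesgue_rV n]_w (laplN w * sin (2 * pi * dot w z)) = 0.
Proof.
elim: n z => [|n IH] z.
  split.
    under eq_Rintegral do rewrite /laplN big_ord0 dotE big_ord0 mulr0 cos0 mulr1.
    by rewrite Rintegral_rV0 /poiN big_ord0.
  under eq_Rintegral do rewrite /laplN big_ord0 dotE big_ord0 mulr0 sin0 mulr0.
  exact: Rintegral_rV0.
pose a := z ord0 ord0; pose z' : 'rV[R]_n := \row_i z ord0 (lift ord0 i).
have mh k : measurable_fun setT (fun w : 'rV[R]_k.+1 => \row_i w ord0 (lift ord0 i) : 'rV[R]_k).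
  by apply: measurable_fun_rVP => i; under eq_fun do rewrite mxE; exact: measurable_coord.
have [ic iS] := IH z'.
pose c0 t := lapl t * cos (2 * pi * a * t); pose s0 t := lapl t * sin (2 * pi * a * t).
pose c1 (y : 'rV[R]_n) := laplN y * cos (2 * pi * dot y z').
pose s1 (y : 'rV[R]_n) := laplN y * sin (2 * pi * dot y z').
have ic0 : lebesgue_measure.-integrable setT (EFin \o c0).
  by apply: integrable_lapl_mul => [|t]; [exact: measurable_cosM|exact: normr_cos].
have is0 : lebesgue_measure.-integrable setT (EFin \o s0).
  by apply: integrable_lapl_mul => [|t]; [exact: measurable_sinM|exact: normr_sin].
have ic1 : (lebesgue_rV n).-integrable setT (EFin \o c1).
  apply: integrableMbounded (integrable_laplN n) _ _ => [|t]; last exact: normr_cos.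
  exact: measurable_cos_dot.
have is1 : (lebesgue_rV n).-integrable setT (EFin \o s1).
  apply: integrableMbounded (integrable_laplN n) _ _ => [|t]; last exact: normr_sin.
  exact: measurable_sin_dot.
have mc0 : measurable_fun setT c0.
  by apply: measurable_funM; [exact: measurable_lapl|exact: measurable_cosM].
have ms0 : measurable_fun setT s0.
  by apply: measurable_funM; [exact: measurable_lapl|exact: measurable_sinM].
have mc1 : measurable_fun setT c1.
  by apply: measurable_funM; [exact: measurable_laplN|exact: measurable_cos_dot].
have ms1 : measurable_fun setT s1.
  by apply: measurable_funM; [exact: measurable_laplN|exact: measurable_sin_dot].
pose T (u : R -> R) (v : 'rV[R]_n -> R) (w : 'rV[R]_n.+1) :=
  u (w ord0 ord0) * v (\row_i w ord0 (lift ord0 i)).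
have TE u v : measurable_fun setT u -> measurable_fun setT v ->
    lebesgue_measure.-integrable setT (EFin \o u) ->
    (lebesgue_rV n).-integrable setT (EFin \o v) ->
    (lebesgue_rV n.+1).-integrable setT (EFin \o (T u v)) /\
    \int[lebesgue_rV n.+1]_w T u v w = (\int[lebesgue_measure]_t u t) * \int[lebesgue_rV n]_y v y.
  move=> mu mv iu iv; apply: Rintegral_rVS_tensor => //.
    apply: measurable_funM; first exact: measurableT_comp mu (measurable_coord ord0).
    exact: measurableT_comp mv (mh n).
  move=> t y; rewrite /T rV_consE; congr (_ * v _).
  by apply/rowP => i; rewrite mxE rV_consE.
have lE (w : 'rV[R]_n.+1) : laplN w = T lapl (@laplN n) w.
  rewrite /laplN /T big_ord_recl; congr (_ * _).
  by apply: eq_bigr => i _; rewrite mxE.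
have dE (w : 'rV[R]_n.+1) : 2 * pi * dot w z =
    2 * pi * a * w ord0 ord0 + 2 * pi * dot (\row_i w ord0 (lift ord0 i)) z'.
  rewrite !dotE big_ord_recl mulrDr; congr (_ + _); first by rewrite /a; ring.
  by congr (_ * _); apply: eq_bigr => i _; rewrite !mxE.
have [icc ccE] := TE _ _ mc0 mc1 ic0 ic1; have [iss ssE] := TE _ _ ms0 ms1 is0 is1.
have [isc scE] := TE _ _ ms0 mc1 is0 ic1; have [ics csE] := TE _ _ mc0 ms1 ic0 is1.
split.
  transitivity (\int[lebesgue_rV n.+1]_w (T c0 c1 w - T s0 s1 w)).
    by apply: eq_Rintegral => w _; rewrite dE cosD lE /T /c0 /c1 /s0 /s1; ring.
  rewrite RintegralB// ccE ssE Rintegral_lapl_cos Rintegral_lapl_sin mul0r subr0 ic.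
  rewrite /poiN big_ord_recl; congr (_ * _).
  by apply: eq_bigr => i _; rewrite mxE.
transitivity (\int[lebesgue_rV n.+1]_w (T s0 c1 w + T c0 s1 w)).
  by apply: eq_Rintegral => w _; rewrite dE sinD lE /T /c0 /c1 /s0 /s1; ring.
by rewrite RintegralD// csE scE Rintegral_lapl_sin mul0r add0r iS mulr0.
Qed.

End rV_kernels.

Section plancherel.
Context {R : realType} (n : nat).
Local Notation mu := (@lebesgue_rV R n).
Implicit Types (g p q : 'rV[R]_n -> R) (w y z : 'rV[R]_n).

Lemma measurable_addrV : measurable_fun setT (fun z : 'rV[R]_n * 'rV[R]_n => z.1 + z.2).
Proof.
apply: measurable_fun_rVP => i; under eq_fun do rewrite mxE.
by apply: measurable_funD; apply: (measurableT_comp (measurable_coord i)).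
Qed.

Lemma measurable_scale_rV (c : R) : measurable_fun setT (fun w : 'rV[R]_n => c *: w).
Proof.
have := measurable_affine_rV c (0 : 'rV[R]_n).
by under eq_fun do rewrite addr0.
Qed.

Lemma measurable_intL d (T : measurableType d) (m : {measure set T -> \bar R}) (f : T -> R) :
  m.-integrable setT (EFin \o f) -> measurable_fun setT f.
Proof. by move=> fi; apply/measurable_EFinP; exact: measurable_int fi. Qed.

(** In the other order of integration, the inner integral of [p (y + z)] over [z] does not depend on
    [y]. *)
Lemma Rintegral_conv p q :
  mu.-integrable setT (EFin \o p) -> mu.-integrable setT (EFin \o q) ->
  mu.-integrable setT (EFin \o (fun z => \int[mu]_y (p (y + z) * q y))) /\
  \int[mu]_z \int[mu]_y (p (y + z) * q y) = (\int[mu]_y p y) * \int[mu]_y q y.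
Proof.
move=> ip iq; have mp := measurable_intL ip; have mq := measurable_intL iq.
pose F (z : 'rV[R]_n * 'rV[R]_n) := p (z.1 + z.2) * q z.1.
have mF : measurable_fun setT F.
  apply: measurable_funM; first exact: measurableT_comp mp measurable_addrV.
  exact: measurableT_comp.
have iF : (mu \x mu)%E.-integrable setT (EFin \o F).
  apply/integrable12ltyP; first exact/measurable_EFinP.
  have ip' := integrable_norm ip; have iq' := integrable_norm iq.
  rewrite (_ : (\int[mu]_x _ = (\int[mu]_y `|p y|)%:E * (\int[mu]_y `|q y|)%:E)%E) ?ltry//.
  rewrite [X in (_ * X)%E]EFin_Rintegral// -ge0_integralZl//; last 2 first.
  - by apply/measurable_EFinP; exact: measurableT_comp.
  - by rewrite EFin_Rintegral// integral_ge0.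
  apply: eq_integral => y _; rewrite muleC EFin_Rintegral//.
  rewrite -(ge0_integral_shift y (F := fun x => (`|p x|)%:E))//; last first.
    by apply/measurable_EFinP; exact: measurableT_comp.
  rewrite -ge0_integralZl//; last first.
    apply/measurable_EFinP; apply: measurableT_comp => //.
    exact: measurableT_comp mp (measurable_shift_rV y).
  by apply: eq_integral => z _; rewrite /F /= normrM mulrC (addrC z).
have [iG GE] := Rintegral21 iF; split => //.
rewrite [LHS]GE -(Rintegral12 iF).2 /F/= -RintegralZl//.
apply: eq_Rintegral => y _; rewrite RintegralZr//; last first.
  have := integrable_shift y ip.
  by under [X in EFin \o X]eq_fun do rewrite addrC.
rewrite -(Rintegral_shift y ip); congr (_ * _).
by apply: eq_Rintegral => z _; rewrite addrC.
Qed.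

Definition Fcos g w := \int[mu]_y (g y * cos (2 * pi * dot y w)).
Definition Fsin g w := \int[mu]_y (g y * sin (2 * pi * dot y w)).

Lemma L2Mbounded d (T : measurableType d) (m : {measure set T -> \bar R}) (f h : T -> R) :
  L2 m f -> measurable_fun setT h -> (forall x, `|h x| <= 1) -> L2 m (fun x => f x * h x).
Proof.
move=> [mf fi] mh h1; split; first exact: measurable_funM.
under [X in EFin \o X]eq_fun do rewrite exprMn.
apply: integrableMbounded => //; first exact: measurable_funX.
by move=> x; rewrite normrX exprn_ile1.
Qed.

Lemma dotDl y z w : dot (y + z) w = dot y w + dot z w.
Proof. by rewrite !dotE -big_split; apply: eq_bigr => i _; rewrite mxE mulrDl. Qed.

Lemma dotC y w : dot y w = dot w y.
Proof. by rewrite !dotE; apply: eq_bigr => i _; rewrite mulrC. Qed.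

Lemma dotZl (c : R) y w : dot (c *: y) w = c * dot y w.
Proof. by rewrite !dotE mulr_sumr; apply: eq_bigr => i _; rewrite mxE mulrA. Qed.

Lemma integrable_corr g : mu.-integrable setT (EFin \o g) ->
  mu.-integrable setT (EFin \o corr g).
Proof. by move=> ig; have [] := Rintegral_conv ig ig. Qed.

(** The Wiener-Khinchin identity. Each square becomes the integral of an autocorrelation, and in
    their sum the phases at [y + z] and [y] combine into the cosine of their difference. *)
Lemma power_spectrum g w : mu.-integrable setT (EFin \o g) -> L2 mu g ->
  Fcos g w ^+ 2 + Fsin g w ^+ 2 = \int[mu]_z (corr g z * cos (2 * pi * dot z w)).
Proof.
move=> ig lg.
pose gc y := g y * cos (2 * pi * dot y w); pose gs y := g y * sin (2 * pi * dot y w).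
have mc : measurable_fun setT (fun y => cos (2 * pi * dot y w)) by exact: measurable_cos_dot.
have ms : measurable_fun setT (fun y => sin (2 * pi * dot y w)) by exact: measurable_sin_dot.
have igc := integrableMbounded ig mc (fun y => normr_cos _).
have igs := integrableMbounded ig ms (fun y => normr_sin _).
have lgc := L2Mbounded lg mc (fun y => normr_cos _).
have lgs := L2Mbounded lg ms (fun y => normr_sin _).
have [ic cE] := Rintegral_conv igc igc; have [iS sE] := Rintegral_conv igs igs.
rewrite !expr2 -cE -sE -RintegralD//.
apply: eq_Rintegral => z _.
rewrite -RintegralD//; [|exact: (L2M (L2_shift z lgc) lgc)|exact: (L2M (L2_shift z lgs) lgs)].
rewrite /corr /ip -RintegralZr//; last exact: (L2M (L2_shift z lg) lg).
apply: eq_Rintegral => y _; rewrite dotDl mulrDr.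
rewrite [in RHS](_ : 2 * pi * dot z w = (2 * pi * dot y w + 2 * pi * dot z w) - 2 * pi * dot y w).
  by rewrite cosB; ring.
by rewrite addrAC subrr add0r.
Qed.

(** Integrability of the bare power spectrum is not known at this stage. Damping by [laplN] allows
    Fubini's theorem, which exchanges [laplN] for its transform [poiN] and moves the scale [c] into
    the argument of [corr g]. *)
Lemma Rintegral_spectrum_lapl g (c : R) : 0 < c -> mu.-integrable setT (EFin \o g) -> L2 mu g ->
  mu.-integrable setT (EFin \o (fun w => laplN (c *: w) * (Fcos g w ^+ 2 + Fsin g w ^+ 2))) /\
  \int[mu]_w (laplN (c *: w) * (Fcos g w ^+ 2 + Fsin g w ^+ 2)) =
  \int[mu]_s (corr g (c *: s) * poiN s).
Proof.
move=> c0 ig lg; have c0' := lt0r_neq0 c0.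
have iA := integrable_corr ig.
have iAc : mu.-integrable setT (EFin \o (fun s => corr g (c *: s))).
  have [+ _] := integrable_affine 0 c0' iA.
  by under [X in EFin \o X]eq_fun do rewrite addr0.
pose Hc w := \int[mu]_s (corr g (c *: s) * cos (2 * pi * dot s w)).
have HE w : Fcos g w ^+ 2 + Fsin g w ^+ 2 = c ^+ n * Hc (c *: w).
  rewrite power_spectrum//.
  have iAw : mu.-integrable setT (EFin \o (fun z => corr g z * cos (2 * pi * dot z w))).
    by apply: (integrableMbounded iA) => [|y]; [exact: measurable_cos_dot|exact: normr_cos].
  have [_] := integrable_affine 0 c0' iAw.
  rewrite (gtr0_norm c0) => E.
  rewrite -[LHS](mulVKf (expf_neq0 n c0')) -E; congr (_ * _).
  apply: eq_Rintegral => s _; rewrite addr0 dotZl dotC (dotC s) dotZl.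
  by congr (_ * cos _); rewrite (dotC s).
pose F (z : 'rV[R]_n * 'rV[R]_n) := laplN z.1 * corr g (c *: z.2) * cos (2 * pi * dot z.2 z.1).
have iF : (mu \x mu)%E.-integrable setT (EFin \o F).
  apply: integrableMbounded; first exact: (integrable_tensor (integrable_laplN n) iAc).1.
    exact: measurable_cos_dot.
  by move=> z; exact: normr_cos.
have FE w : \int[mu]_s F (w, s) = laplN w * Hc w.
  rewrite /F/= /Hc -RintegralZl//.
    by apply: eq_Rintegral => s _; rewrite mulrA.
  by apply: (integrableMbounded iAc) => [|y]; [exact: measurable_cos_dot|exact: normr_cos].
have [i1 E1] := Rintegral12 iF; have [_ E2] := Rintegral21 iF.
have {}i1 : mu.-integrable setT (EFin \o (fun w => laplN w * Hc w)).
  by under [X in EFin \o X]eq_fun do rewrite -FE.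
have [iL LE] := integrable_affine 0 c0' i1.
have E3 w : laplN (c *: w) * (Fcos g w ^+ 2 + Fsin g w ^+ 2) =
    c ^+ n * (laplN (c *: w + 0) * Hc (c *: w + 0)).
  by rewrite HE addr0; ring.
split.
  under [X in EFin \o X]eq_fun do rewrite E3.
  exact: (integrableZl measurableT (c ^+ n) iL).
transitivity (c ^+ n * \int[mu]_w (laplN (c *: w + 0) * Hc (c *: w + 0))).
  rewrite -(RintegralZl (c ^+ n) measurableT iL).
  by apply: eq_Rintegral => w _; exact: E3.
rewrite LE (gtr0_norm c0) mulVKf ?expf_neq0//.
transitivity (\int[mu]_w \int[mu]_s F (w, s)).
  by apply: eq_Rintegral => w _; rewrite FE.
rewrite E1 -E2; apply: eq_Rintegral => s _.
rewrite -(Rintegral_laplN s).1 -RintegralZl//.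
  by apply: eq_Rintegral => w _; rewrite /F/= (dotC s); ring.
apply: (integrableMbounded (integrable_laplN n)) => [|y]; last exact: normr_cos.
exact: measurable_cos_dot.
Qed.

Lemma laplN_cvg w (u : R^nat) : u @ \oo --> 0 -> laplN (u k *: w) @[k --> \oo] --> (1 : R).
Proof.
move=> u0; rewrite /laplN; elim: (index_enum _) => [|i r IH].
  by under eq_fun do rewrite big_nil; exact: cvg_cst.
under eq_fun do rewrite big_cons.
have l0 : lapl (0 : R) = 1 by rewrite /lapl normr0 mulr0 expR0.
have uw0 : u k * w ord0 i @[k --> \oo] --> (0 : R).
  by rewrite -(mul0r (w ord0 i)); apply: cvgM; [exact: u0|exact: cvg_cst].
have H1 : lapl (u k * w ord0 i) @[k --> \oo] --> (1 : R).
  by rewrite -l0; exact: (cvg_comp (fun k => u k * w ord0 i) (@lapl R) uw0 (@continuous_lapl R 0)).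
under eq_fun do rewrite mxE.
suff : lapl (u k * w ord0 i) * (\prod_(j <- r) lapl ((u k *: w) ord0 j))
    @[k --> \oo] --> (1 * 1 : R).
  by rewrite mulr1.
by apply: cvgM.
Qed.

Lemma laplN_le1 w : laplN w <= 1.
Proof.
apply: prodr_ile1 => i _; rewrite expR_ge0/= -expR0 ler_expR.
by rewrite mulr_le0_ge0// oppr_le0 ltW// pi2_gt0.
Qed.

Lemma measurable_Fcos g : measurable_fun setT g -> measurable_fun setT (Fcos g).
Proof.
move=> mg; apply: (@measurable_Rintegral _ _ _ _ _ mu
  (fun z : 'rV[R]_n * 'rV[R]_n => g z.2 * cos (2 * pi * dot z.2 z.1))).
by apply: measurable_funM; [exact: measurableT_comp|exact: measurable_cos_dot].
Qed.

Lemma measurable_Fsin g : measurable_fun setT g -> measurable_fun setT (Fsin g).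
Proof.
move=> mg; apply: (@measurable_Rintegral _ _ _ _ _ mu
  (fun z : 'rV[R]_n * 'rV[R]_n => g z.2 * sin (2 * pi * dot z.2 z.1))).
by apply: measurable_funM; [exact: measurableT_comp|exact: measurable_sin_dot].
Qed.

(** An approximate identity: the integrand is dominated by [corr g 0 * poiN s], and [poiN] has total
    mass 1. *)
Lemma corr_poi_cvg g (u : R^nat) : sepcont g -> L2 mu g -> u @ \oo --> 0 ->
  (forall k, measurable_fun setT (fun s : 'rV[R]_n => corr g (u k *: s))) ->
  \int[mu]_s (corr g (u k *: s) * poiN s) @[k --> \oo] --> corr g 0.
Proof.
move=> cg lg u0 mA.
have mP : measurable_fun setT (@poiN R n) := measurable_intL (integrable_poiN n).
have iP := integrableZl measurableT (corr g 0) (integrable_poiN n).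
have [] := @dominated_convergence _ _ _ mu setT measurableT
  (fun k s => (corr g (u k *: s) * poiN s)%:E) (fun s => (corr g 0 * poiN s)%:E)
  (fun s => (corr g 0 * poiN s)%:E).
- by move=> k; apply/measurable_EFinP; exact: measurable_funM.
- by apply/measurable_EFinP; exact: measurable_funM.
- apply: aeW => s _; apply: cvg_EFin; first exact: nearW.
  by apply: cvgM; [exact: corr_cvg|exact: cvg_cst].
- exact: iP.
- apply: aeW => s k _; rewrite /= lee_fin normrM (ger0_norm (poiN_ge0 _)).
  by rewrite ler_wpM2r ?poiN_ge0// normr_corr.
move=> _ _.
have -> : (\int[mu]_x (corr g 0 * poiN x)%:E = (corr g 0)%:E)%E.
  rewrite -EFin_Rintegral; last exact: iP.
  by rewrite RintegralZl// ?Rintegral_poiN ?mulr1//; exact: integrable_poiN.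
by move=> /fine_cvg.
Qed.

(** The damped integrals [I k] tend to [corr g 0]. As the spectrum is nonnegative, Fatou's lemma
    bounds the undamped integral above by this limit, and [laplN <= 1] bounds it below. *)
Theorem plancherel g : sepcont g -> mu.-integrable setT (EFin \o g) -> L2 mu g ->
  (\int[mu]_w (Fcos g w ^+ 2 + Fsin g w ^+ 2)%:E = (corr g 0)%:E)%E.
Proof.
move=> cg ig lg.
have mg := lg.1.
pose H w := Fcos g w ^+ 2 + Fsin g w ^+ 2.
have H0 w : 0 <= H w by rewrite addr_ge0 ?sqr_ge0.
have mH : measurable_fun setT H.
  apply: measurable_funD; apply: measurable_funX; first exact: measurable_Fcos.
  exact: measurable_Fsin.
pose u (k : nat) : R := k.+1%:R^-1.
have u0 : u @ \oo --> (0 : R) by exact: cvg_harmonic.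
have up k : 0 < u k by rewrite invr_gt0.
pose I k := \int[mu]_s (corr g (u k *: s) * poiN s).
have mL k : measurable_fun setT (fun w => laplN (u k *: w)).
  exact: (measurableT_comp (@measurable_laplN R n) (measurable_scale_rV (u k))).
have IE k : (\int[mu]_w (laplN (u k *: w) * H w)%:E = (I k)%:E)%E.
  have [iL LE] := Rintegral_spectrum_lapl (up k) ig lg.
  by rewrite /I -LE EFin_Rintegral.
have Icvg : I @ \oo --> corr g 0.
  apply: corr_poi_cvg => // k.
  have mA := measurable_intL (integrable_corr ig).
  exact: (measurableT_comp mA (measurable_scale_rV (u k))).
apply/eqP; rewrite eq_le; apply/andP; split.
  apply: (fatou_cvg (F := fun k w => laplN (u k *: w) * H w) (c := I)) => //.
  - by move=> k; exact: measurable_funM.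
  - by move=> k w; rewrite mulr_ge0 ?laplN_ge0.
  - move=> w; rewrite -[X in _ --> X](mul1r (H w)).
    by apply: cvgM; [exact: laplN_cvg|exact: cvg_cst].
  - by move=> k; rewrite IE.
have IEc : (fun k => (I k)%:E) @ \oo --> (corr g 0)%:E.
  by apply: cvg_EFin; [exact: nearW|exact: Icvg].
rewrite -(cvg_lim _ IEc)//; apply: lime_le; first by apply/cvg_ex; exists (corr g 0)%:E.
apply: nearW => k; rewrite -IE; apply: ge0_le_integral => //.
- by move=> w _; rewrite lee_fin mulr_ge0 ?laplN_ge0.
- by apply/measurable_EFinP; exact: measurable_funM.
- by apply/measurable_EFinP.
- by move=> w _; rewrite lee_fin ler_piMl// laplN_le1.
Qed.

End plancherel.

(** * Moments of the time-frequency distribution *)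

Section cross_product.
Context {R : realType} (n : nat).
Local Notation mu := (@lebesgue_rV R n).
Local Notation V2 := ('rV[R]_n * 'rV[R]_n)%type.
Implicit Types (x y w h u v : 'rV[R]_n).

(** The linear map has determinant of modulus 1. It is split into substitutions in a single vector
    variable: a shift of [x] by half of [y] for fixed [y], then [y |-> x - y] for fixed [x], with
    Tonelli's theorem before each. *)
Lemma ge0_integral_center_difference (F : 'rV[R]_n * 'rV[R]_n -> \bar R) :
  measurable_fun setT F -> (forall z, 0 <= F z)%E ->
  (\int[mu]_x \int[mu]_y F ((x + 2^-1 *: y)%R, (x - 2^-1 *: y)%R) =
   \int[mu]_u \int[mu]_v F (u, v))%E.
Proof.
move=> mF F0.
have mpair (p q : 'rV[R]_n * 'rV[R]_n -> 'rV[R]_n) :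
    measurable_fun setT p -> measurable_fun setT q ->
    measurable_fun setT (fun z : V2 => F (p z, q z)).
  by move=> mp mq; apply: measurableT_comp mF _; apply/measurable_fun_pairP; split.
have mlin (a b : R) : measurable_fun setT (fun z : V2 => a *: z.1 + b *: z.2).
  exact: (measurableT_comp (@measurable_addrV R n)
    (measurable_fun_pair (measurableT_comp (@measurable_scale_rV R n a) measurable_fst)
       (measurableT_comp (@measurable_scale_rV R n b) measurable_snd))).
have mpl a b c e : measurable_fun setT (fun z : V2 =>
    F (a *: z.1 + b *: z.2, c *: z.1 + e *: z.2)) by exact: mpair.
have m1 : measurable_fun setT (fun z : V2 => F (z.1 + 2^-1 *: z.2, z.1 - 2^-1 *: z.2)).
  have := mpl 1 2^-1 1 (- 2^-1).
  by under eq_fun do rewrite !scale1r scaleNr.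
have m2 : measurable_fun setT (fun z : V2 => F (z.1, z.1 - z.2)).
  have := mpl 1 0 1 (-1).
  by under eq_fun do rewrite !scale1r scale0r addr0 scaleN1r.
apply: etrans; first exact: (fubini_tonelli _ m1 (fun=> F0 _)).
transitivity (\int[mu]_y \int[mu]_x F (x, (x - y)%R))%E.
  apply: eq_integral => y _.
  rewrite -[RHS](ge0_integral_shift (2^-1 *: y) (F := fun x => F (x, (x - y)%R)))//; last first.
    exact: (measurableT_comp m2 (@pair2_measurable _ _ _ _ y)).
  apply: eq_integral => x _; congr (F (_, _)).
  rewrite -addrA; congr (_ + _).
  by rewrite -[X in _ = _ - X]scale1r -scalerBl -scaleNr; congr (_ *: _); field.
apply: etrans; first apply: esym (fubini_tonelli _ m2 (fun=> F0 _)).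
apply: eq_integral => x _.
have n1 : -1 != 0 :> R by rewrite oppr_eq0 oner_eq0.
have := ge0_integral_affine x n1
  (measurableT_comp mF (@pair1_measurable _ _ _ _ x)) (fun y => F0 (x, y)).
rewrite normrN1 expr1n invr1 mul1e => <-.
by apply: eq_integral => y _; rewrite /= scaleN1r addrC.
Qed.

Variable f : 'rV[R]_n -> R.
Hypotheses (cf : sepcont f) (lf : L2 mu f).
Local Notation A := (corr f).

Definition cross x y := f (x + 2^-1 *: y) * f (x - 2^-1 *: y).

Let half0 : 2^-1 != 0 :> R. Proof. by rewrite invr_eq0. Qed.
Let mhalf0 : - 2^-1 != 0 :> R. Proof. by rewrite oppr_eq0 invr_eq0. Qed.

Let L2plus x : L2 mu (fun y => f (x + 2^-1 *: y)).
Proof. by have := L2_affine x half0 lf; under [X in L2 _ X]eq_fun do rewrite addrC. Qed.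

Let L2minus x : L2 mu (fun y => f (x - 2^-1 *: y)).
Proof.
by have := L2_affine x mhalf0 lf; under [X in L2 _ X]eq_fun do rewrite addrC scaleNr.
Qed.

Lemma integrable_cross x : mu.-integrable setT (EFin \o cross x).
Proof. exact: L2M (L2plus x) (L2minus x). Qed.

Lemma sepcont_cross x : sepcont (cross x).
Proof.
move=> y i.
have E (s : R) : cross x (y + s *: delta_mx ord0 i) =
    f ((x + 2^-1 *: y) + (2^-1 * s) *: delta_mx ord0 i) *
    f ((x - 2^-1 *: y) + (- 2^-1 * s) *: delta_mx ord0 i).
  rewrite /cross; congr (f _ * f _); first by rewrite scalerDr scalerA addrA.
  by rewrite scalerDr scalerA opprD addrA mulNr scaleNr.
under eq_fun do rewrite E.
have C (z : 'rV[R]_n) (c : R) : continuous (fun s : R => f (z + (c * s) *: delta_mx ord0 i)).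
  move=> s; apply: (@continuous_comp _ _ _ (fun s : R => c * s)
    (fun r : R => f (z + r *: delta_mx ord0 i))); last exact: cf.
  by apply: cvgM; [exact: cvg_cst|exact: cvg_id].
by move=> s; apply: cvgM; exact: C.
Qed.

Let mf : measurable_fun setT f := lf.1.

Let mlin (a b : R) : measurable_fun setT (fun z : V2 => a *: z.1 + b *: z.2).
Proof.
exact: (measurableT_comp (@measurable_addrV R n)
    (measurable_fun_pair (measurableT_comp (@measurable_scale_rV R n a) measurable_fst)
       (measurableT_comp (@measurable_scale_rV R n b) measurable_snd))).
Qed.

Lemma measurable_cross : measurable_fun setT (fun z : V2 => cross z.1 z.2).
Proof.
apply: measurable_funM; apply: (measurableT_comp mf).
  by have := mlin 1 2^-1; under eq_fun do rewrite scale1r.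
by have := mlin 1 (- 2^-1); under eq_fun do rewrite scale1r scaleNr.
Qed.

Definition spec x w := Fcos (cross x) w ^+ 2 + Fsin (cross x) w ^+ 2.

Lemma spec_ge0 x w : 0 <= spec x w.
Proof. by rewrite addr_ge0 ?sqr_ge0. Qed.

Lemma measurable_spec : measurable_fun setT (fun z : V2 => spec z.1 z.2).
Proof.
have m1 : measurable_fun setT (fun z : ('rV[R]_n * 'rV[R]_n) * 'rV[R]_n => cross z.1.1 z.2).
  have mq : measurable_fun setT (fun z : V2 * 'rV[R]_n => (z.1.1, z.2)).
    exact: (measurable_fun_pair (measurableT_comp measurable_fst measurable_fst) measurable_snd).
  exact: (measurableT_comp measurable_cross mq).
apply: measurable_funD; apply: measurable_funX.
  apply: (@measurable_Rintegral _ _ _ _ _ mu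
    (fun z : ('rV[R]_n * 'rV[R]_n) * 'rV[R]_n => cross z.1.1 z.2 * cos (2 * pi * dot z.2 z.1.2))).
  apply: measurable_funM => //; apply: measurable_cos_dot => //.
  exact: measurableT_comp.
apply: (@measurable_Rintegral _ _ _ _ _ mu
    (fun z : ('rV[R]_n * 'rV[R]_n) * 'rV[R]_n => cross z.1.1 z.2 * sin (2 * pi * dot z.2 z.1.2))).
apply: measurable_funM => //; apply: measurable_sin_dot => //.
exact: measurableT_comp.
Qed.

Lemma ge0_integral_sqr_tensor (a b : 'rV[R]_n -> R) : L2 mu a -> L2 mu b ->
  (\int[mu]_u \int[mu]_v ((a u * b v) ^+ 2)%:E = (ip mu a a * ip mu b b)%:E)%E.
Proof.
move=> la lb.
transitivity (\int[mu]_u ((a u ^+ 2)%:E * (ip mu b b)%:E))%E.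
  apply: eq_integral => u _; rewrite -(ip_sqr lb) -ge0_integralZl//.
  - by apply: eq_integral => v _; rewrite exprMn.
  - by apply/measurable_EFinP; apply: measurable_funX; exact: lb.1.
  - by move=> v _; rewrite lee_fin sqr_ge0.
  - by rewrite lee_fin sqr_ge0.
rewrite ge0_integralZr//.
- by rewrite (ip_sqr la).
- by apply/measurable_EFinP; apply: measurable_funX; exact: la.1.
- by move=> v _; rewrite lee_fin sqr_ge0.
- by rewrite lee_fin ip_ge0.
Qed.

Lemma integral_cross_sqr :
  (\int[mu]_x \int[mu]_y ((cross x y) ^+ 2)%:E = ((A 0) ^+ 2)%:E)%E.
Proof.
rewrite (ge0_integral_center_difference (F := fun z : V2 => ((f z.1 * f z.2) ^+ 2)%:E)).
- by rewrite expr2 corr0 -(ge0_integral_sqr_tensor lf lf).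
- apply/measurable_EFinP; apply: measurable_funX; apply: measurable_funM; exact: measurableT_comp.
- by move=> z; rewrite lee_fin sqr_ge0.
Qed.

(** [cross x] is integrable for every [x], being a product of two square integrable functions, but
    its own square is controlled only through the finite double integral. Plancherel's formula is
    therefore used for almost every [x]. *)
Lemma ae_L2_cross : \forall x \ae mu, L2 mu (cross x).
Proof.
have mc2 : measurable_fun setT (fun z : V2 => (cross z.1 z.2 ^+ 2)%:E).
  by apply/measurable_EFinP; apply: measurable_funX; exact: measurable_cross.
have iI : mu.-integrable setT (fun x => \int[mu]_y (cross x y ^+ 2)%:E)%E.
  apply/integrableP; split.
    apply: (measurable_fun_fubini_tonelli_F (fun z : V2 => (cross z.1 z.2 ^+ 2)%:E)) => //.
    by move=> z; rewrite lee_fin sqr_ge0.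
  rewrite (_ : (\int[mu]_x _ = ((A 0) ^+ 2)%:E)%E) ?ltry// -integral_cross_sqr.
  apply: eq_integral => x _; rewrite gee0_abs// integral_ge0// => y _.
  by rewrite lee_fin sqr_ge0.
have := integrable_ae measurableT iI.
apply: filterS => x /(_ I) fx.
have mx : measurable_fun setT (cross x) := measurable_intL (integrable_cross x).
split => //; apply/integrableP; split.
  by apply/measurable_EFinP; exact: measurable_funX.
rewrite (_ : (\int[mu]_y _ = \int[mu]_y (cross x y ^+ 2)%:E)%E).
  by move: fx; rewrite ge0_fin_numE// integral_ge0// => y _; rewrite lee_fin sqr_ge0.
by apply: eq_integral => y _; rewrite /= ger0_norm// sqr_ge0.
Qed.

End cross_product.

Section spectral_identities.
Context {R : realType} (n : nat).
Local Notation mu := (@lebesgue_rV R n).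
Local Notation V2 := ('rV[R]_n * 'rV[R]_n)%type.
Implicit Types (x y w h u v : 'rV[R]_n).

Lemma sepcont_shift (g : 'rV[R]_n -> R) h : sepcont g -> sepcont (fun y => g (y + h)).
Proof.
move=> cg y i; have := cg (y + h) i.
by under eq_fun do rewrite addrAC.
Qed.

Lemma sepcontB (g k : 'rV[R]_n -> R) : sepcont g -> sepcont k -> sepcont (fun y => g y - k y).
Proof. by move=> cg ck y i s; apply: cvgB; [exact: cg|exact: ck]. Qed.

(** A translation by [h] multiplies the Fourier transform by a phase of angle [t = 2 pi h.w], and
    the squared modulus of [exp (i t) - 1] is [2 - 2 cos t]. *)
Lemma spectrum_difference (g : 'rV[R]_n -> R) h w : mu.-integrable setT (EFin \o g) ->
  Fcos (fun y => g (y + h) - g y) w ^+ 2 + Fsin (fun y => g (y + h) - g y) w ^+ 2 =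
  (Fcos g w ^+ 2 + Fsin g w ^+ 2) * (2 - 2 * cos (2 * pi * dot h w)).
Proof.
move=> ig.
have ish := integrable_shift h ig.
have mc : measurable_fun setT (fun y => cos (2 * pi * dot y w)) by exact: measurable_cos_dot.
have ms : measurable_fun setT (fun y => sin (2 * pi * dot y w)) by exact: measurable_sin_dot.
have igc := integrableMbounded ig mc (fun y => normr_cos _).
have igs := integrableMbounded ig ms (fun y => normr_sin _).
have ishc := integrableMbounded ish mc (fun y => normr_cos _).
have ishs := integrableMbounded ish ms (fun y => normr_sin _).
pose t := 2 * pi * dot h w.
have dE y : 2 * pi * dot y w = 2 * pi * dot (y + h) w - t.
  by rewrite dotDl /t; ring.
have Ec : \int[mu]_y (g (y + h) * cos (2 * pi * dot y w)) =
    cos t * Fcos g w + sin t * Fsin g w.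
  transitivity (\int[mu]_y (cos t * (g (y + h) * cos (2 * pi * dot (y + h) w)) +
      sin t * (g (y + h) * sin (2 * pi * dot (y + h) w)))).
    by apply: eq_Rintegral => y _; rewrite dE cosB; ring.
  rewrite RintegralD//; last 2 first.
  - exact: (integrableZl measurableT (cos t) (integrable_shift h igc)).
  - exact: (integrableZl measurableT (sin t) (integrable_shift h igs)).
  rewrite (RintegralZl (cos t) measurableT (integrable_shift h igc)).
  rewrite (RintegralZl (sin t) measurableT (integrable_shift h igs)).
  by rewrite (Rintegral_shift h igc) (Rintegral_shift h igs).
have Es : \int[mu]_y (g (y + h) * sin (2 * pi * dot y w)) =
    cos t * Fsin g w - sin t * Fcos g w.
  transitivity (\int[mu]_y (cos t * (g (y + h) * sin (2 * pi * dot (y + h) w)) -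
      sin t * (g (y + h) * cos (2 * pi * dot (y + h) w)))).
    by apply: eq_Rintegral => y _; rewrite dE sinB; ring.
  rewrite RintegralB//; last 2 first.
  - exact: (integrableZl measurableT (cos t) (integrable_shift h igs)).
  - exact: (integrableZl measurableT (sin t) (integrable_shift h igc)).
  rewrite (RintegralZl (cos t) measurableT (integrable_shift h igs)).
  rewrite (RintegralZl (sin t) measurableT (integrable_shift h igc)).
  by rewrite (Rintegral_shift h igc) (Rintegral_shift h igs).
have -> : Fcos (fun y => g (y + h) - g y) w = cos t * Fcos g w + sin t * Fsin g w - Fcos g w.
  rewrite -Ec -RintegralB//.
  by apply: eq_Rintegral => y _; rewrite mulrBl.
have -> : Fsin (fun y => g (y + h) - g y) w = cos t * Fsin g w - sin t * Fcos g w - Fsin g w.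
  rewrite -Es -RintegralB//.
  by apply: eq_Rintegral => y _; rewrite mulrBl.
rewrite -/t; have := cos2Dsin2 t; move: (cos t) (sin t) (Fcos g w) (Fsin g w) => c s a b cs.
have -> : (a ^+ 2 + b ^+ 2) * (2 - 2 * c) = (a ^+ 2 + b ^+ 2) * (1 + (c ^+ 2 + s ^+ 2) - 2 * c).
  by rewrite cs; ring.
ring.
Qed.

Lemma ge0_integral_sqr_tensorD (p1 q1 p2 q2 : 'rV[R]_n -> R) :
  L2 mu p1 -> L2 mu q1 -> L2 mu p2 -> L2 mu q2 ->
  (\int[mu]_u \int[mu]_v ((p1 u * q1 v + p2 u * q2 v) ^+ 2)%:E =
   (ip mu p1 p1 * ip mu q1 q1 + 2 * (ip mu p1 p2 * ip mu q1 q2)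
    + ip mu p2 p2 * ip mu q2 q2)%:E)%E.
Proof.
move=> lp1 lq1 lp2 lq2.
pose a := ip mu q1 q1; pose b := ip mu q1 q2; pose c := ip mu q2 q2.
transitivity (\int[mu]_u (a * (p1 u * p1 u) + 2 * b * (p1 u * p2 u) + c * (p2 u * p2 u))%:E)%E.
  apply: eq_integral => u _.
  have := ip_sqr (L2D (L2Z (p1 u) lq1) (L2Z (p2 u) lq2)).
  rewrite ip_sqrD// -/a -/b -/c => ->; congr EFin; ring.
have i1 := integrableZl measurableT a (L2M lp1 lp1).
have i2 := integrableZl measurableT (2 * b) (L2M lp1 lp2).
have i3 := integrableZl measurableT c (L2M lp2 lp2).
have i12 := integrableD measurableT i1 i2.
rewrite -EFin_Rintegral; last exact: (integrableD measurableT i12 i3).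
congr EFin.
rewrite (RintegralD measurableT i12 i3) (RintegralD measurableT i1 i2).
rewrite (RintegralZl a measurableT (L2M lp1 lp1)) (RintegralZl (2 * b) measurableT (L2M lp1 lp2)).
rewrite (RintegralZl c measurableT (L2M lp2 lp2)).
rewrite -/(ip mu p1 p1) -/(ip mu p1 p2) -/(ip mu p2 p2) /a /b /c; ring.
Qed.

Variable f : 'rV[R]_n -> R.
Hypotheses (cf : sepcont f) (lf : L2 mu f).
Local Notation A := (corr f).

Let mf : measurable_fun setT f := lf.1.

Lemma ae_spec : \forall x \ae mu,
  (\int[mu]_w (spec f x w)%:E = \int[mu]_y (cross f x y ^+ 2)%:E)%E.
Proof.
apply: filterS (ae_L2_cross lf) => x lc.
have cc : sepcont (cross f x) by exact: sepcont_cross.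
rewrite (plancherel cc (integrable_cross lf x) lc).
by rewrite corr0 ip_sqr.
Qed.

Lemma ae_spec_difference h : \forall x \ae mu,
  (\int[mu]_w (spec f x w * (2 - 2 * cos (2 * pi * dot h w)))%:E =
   \int[mu]_y ((cross f x (y + h) - cross f x y) ^+ 2)%:E)%E.
Proof.
apply: filterS (ae_L2_cross lf) => x lc.
have ic := integrable_cross lf x; have cc : sepcont (cross f x) by exact: sepcont_cross.
have ld := L2B (L2_shift h lc) lc.
have id := integrableB measurableT (integrable_shift h ic) ic.
rewrite (ip_sqr ld) -corr0.
rewrite -(plancherel _ id ld); last first.
  by apply: sepcontB => //; exact: sepcont_shift.
by apply: eq_integral => w _; rewrite spectrum_difference.
Qed.

Lemma measurable_sqrr d (T : measurableType d) (g : T -> R) : measurable_fun setT g ->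
  measurable_fun setT (fun t => (g t ^+ 2)%:E).
Proof. by move=> mg; apply/measurable_EFinP; exact: measurable_funX. Qed.

Lemma integral_spec (rho : 'rV[R]_n -> R) : measurable_fun setT rho -> (forall x, 0 <= rho x) ->
  (\int[mu]_x \int[mu]_w (rho x * spec f x w)%:E =
   \int[mu]_x \int[mu]_y (rho x * cross f x y ^+ 2)%:E)%E.
Proof.
move=> mr r0.
have m1 : measurable_fun setT (fun z : V2 => (rho z.1 * spec f z.1 z.2)%:E).
  apply/measurable_EFinP; apply: measurable_funM; first exact: measurableT_comp.
  exact: measurable_spec.
have m2 : measurable_fun setT (fun z : V2 => (rho z.1 * cross f z.1 z.2 ^+ 2)%:E).
  apply/measurable_EFinP; apply: measurable_funM; first exact: measurableT_comp.
  by apply: measurable_funX; exact: measurable_cross.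
apply: ge0_ae_eq_integral => //.
- by apply: (measurable_fun_fubini_tonelli_F _ m1) => z; rewrite lee_fin mulr_ge0// spec_ge0.
- by apply: (measurable_fun_fubini_tonelli_F _ m2) => z; rewrite lee_fin mulr_ge0// sqr_ge0.
- by move=> x _; apply: integral_ge0 => w _; rewrite lee_fin mulr_ge0// spec_ge0.
- by move=> x _; apply: integral_ge0 => w _; rewrite lee_fin mulr_ge0// sqr_ge0.
apply: filterS ae_spec => x E _.
under eq_integral do rewrite EFinM.
rewrite ge0_integralZl//; last 3 first.
- apply/measurable_EFinP.
  exact: (measurableT_comp (measurable_spec lf) (@pair1_measurable _ _ _ _ x)).
- by move=> w _; rewrite lee_fin spec_ge0.
- by rewrite lee_fin.
rewrite E -ge0_integralZl//.
- apply: measurable_sqrr.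
  exact: (measurableT_comp (measurable_cross lf) (@pair1_measurable _ _ _ _ x)).
- by move=> w _; rewrite lee_fin sqr_ge0.
- by rewrite lee_fin.
Qed.

(** In the variables [u = x + y/2], [v = x - y/2], adding [h] to [y] moves [u] by [h/2] and [v] by
    [- h/2]. The integrand is then the square of a difference of two tensor products, with cross
    term [- 2 A (h/2) A (- h/2)]. *)
Lemma integral_spec_difference h :
  (\int[mu]_x \int[mu]_w (spec f x w * (2 - 2 * cos (2 * pi * dot h w)))%:E =
   (2 * (A 0 ^+ 2 - A (2^-1 *: h) ^+ 2))%:E)%E.
Proof.
pose F (z : V2) := f (z.1 + 2^-1 *: h) * f (z.2 - 2^-1 *: h) + (- f z.1) * f z.2.
have mF : measurable_fun setT F.
  apply: measurable_funD; apply: measurable_funM.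
  - exact: (measurableT_comp (L2_shift (2^-1 *: h) lf).1 measurable_fst).
  - exact: (measurableT_comp (L2_shift (- (2^-1 *: h)) lf).1 measurable_snd).
  - by apply: measurableT_comp => //; exact: measurableT_comp.
  - exact: measurableT_comp.
have FE x y : F (x + 2^-1 *: y, x - 2^-1 *: y) = cross f x (y + h) - cross f x y.
  by rewrite /F /cross /= scalerDr opprD !addrA mulNr.
have mF' : measurable_fun setT (fun z : V2 => F (z.1 + 2^-1 *: z.2, z.1 - 2^-1 *: z.2)).
  under eq_fun do rewrite FE.
  apply: measurable_funB; last exact: measurable_cross.
  have mq : measurable_fun setT (fun z : V2 => (z.1, z.2 + h)).
    exact: (measurable_fun_pair measurable_fst
      (measurableT_comp (measurable_shift_rV h) measurable_snd)).
  exact: (measurableT_comp (measurable_cross lf) mq).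
have cos2 t : 0 <= 2 - 2 * cos t :> R.
  by have := cos_le1 t; lra.
transitivity (\int[mu]_x \int[mu]_y ((cross f x (y + h) - cross f x y) ^+ 2)%:E)%E.
  apply: ge0_ae_eq_integral => //.
  - apply: (measurable_fun_fubini_tonelli_F (fun z : V2 =>
      (spec f z.1 z.2 * (2 - 2 * cos (2 * pi * dot h z.2)))%:E)).
      apply/measurable_EFinP; apply: measurable_funM; first exact: measurable_spec.
      apply: measurable_funB => //; apply: measurable_funM => //.
      exact: measurable_cos_dot.
    by move=> z; rewrite lee_fin mulr_ge0// spec_ge0.
  - under eq_fun do under eq_integral do rewrite -FE.
    apply: (measurable_fun_fubini_tonelli_F (fun z : V2 =>
      (F (z.1 + 2^-1 *: z.2, z.1 - 2^-1 *: z.2) ^+ 2)%:E)).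
      exact: measurable_sqrr.
    by move=> z; rewrite lee_fin sqr_ge0.
  - by move=> x _; apply: integral_ge0 => w _; rewrite lee_fin mulr_ge0// spec_ge0.
  - by move=> x _; apply: integral_ge0 => w _; rewrite lee_fin sqr_ge0.
  by apply: filterS (ae_spec_difference h) => x + _.
transitivity (\int[mu]_u \int[mu]_v (F (u, v) ^+ 2)%:E)%E.
  rewrite -(ge0_integral_center_difference (F := fun z => (F z ^+ 2)%:E)).
  - by apply: eq_integral => x _; apply: eq_integral => y _; rewrite FE.
  - exact: measurable_sqrr.
  - by move=> z; rewrite lee_fin sqr_ge0.
have lN : L2 mu (fun u => - f u).
  by have := L2Z (-1) lf; under [X in L2 _ X]eq_fun do rewrite mulN1r.
rewrite /F /= (ge0_integral_sqr_tensorD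
  (L2_shift (2^-1 *: h) lf) (L2_shift (- (2^-1 *: h)) lf) lN lf).
rewrite !ip_shifts// !subrr -/(A _) corrN// -(corr0 f).
have -> : ip mu (fun u => - f u) (fun u => - f u) = A 0.
  by rewrite corr0; apply: eq_Rintegral => u _; rewrite mulrNN.
have -> : ip mu (fun u => f (u + 2^-1 *: h)) (fun u => - f u) = - A (2^-1 *: h).
  rewrite ipC -[RHS]mulN1r /corr [in RHS]ipC -ipZl//; last exact: L2_shift.
  by apply: eq_Rintegral => u _; rewrite mulN1r.
congr EFin; ring.
Qed.

End spectral_identities.

(** * Estimates and limits for trigonometric quotients *)

Section trigonometric_limits.
Context {R : realType}.

Lemma normr_sin_le (t : R) : `|sin t| <= `|t|.
Proof.
wlog t0 : t / 0 < t.
  move=> H; have [t0|t0|->] := ltgtP t 0; [|exact: H|by rewrite sin0].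
  by have := H (- t); rewrite sinN !normrN oppr_gt0; exact.
have [|c _] := @MVT R sin cos 0 t t0.
  by apply: continuous_subspaceT => x; exact: continuous_sin.
rewrite sin0 !subr0 => ->.
by rewrite normrM ler_piMl// normr_cos.
Qed.

Lemma two_sub_cosE (t : R) : 2 - 2 * cos t = (2 * sin (t / 2)) ^+ 2.
Proof.
have {1}-> : t = (t / 2) *+ 2 by rewrite -mulr_natr; field.
by rewrite cos_mulr2n cos2sin2 -mulr_natr; ring.
Qed.

Lemma two_sub_cos_le (t : R) : 2 - 2 * cos t <= t ^+ 2.
Proof.
rewrite two_sub_cosE -[leRHS]real_normK ?num_real// -[leLHS]real_normK ?num_real//.
rewrite lerXn2r ?nnegrE// normrM (ger0_norm (x := 2))//.
have := normr_sin_le (t / 2); rewrite normrM (ger0_norm (x := 2^-1)) ?invr_ge0//; lra.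
Qed.

Lemma is_derive_quotient (G : R -> R) (s l : R) (u : R^nat) : is_derive s (1 : R) G l ->
  u @ \oo --> (0 : R) -> (forall k, u k != 0) ->
  (u k)^-1 * (G (s + u k) - G s) @[k --> \oo] --> (l : R).
Proof.
move=> [dv dE] u0 un0.
have H : h^-1 *: (G (h *: 1 + s) - G s) @[h --> (0 : R)^'] --> l.
  by rewrite -dE; exact: dv.
have uc : u @ \oo --> (0 : R)^'.
  move=> P; rewrite /= /dnbhs /within /= => /u0 N.
  have {}N : \forall k \near \oo, u k != 0 -> P (u k) by exact: N.
  have : \forall k \near \oo, P (u k) by apply: filterS N => k; apply.
  by [].
have := cvg_comp u _ uc H.
rewrite (_ : _ \o u = fun k => (u k)^-1 * (G (s + u k) - G s))//.
by apply/funext => k; rewrite /= /GRing.scale /= mulr1 (addrC s).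
Qed.

Lemma sin_div_cvg (b : R) (u : R^nat) : u @ \oo --> (0 : R) -> (forall k, u k != 0) ->
  sin (b * u k) / u k @[k --> \oo] --> b.
Proof.
move=> u0 un0.
have D : is_derive (0 : R) (1 : R) (fun t : R => sin (b * t)) b.
  by apply: is_derive_eq; rewrite /GRing.scale /= mulr0 cos0; ring.
have := is_derive_quotient D u0 un0.
by under [X in X @ _ --> _ -> _]eq_fun do rewrite mulr0 sin0 subr0 add0r mulrC.
Qed.

End trigonometric_limits.


Section moments.
Context {R : realType} (n : nat).
Local Notation mu := (@lebesgue_rV R n).
Local Notation mu2 := (mu \x mu)%E.
Local Notation V2 := ('rV[R]_n * 'rV[R]_n)%type.
Implicit Types (x y w h u v p : 'rV[R]_n) (i : 'I_n).

Variable f : 'rV[R]_n -> R.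
Hypotheses (cf : sepcont f) (lf : L2 mu f).
Hypothesis lx : forall i, L2 mu (fun x => x ord0 i * f x).
Local Notation A := (corr f).
Local Notation e i := (delta_mx ord0 i : 'rV[R]_n).

Let mspec : measurable_fun setT (fun z : V2 => spec f z.1 z.2) := measurable_spec lf.

Definition xmul p i x := (x ord0 i - p ord0 i) * f x.

Lemma L2_xmul p i : L2 mu (xmul p i).
Proof.
have := L2B (lx i) (L2Z (p ord0 i) lf).
by under [X in L2 _ X]eq_fun do rewrite -mulrBl.
Qed.

Lemma integral_spec_total : (\int[mu2]_z (spec f z.1 z.2)%:E = (A 0 ^+ 2)%:E)%E.
Proof.
rewrite (fubini_tonelli1 (fun z : V2 => (spec f z.1 z.2)%:E)); last 2 first.
- by apply/measurable_EFinP.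
- by move=> z; rewrite lee_fin spec_ge0.
rewrite -(integral_cross_sqr lf) /fubini_F.
have := integral_spec cf lf (measurable_cst (1 : R)) (fun=> ler01).
under eq_integral do under eq_integral do rewrite mul1r.
by under [in X in _ = X -> _]eq_integral do under eq_integral do rewrite mul1r.
Qed.

Lemma integral_spec_diff h :
  (\int[mu2]_z (spec f z.1 z.2 * (2 - 2 * cos (2 * pi * dot h z.2)))%:E =
   (2 * (A 0 ^+ 2 - A (2^-1 *: h) ^+ 2))%:E)%E.
Proof.
rewrite -(integral_spec_difference cf lf).
apply: (fubini_tonelli1 (fun z : V2 =>
  (spec f z.1 z.2 * (2 - 2 * cos (2 * pi * dot h z.2)))%:E)).
  apply/measurable_EFinP; apply: measurable_funM => //.
  by apply: measurable_funB => //; apply: measurable_funM => //; exact: measurable_cos_dot.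
by move=> z; rewrite lee_fin mulr_ge0 ?spec_ge0// two_sub_cosE sqr_ge0.
Qed.

(** Since [x] is the midpoint of [u] and [v], the factor [x_i - p_i] splits into halves and gives
    the symmetric tensor [F]. The last term, the cross term of its square, measures how far [p] is
    from the centroid of [f] in direction [i]. *)
Lemma integral_spec_xmoment p i :
  (\int[mu2]_z ((z.1 ord0 i - p ord0 i) ^+ 2 * spec f z.1 z.2)%:E =
   (2^-1 * A 0 * ip mu (xmul p i) (xmul p i) + 2^-1 * (ip mu f (xmul p i)) ^+ 2)%:E)%E.
Proof.
have mxi : measurable_fun setT (fun x : 'rV[R]_n => (x ord0 i - p ord0 i) ^+ 2).
  by apply: measurable_funX; apply: measurable_funB => //; exact: measurable_coord.
rewrite (fubini_tonelli1 (fun z : V2 =>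
  ((z.1 ord0 i - p ord0 i) ^+ 2 * spec f z.1 z.2)%:E)); last 2 first.
- apply/measurable_EFinP; apply: measurable_funM => //.
  exact: measurableT_comp mxi measurable_fst.
- by move=> z; rewrite lee_fin mulr_ge0 ?sqr_ge0 ?spec_ge0.
rewrite /fubini_F (integral_spec cf lf mxi (fun=> sqr_ge0 _)).
pose F (z : V2) := 2^-1 * xmul p i z.1 * f z.2 + 2^-1 * f z.1 * xmul p i z.2.
have mq := (L2_xmul p i).1; have mf := lf.1.
have mF : measurable_fun setT F.
  apply: measurable_funD; apply: measurable_funM; try exact: measurableT_comp.
    by apply: measurable_funM => //; exact: measurableT_comp.
  by apply: measurable_funM => //; exact: measurableT_comp.
transitivity (\int[mu]_x \int[mu]_y (F (x + 2^-1 *: y, x - 2^-1 *: y) ^+ 2)%:E)%E.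
  apply: eq_integral => x _; apply: eq_integral => y _; congr EFin.
  by rewrite /F /cross /xmul /= !mxE; field.
rewrite (ge0_integral_center_difference (F := fun z => (F z ^+ 2)%:E)); last 2 first.
- exact: measurable_sqrr.
- by move=> z; rewrite lee_fin sqr_ge0.
have lq := L2_xmul p i.
rewrite (ge0_integral_sqr_tensorD (L2Z 2^-1 lq) lf (L2Z 2^-1 lf) lq).
have ipZZ (g k : 'rV[R]_n -> R) : L2 mu g -> L2 mu k ->
    ip mu (fun x => 2^-1 * g x) (fun x => 2^-1 * k x) = 4^-1 * ip mu g k.
  move=> lg lk; rewrite (ipZl _ lg (L2Z 2^-1 lk)) ipC (ipZl _ lk lg) ipC; by field.
rewrite !ipZZ// (ipC _ (xmul p i) f) -(corr0 f); congr EFin; by field.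
Qed.

(** The factor [2 * pi] matches the increments along [h = t *: e i], where [2 - 2 cos (2 pi h.w)] is
    [t ^ 2 (2 pi w_i) ^ 2] to leading order. *)
Definition wmom i := (\int[mu2]_z ((2 * pi * z.2 ord0 i) ^+ 2 * spec f z.1 z.2)%:E)%E.

Lemma wmom_ge0 i : (0 <= wmom i)%E.
Proof.
by apply: integral_ge0 => z _; rewrite lee_fin mulr_ge0 ?sqr_ge0 ?spec_ge0.
Qed.

Lemma measurable_wmom i : measurable_fun setT
  (fun z : V2 => (2 * pi * z.2 ord0 i) ^+ 2 * spec f z.1 z.2).
Proof.
apply: measurable_funM => //; apply: measurable_funX; apply: measurable_funM => //.
exact: measurableT_comp (measurable_coord i) measurable_snd.
Qed.

Lemma dot_delta (t : R) i w : dot (t *: e i) w = t * w ord0 i.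
Proof.
rewrite dotE (bigD1 i)//= big1 ?addr0 => [|j ji]; first by rewrite !mxE !eqxx mulr1.
by rewrite !mxE eqxx (negbTE ji) mulr0 mul0r.
Qed.

Lemma wmom_ge i (t : R) :
  ((2 * (A 0 ^+ 2 - A (2^-1 *: (t *: e i)) ^+ 2))%:E <= (t ^+ 2)%:E * wmom i)%E.
Proof.
rewrite -integral_spec_diff /wmom -ge0_integralZl//; last 3 first.
- by apply/measurable_EFinP; exact: measurable_wmom.
- by move=> z _; rewrite lee_fin mulr_ge0 ?sqr_ge0 ?spec_ge0.
- by rewrite lee_fin sqr_ge0.
apply: ge0_le_integral => //.
- by move=> z _; rewrite lee_fin mulr_ge0 ?spec_ge0// two_sub_cosE sqr_ge0.
- apply/measurable_EFinP; apply: measurable_funM => //.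
  by apply: measurable_funB => //; apply: measurable_funM => //; exact: measurable_cos_dot.
- by apply/measurable_EFinP; apply: measurable_funM => //; exact: measurable_wmom.
- move=> z _; rewrite -EFinM lee_fin mulrA mulrC ler_wpM2r ?spec_ge0//.
  rewrite (le_trans (two_sub_cos_le _))// -exprMn dot_delta.
  by rewrite le_eqVlt; apply/orP; left; apply/eqP; congr (_ ^+ 2); ring.
Qed.

(** Converse to [wmom_ge]: the quotients [(2 - 2 cos) / u k ^ 2] converge pointwise to
    [(2 pi w_i) ^ 2], so by Fatou's lemma a bound along one sequence suffices. *)
Lemma wmom_le i (u : R^nat) (c : R) : u @ \oo --> (0 : R) -> (forall k, u k != 0) ->
  (forall k, 2 * (A 0 ^+ 2 - A (2^-1 *: (u k *: e i)) ^+ 2) <= u k ^+ 2 * c) ->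
  (wmom i <= c%:E)%E.
Proof.
move=> u0 un0 Ac.
have mF k : measurable_fun setT (fun z : V2 =>
    spec f z.1 z.2 * (2 - 2 * cos (2 * pi * dot (u k *: e i) z.2))).
  apply: measurable_funM => //.
  by apply: measurable_funB => //; apply: measurable_funM => //; exact: measurable_cos_dot.
apply: (fatou_cvg (c := fun=> c) (F := fun k z => u k ^- 2 *
    (spec f z.1 z.2 * (2 - 2 * cos (2 * pi * dot (u k *: e i) z.2))))).
- by move=> k; exact: measurable_funM.
- move=> k z; apply: mulr_ge0; first by rewrite invr_ge0 sqr_ge0.
  by apply: mulr_ge0; [exact: spec_ge0|rewrite two_sub_cosE sqr_ge0].
- move=> z.
  have E k : u k ^- 2 * (spec f z.1 z.2 * (2 - 2 * cos (2 * pi * dot (u k *: e i) z.2))) =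
      (2 * (sin (pi * z.2 ord0 i * u k) / u k)) ^+ 2 * spec f z.1 z.2.
    rewrite two_sub_cosE dot_delta.
    have -> : 2 * pi * (u k * z.2 ord0 i) / 2 = pi * z.2 ord0 i * u k by field.
    by move: (sin _) (un0 k) => s uk0; field.
  under eq_fun do rewrite E.
  apply: cvgM; last exact: cvg_cst.
  have H : 2 * (sin (pi * z.2 ord0 i * u k) / u k) @[k --> \oo] --> 2 * (pi * z.2 ord0 i).
    by apply: cvgM; [exact: cvg_cst|exact: sin_div_cvg].
  rewrite -mulrA expr2; under eq_fun do rewrite expr2.
  exact: cvgM.
- move=> k; under eq_integral do rewrite EFinM.
  rewrite ge0_integralZl//; last 3 first.
  + exact/measurable_EFinP.
  + by move=> z _; rewrite lee_fin mulr_ge0 ?spec_ge0// two_sub_cosE sqr_ge0.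
  + by rewrite lee_fin invr_ge0 sqr_ge0.
  rewrite integral_spec_diff -EFinM lee_fin.
  by rewrite ler_pdivrMl; [exact: Ac|rewrite exprn_even_gt0//; exact: un0].
- exact: cvg_cst.
Qed.

End moments.

(** * Inequality for central differences *)

Lemma cvgn_le (R : realType) (u : R^nat) (l c : R) :
  (forall k, u k <= c) -> u @ \oo --> l -> l <= c.
Proof.
move=> uc ul; rewrite -(cvg_lim _ ul)//; apply: limr_le; last exact: nearW.
by apply/cvg_ex; exists l.
Qed.

Lemma cvgn_ge (R : realType) (u : R^nat) (l c : R) :
  (forall k, c <= u k) -> u @ \oo --> l -> c <= l.
Proof.
move=> uc ul; rewrite -(cvg_lim _ ul)//; apply: limr_ge; last exact: nearW.
by apply/cvg_ex; exists l.
Qed.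

Section central_differences.
Context {R : realType} (n : nat).
Local Notation mu := (@lebesgue_rV R n).
Implicit Types (x y w h u p : 'rV[R]_n) (i : 'I_n) (t z : R).

Variable f : 'rV[R]_n -> R.
Hypotheses (cf : sepcont f) (lf : L2 mu f).
Hypothesis lx : forall i, L2 mu (fun x => x ord0 i * f x).
Local Notation A := (corr f).
Local Notation e i := (delta_mx ord0 i : 'rV[R]_n).
Local Notation X p i := (ip mu (xmul f p i) (xmul f p i)).

Definition cdiff t i x := f (x + t *: e i) - f (x + - (t *: e i)).

(** Discrete form of [d_i f + (x_i - p_i) f / z]; the functions that this expression annihilates for
    all [i] are the multiples of the Gaussian with centre [p] and parameter [z]. *)
Definition resid z p t i x := (2 * t)^-1 * cdiff t i x + z^-1 * xmul f p i x.

Definition step (k : nat) : R := k.+1%:R^-1.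

Lemma step_gt0 k : 0 < step k. Proof. by rewrite invr_gt0. Qed.

Lemma step_neq0 k : step k != 0. Proof. by rewrite lt0r_neq0// step_gt0. Qed.

Lemma step_cvg0 : step @ \oo --> (0 : R). Proof. exact: cvg_harmonic. Qed.

Lemma L2_cdiff t i : L2 mu (cdiff t i).
Proof. by apply: L2B; exact: L2_shift. Qed.

Lemma L2_resid z p t i : L2 mu (resid z p t i).
Proof. by apply: L2D; apply: L2Z; [exact: L2_cdiff|exact: L2_xmul]. Qed.

(** Exact discrete integration by parts: translating the second half of the difference by [t *: e i]
    leaves only the increment [t] of the factor [x_i - p_i]. Divided by [2 * t], it tends to
    [- A 0 / 2]. *)
Lemma ip_cdiff_xmul p t i : ip mu (cdiff t i) (xmul f p i) = - t * A (t *: e i).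
Proof.
have lq := L2_xmul lf lx p i.
have lfp := L2_shift (t *: e i) lf; have lfm := L2_shift (- (t *: e i)) lf.
have -> : ip mu (cdiff t i) (xmul f p i) =
    ip mu (fun x => f (x + t *: e i)) (xmul f p i) -
    ip mu (fun x => f (x + - (t *: e i))) (xmul f p i).
  rewrite /ip -RintegralB//; [|exact: L2M..].
  by apply: eq_Rintegral => x _; rewrite /cdiff mulrBl.
rewrite -(ip_shift (t *: e i) lfm lq).
have -> : ip mu (fun x => f (x + t *: e i + - (t *: e i))) (fun x => xmul f p i (x + t *: e i)) =
    ip mu (fun x => f (x + t *: e i)) (xmul f p i) + t * A (t *: e i).
  rewrite /corr -(ipZl t lfp lf) /ip -RintegralD//; last 2 first.
  - exact: L2M.
  - exact: L2M (L2Z t lfp) lf.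
  apply: eq_Rintegral => x _; rewrite addrK /xmul !mxE !eqxx mulr1; ring.
ring.
Qed.

Lemma ip_resid z p t i : t != 0 -> z != 0 -> ip mu (resid z p t i) (resid z p t i) =
  (A 0 - A ((2 * t) *: e i)) / (2 * t ^+ 2) - A (t *: e i) / z + X p i / z ^+ 2.
Proof.
move=> t0 z0; rewrite ip_sqrD; [|exact: L2_cdiff|exact: L2_xmul].
rewrite ip_cdiff_xmul ip_diff// opprK -scalerDl -mulr2n -[t *+ 2]mulr_natl.
by field; rewrite t0 z0.
Qed.

Lemma xmul_ip_gt0 p i : 0 < A 0 -> 0 < X p i.
Proof.
move=> A00; rewrite lt_neqAle ip_ge0 andbT eq_sym; apply/eqP => X0.
have At t : t != 0 -> A (t *: e i) <= 0.
  move=> t0; rewrite leNgt; apply/negP => At0.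
  pose b := (A 0 - A ((2 * t) *: e i)) / (2 * t ^+ 2).
  have b0 : 0 <= b.
    apply: divr_ge0; last by rewrite mulr_ge0// sqr_ge0.
    by rewrite subr_ge0 (le_trans (ler_norm _))// normr_corr.
  have b1 : 0 < b + 1 by lra.
  (* If [X p i = 0], the squared norm of the residual is [b - A (t *: e i) / z]; this [z] gives it
     the value -1. *)
  pose z := A (t *: e i) / (b + 1).
  have z0 : z != 0 by rewrite mulf_neq0 ?invr_neq0 ?lt0r_neq0.
  have := ip_ge0 mu (resid z p t i).
  rewrite ip_resid// X0 mul0r addr0 -/b /z invf_div mulrCA divff ?lt0r_neq0// mulr1; lra.
have := cvgn_le (fun k => At _ (step_neq0 k)) (corr_cvg1 i cf lf step_cvg0).
by rewrite leNgt A00.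
Qed.

(** The moment bounds [A 0 ^ 2 - A ^ 2] and not [A 0 - A], so the squared norm is multiplied by
    [A 0 + A (2 t e_i)]. The step [4 * t] in [wmom_ge] is halved there and yields the [2 * t] of the
    central difference. *)
Lemma resid_bound z p i k (v : R) : z != 0 -> wmom f i = v%:E ->
  (A 0 + A ((2 * step k) *: e i)) * ip mu (resid z p (step k) i) (resid z p (step k) i) <=
  4 * v + (A 0 + A ((2 * step k) *: e i)) * (- A (step k *: e i) / z + X p i / z ^+ 2).
Proof.
move=> z0 Vv; have t0 := step_neq0 k; set t := step k.
rewrite ip_resid// -addrA mulrDr mulNr lerD2r.
have := wmom_ge cf lf i (4 * t).
rewrite Vv -EFinM lee_fin scalerA (_ : 2^-1 * (4 * t) = 2 * t); last by field.
move: (A 0) (A _) => a b H.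
rewrite mulrA ler_pdivrMr; last by rewrite mulr_gt0// exprn_even_gt0.
rewrite -(ler_pM2l (x := 2))//; lra.
Qed.

Definition resid_limit z p i (v : R) := 4 * v + (2 * A 0) * (- A 0 / z + X p i / z ^+ 2).

Lemma resid_bound_cvg z p i (v : R) :
  4 * v + (A 0 + A ((2 * step k) *: e i)) * (- A (step k *: e i) / z + X p i / z ^+ 2)
    @[k --> \oo] --> (resid_limit z p i v : R).
Proof.
have s2 : 2 * step k @[k --> \oo] --> (0 : R).
  by rewrite -[0](mulr0 2); apply: cvgM; [exact: cvg_cst|exact: step_cvg0].
apply: cvgD; first exact: cvg_cst.
have -> : 2 * A 0 = A 0 + A 0 by ring.
apply: cvgM; first by apply: cvgD; [exact: cvg_cst|exact: corr_cvg1].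
apply: cvgD; last exact: cvg_cst.
apply: cvgM; last exact: cvg_cst.
by apply: cvgN; exact: corr_cvg1 step_cvg0.
Qed.

Lemma corr_sum_ge0 h : 0 <= A 0 + A h.
Proof. by have := normr_corr h lf; rewrite ler_norml => /andP[+ _]; lra. Qed.

Lemma resid_limit_ge0 z p i (v : R) : z != 0 -> wmom f i = v%:E -> 0 <= resid_limit z p i v.
Proof.
move=> z0 Vv; apply: (cvgn_ge _ (@resid_bound_cvg z p i v)) => k.
apply: le_trans (resid_bound p k z0 Vv).
by rewrite mulr_ge0 ?ip_ge0// corr_sum_ge0.
Qed.

(** The factor of [resid_bound] tends to [2 * A 0], which is not 0, and can be divided out for large
    [k]. *)
Lemma resid_cvg0 z p i (v : R) : 0 < A 0 -> z != 0 -> wmom f i = v%:E -> resid_limit z p i v = 0 ->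
  ip mu (resid z p (step k) i) (resid z p (step k) i) @[k --> \oo] --> (0 : R).
Proof.
move=> A00 z0 Vv L0.
pose a k := A 0 + A ((2 * step k) *: e i).
pose N k := ip mu (resid z p (step k) i) (resid z p (step k) i).
have s2 : 2 * step k @[k --> \oo] --> (0 : R).
  by rewrite -[0](mulr0 2); apply: cvgM; [exact: cvg_cst|exact: step_cvg0].
have a2 : a @ \oo --> 2 * A 0.
  have -> : 2 * A 0 = A 0 + A 0 by ring.
  by apply: cvgD; [exact: cvg_cst|exact: corr_cvg1].
have aN : a k * N k @[k --> \oo] --> (0 : R).
  have B := @resid_bound_cvg z p i v; rewrite L0 in B.
  apply: (squeeze_cvgr _ (cvg_cst (0 : R)) B); apply: nearW => k.
  by rewrite resid_bound// mulr_ge0 ?ip_ge0// corr_sum_ge0.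
have a20 : 2 * A 0 != 0 by rewrite mulf_neq0// lt0r_neq0.
have H : (a k)^-1 * (a k * N k) @[k --> \oo] --> (2 * A 0)^-1 * 0.
  by apply: cvgM => //; exact: cvgV.
rewrite mulr0 in H.
apply: cvg_trans H; apply: near_eq_cvg.
have : \forall k \near \oo, a k != 0.
  exact: (a2 [set y | y != 0] (open_nbhs_nbhs (conj (@open_neq _ _) a20))).
by apply: filterS => k ak; rewrite mulKf.
Qed.

(** One [z] must serve all coordinates, since the extremal Gaussian is isotropic; so the limits are
    summed before [z] is chosen. Under equality a sum of nonnegative limits vanishes, hence each of
    them does. *)
Lemma heisenberg p (v : 'I_n -> R) : (0 < n)%N -> 0 < A 0 ->
  (forall i, wmom f i = (v i)%:E) ->
  n%:R ^+ 2 * A 0 ^+ 3 <= 8 * (\sum_i v i) * (\sum_i X p i) /\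
  (n%:R ^+ 2 * A 0 ^+ 3 = 8 * (\sum_i v i) * (\sum_i X p i) ->
   exists2 z : R, 0 < z & forall i,
   ip mu (resid z p (step k) i) (resid z p (step k) i) @[k --> \oo] --> (0 : R)).
Proof.
move=> n0 A00 Vv.
set sv := \sum_i v i; set sX := \sum_i X p i.
have sX0 : 0 < sX.
  rewrite /sX (bigD1 (Ordinal n0))//=; apply: ltr_wpDr; last exact: xmul_ip_gt0.
  by apply: sumr_ge0 => i _; exact: ip_ge0.
have nR : 0 < n%:R :> R by rewrite ltr0n.
(* This [z] minimizes the sum of the limits over [i]. *)
pose z := 2 * sX / (n%:R * A 0).
have z0 : 0 < z by rewrite divr_gt0// mulr_gt0.
have zn0 := lt0r_neq0 z0.
have E : \sum_i resid_limit z p i (v i) = 4 * sv - n%:R ^+ 2 * A 0 ^+ 3 / (2 * sX).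
  rewrite big_split/= -mulr_sumr -/sv -mulr_sumr big_split/= sumr_const card_ord -mulr_suml -/sX.
  rewrite /z -mulr_natl; field.
  by rewrite !lt0r_neq0.
have L0 i : 0 <= resid_limit z p i (v i) by exact: resid_limit_ge0.
have sL0 : 0 <= \sum_i resid_limit z p i (v i) by apply: sumr_ge0.
split.
  move: sL0; rewrite E subr_ge0 ler_pdivrMr ?mulr_gt0//; lra.
move=> Eq; exists z => // i.
have /eqP : \sum_i resid_limit z p i (v i) = 0.
  by rewrite E Eq; field; exact: lt0r_neq0.
rewrite psumr_eq0// => /allP /(_ i (mem_index_enum i)) /= /eqP Li.
exact: (resid_cvg0 A00 zn0 (Vv i) Li).
Qed.

End central_differences.

(** * Rigidity in the equality case *)

Section line.
Context {R : realType}.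
Local Notation leb := (@lebesgue_measure R).
Implicit Types (a b s t S : R).

(** The infimum over a tail integrates to at most every later [c k], hence to 0. This takes the
    place of an almost everywhere convergent subsequence: the indices where [F] is small may depend
    on the point. *)
Lemma ae_einfs0 d (T : measurableType d) (mu : {measure set T -> \bar R})
    (F : (T -> \bar R)^nat) (c : R^nat) :
  (forall k, measurable_fun setT (F k)) -> (forall k x, 0 <= F k x)%E ->
  (forall k, \int[mu]_x F k x <= (c k)%:E)%E -> c @ \oo --> (0 : R) ->
  \forall x \ae mu, forall N, einfs (F ^~ x) N = 0%E.
Proof.
move=> mF F0 Fc c0; apply: ae_foralln => N.
pose g x := einfs (F ^~ x) N.
have g0 x : (0 <= g x)%E by apply: le_ereal_inf_tmp => _ [m /= _ <-].
have mg : measurable_fun setT g by exact: measurable_fun_einfs.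
have : (\int[mu]_x `|g x| = 0)%E.
  under eq_integral do rewrite gee0_abs//.
  apply/eqP; rewrite eq_le integral_ge0// andbT.
  have C : (fun k => (c (k + N)%N)%:E) @ \oo --> 0%E.
    by apply: cvg_EFin; [exact: nearW|rewrite (cvg_shiftn N c)].
  rewrite -(cvg_lim _ C)//; apply: lime_ge; first by apply/cvg_ex; exists 0%E.
  apply: nearW => k; apply: le_trans (Fc _); apply: ge0_le_integral => //.
  by move=> x _; apply: ereal_inf_lbound; exists (k + N)%N => //=; exact: leq_addl.
move/(ae_eq_integral_abs mu measurableT mg).
by apply: filterS => x /(_ I).
Qed.

Lemma exists_primitive (phi : R -> R) (M : R) : continuous phi -> 0 < M ->
  exists G : R -> R, forall s, - M < s < M -> is_derive s (1 : R) G (phi s).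
Proof.
move=> cphi M0; exists (fun s => \int[leb]_(t in `[- M, s]) phi t) => s /andP[Ms sM].
have ci : leb.-integrable `[- M, M] (EFin \o phi).
  apply: continuous_compact_integrable; first exact: segment_compact.
  exact: continuous_subspaceT.
have [d dE] := continuous_FTC1_closed sM ci Ms (cphi s).
apply: DeriveDef; first exact: d.
by rewrite -derive1E; exact: dE.
Qed.

Lemma is_derive_central (G : R -> R) s l : is_derive s (1 : R) G l ->
  (2 * step k)^-1 * (G (s + step k) - G (s - step k)) @[k --> \oo] --> (l : R).
Proof.
move=> dG.
have s0 := @step_cvg0 R.
have ms0 : - step k @[k --> \oo] --> (0 : R) by rewrite -[0]oppr0; exact: cvgN.
have H1 := is_derive_quotient dG s0 (@step_neq0 R).
have H2 : (- step k)^-1 * (G (s + - step k) - G s) @[k --> \oo] --> (l : R).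
  by apply: (is_derive_quotient dG ms0) => k; rewrite oppr_eq0 step_neq0.
have H : 2^-1 * ((step k)^-1 * (G (s + step k) - G s) +
    (- step k)^-1 * (G (s + - step k) - G s)) @[k --> \oo] --> 2^-1 * (l + l).
  by apply: cvgM; [exact: cvg_cst|exact: cvgD].
rewrite (_ : 2^-1 * (l + l) = l) in H; last by field.
apply: cvg_trans H; apply: near_eq_cvg; apply: nearW => k.
by field; rewrite step_neq0.
Qed.

Variables (phi b : R -> R) (S : R).
Hypotheses (cphi : continuous phi) (cb : continuous b) (S0 : 0 < S).

Let r k s := (2 * step k)^-1 * (phi (s + step k) - phi (s - step k)) + b s * phi s.

Hypothesis r0 : forall N,
  einfs (fun k => \int[leb]_(s in `[(- S)%R, S]) (r k s ^+ 2)%:E)%E N = 0%E.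

Let step_le1 k : step k <= 1 :> R.
Proof. by rewrite invf_le1// ler1n. Qed.

Let cr k : continuous (r k).
Proof.
move=> s; apply: cvgD; last by apply: cvgM; [exact: cb|exact: cphi].
apply: cvgM; first exact: cvg_cst.
apply: cvgB.
  apply: (@continuous_comp _ _ _ (fun s => s + step k) phi); last exact: cphi.
  by apply: cvgD; [exact: cvg_id|exact: cvg_cst].
apply: (@continuous_comp _ _ _ (fun s => s - step k) phi); last exact: cphi.
by apply: cvgB; [exact: cvg_id|exact: cvg_cst].
Qed.

(** The equation [phi' = - b phi] in integrated form: [phi] is only continuous here, and its
    differentiability is a consequence. *)
Let line_const : exists K : R -> R,
  (forall s, - S < s < S -> is_derive s (1 : R) K (b s * phi s)) /\
  forall x y, - S < x -> x < y -> y < S -> phi y + K y = phi x + K x.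
Proof.
(* One unit of margin covers the steps, which are at most 1; the other lets [W k] be differentiable
   beyond the interval, as the fundamental theorem asks at the end points. *)
have M0 : 0 < S + 2 by rewrite ltr_wpDr.
have cbp : continuous (fun s => b s * phi s).
  by move=> s; apply: cvgM; [exact: cb|exact: cphi].
have [G dG] := exists_primitive cphi M0.
have [K dK] := exists_primitive cbp M0.
exists K; split.
  by move=> s /andP[Ss sS]; apply: dK; apply/andP; split; lra.
move=> x y Sx xy yS.
(* [W k] is a primitive of the residual [r k] and tends to [phi + K]. *)
pose W k s := (2 * step k)^-1 * (G (s + step k) - G (s - step k)) + K s.
have dW k s : - S - 1 < s < S + 1 -> is_derive s (1 : R) (W k) (r k s).
  move=> /andP[Ss sS]; have t0 := step_gt0 k : 0 < step k :> R; have t1 := step_le1 k.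
  have i1 : - (S + 2) < s + step k < S + 2 by apply/andP; split; lra.
  have i2 : - (S + 2) < s - step k < S + 2 by apply/andP; split; lra.
  have i3 : - (S + 2) < s < S + 2 by apply/andP; split; lra.
  have d3 := dK _ i3.
  have e1 : is_derive s (1 : R) (fun s => G (s + step k)) (phi (s + step k)).
    have d1 : is_derive (s + step k) (1 : R) G (phi (s + step k)) by exact: dG.
    have sh : is_derive s (1 : R) (fun s : R => s + step k) 1.
      by apply: is_derive_eq; rewrite addr0.
    by rewrite -[phi _]mulr1; exact: (@is_derive1_comp _ G (fun s : R => s + step k) s _ _ d1 sh).
  have e2 : is_derive s (1 : R) (fun s => G (s - step k)) (phi (s - step k)).
    have d2 : is_derive (s - step k) (1 : R) G (phi (s - step k)) by exact: dG.
    have sh : is_derive s (1 : R) (fun s : R => s - step k) 1.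
      by apply: is_derive_eq; rewrite subr0.
    by rewrite -[phi _]mulr1; exact: (@is_derive1_comp _ G (fun s : R => s - step k) s _ _ d2 sh).
  have e3 := is_deriveD (is_deriveZ (2 * step k)^-1 (is_deriveB e1 e2)) d3.
  exact: e3.
have Wint k : (\int[leb]_(s in `[x, y]) (r k s)%:E = (W k y)%:E - (W k x)%:E)%E.
  have dd s : x - 1 < s < y + 1 -> derivable (W k) s 1.
    move=> /andP[? ?]; have [] := dW k s; last by [].
    by apply/andP; split; lra.
  have cc s : x - 1 < s < y + 1 -> {for s, continuous (W k)}.
    by move=> sxy; apply: differentiable_continuous; apply/derivable1_diffP; exact: dd.
  apply: continuous_FTC2 => //.
  - by apply: continuous_subspaceT => s; exact: cr.
  - split.
    + by move=> s; rewrite in_itv/= => /andP[? ?]; apply: dd; apply/andP; split; lra.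
    + by apply: cvg_at_right_filter; apply: cc; apply/andP; split; lra.
    + by apply: cvg_at_left_filter; apply: cc; apply/andP; split; lra.
  - move=> s; rewrite in_itv/= => /andP[? ?]; rewrite derive1E.
    have [] := dW k s; last by [].
    by apply/andP; split; lra.
have sub : `[x, y] `<=` `[- S, S].
  by move=> s /=; rewrite !in_itv/= => /andP[? ?]; apply/andP; split; lra.
have mr k : measurable_fun setT (r k) by apply: continuous_measurable_fun; exact: cr.
(* Weighted AM-GM: [|r| <= d / 2 + r^2 / (2 d)]. *)
have bound k (d : R) : 0 < d -> (`|W k y - W k x|%:E <=
    (d * S)%:E + (2 * d)^-1%:E * \int[leb]_(s in `[(- S)%R, S]) (r k s ^+ 2)%:E)%E.
  move=> d0; have dn0 := lt0r_neq0 d0.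
  have -> : (`|W k y - W k x|%:E = `|\int[leb]_(s in `[x, y]) (r k s)%:E|)%E.
    by rewrite Wint -EFinB.
  have mr2 : measurable_fun setT (fun s => (r k s ^+ 2)%:E) by exact: measurable_sqrr.
  have mrxy : measurable_fun `[x, y] (EFin \o r k).
    by apply/measurable_EFinP; exact: measurable_funTS.
  apply: (@le_trans _ _ (\int[leb]_(s in `[x, y]) `|(r k s)%:E|)%E).
    by apply: le_abse_integral => //; exact: measurable_itv.
  apply: (@le_trans _ _
      (\int[leb]_(s in `[x, y]) ((d / 2)%:E + ((2 * d)^-1)%:E * (r k s ^+ 2)%:E))%E).
    apply: ge0_le_integral => //.
    - exact: measurableT_comp.
    - apply: emeasurable_funD; first exact: measurable_cst.
      exact: (emeasurable_funM (measurable_cst _) (measurable_funTS mr2)).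
    - move=> s _; rewrite /= -EFinM -EFinD lee_fin.
      have := sqr_ge0 (`|r k s| - d); rewrite -(real_normK (num_real (r k s))).
      move: `|r k s| => a H.
      rewrite -subr_ge0 (_ : _ - _ = (2 * d)^-1 * (a - d) ^+ 2); last by field.
      by rewrite mulr_ge0// invr_ge0 mulr_ge0// ltW.
  rewrite ge0_integralD//; last 3 first.
  - by move=> s _; rewrite lee_fin divr_ge0// ltW.
  - by move=> s _; rewrite -EFinM lee_fin mulr_ge0 ?sqr_ge0// invr_ge0 mulr_ge0// ltW.
  - exact: (emeasurable_funM (measurable_cst _) (measurable_funTS mr2)).
  rewrite ge0_integralZl//; last 3 first.
  - exact: measurable_funTS.
  - by move=> s _; rewrite lee_fin sqr_ge0.
  - by rewrite lee_fin invr_ge0 mulr_ge0// ltW.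
  apply: leeD.
    rewrite integral_cst//= lebesgue_measure_itv/= lte_fin xy -EFinD -EFinM lee_fin.
    have : y - x <= 2 * S by lra.
    by move=> /(ler_wpM2l (ltW d0)); lra.
  rewrite lee_pmul2l//; last by rewrite lte_fin invr_gt0 mulr_gt0.
  apply: ge0_subset_integral => //; last by move=> s _; rewrite lee_fin sqr_ge0.
  exact: measurable_funTS.
have Wcvg s : - S < s < S -> W k s @[k --> \oo] --> (phi s + K s : R).
  move=> /andP[? ?]; apply: cvgD; last exact: cvg_cst.
  by apply: is_derive_central; apply: dG; apply/andP; split; lra.
have Dcvg : `|W k y - W k x| @[k --> \oo] --> (`|(phi y + K y) - (phi x + K x)| : R).
  by apply: cvg_norm; apply: cvgB; apply: Wcvg; apply/andP; split; lra.
apply/eqP; rewrite -subr_eq0 -normr_eq0; apply/negPn/negP => P0.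
set P := `|_| in P0 Dcvg.
have Pp : 0 < P by rewrite lt_neqAle eq_sym P0 /P normr_ge0.
(* This makes the term [d * S] of [bound] equal to [P / 4]. Once the increment of [W k] exceeds
   [P / 2], the integral of [r k ^ 2] is at least [2 * d * (P / 4)], against the vanishing
   infimum. *)
pose d := P / (4 * S).
have d0 : 0 < d by rewrite divr_gt0// mulr_gt0.
have [N _ HN] : \forall k \near \oo, P / 2 < `|W k y - W k x|.
  have := Dcvg [set z | P / 2 < z]; apply.
  apply: open_nbhs_nbhs; split; first exact: open_gt.
  by rewrite /= ltr_pdivrMr// ltr_pMr// ltr1n.
have := r0 N; apply/eqP; rewrite gt_eqF//.
apply: (@lt_le_trans _ _ ((2 * d * (P / 4))%:E)).
  by rewrite lte_fin; apply: mulr_gt0; [exact: mulr_gt0|exact: divr_gt0].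
apply: le_ereal_inf_tmp => _ [k /= Nk <-].
have := bound k d d0; have := HN k Nk; rewrite /= => H1 H2.
have : ((P / 4)%:E <= (2 * d)^-1%:E * \int[leb]_(s in `[(- S)%R, S]) (r k s ^+ 2)%:E)%E.
  have : ((P / 2)%:E <= (d * S)%:E +
      (2 * d)^-1%:E * \int[leb]_(s in `[(- S)%R, S]) (r k s ^+ 2)%:E)%E.
    by apply: le_trans H2; rewrite lee_fin ltW.
  have -> : d * S = P / 4 by rewrite /d; field; rewrite lt0r_neq0.
  by rewrite -leeBlDl// -EFinB (_ : P / 2 - P / 4 = P / 4)//; field.
have d20 : (0 <= (2 * d)%:E)%E by rewrite lee_fin mulr_ge0// ltW.
move=> /(lee_wpmul2l d20).
by rewrite muleA -!EFinM divff ?mul1e// mulf_neq0// lt0r_neq0.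
Qed.

(** [E] is an integrating factor for [phi' = - b phi], so the product has derivative 0. In [P],
    [phi] is replaced by [phi 0 + K 0 - K], whose derivative is known. *)
Lemma line_gaussian (E : R -> R) : (forall s, is_derive s (1 : R) E (b s * E s)) ->
  forall s, - S < s < S -> phi s * E s = phi 0 * E 0.
Proof.
move=> dE s sS; have [K [dK cK]] := line_const.
have S00 : - S < 0 < S by rewrite oppr_lt0 S0.
have cK0 x : - S < x < S -> phi x = phi 0 + K 0 - K x.
  move=> /andP[? ?]; have [x0|x0|->] := ltgtP x 0; last by rewrite addrK.
    by rewrite (cK x 0)// addrK.
  by rewrite -(cK 0 x)// ?oppr_lt0// addrK.
pose P x := (phi 0 + K 0 - K x) * E x.
have dP x : - S < x < S -> is_derive x (1 : R) P 0.
  move=> xS; have dKx := dK _ xS; have dEx := dE x.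
  have := is_deriveM (is_deriveB (is_derive_cst (phi 0 + K 0) x 1) dKx) dEx.
  move=> H; apply: (is_derive_eq H).
  by rewrite /GRing.scale /= (cK0 x xS) !fctE; ring.
have Peq x y : - S < x -> x < y -> y < S -> P x = P y.
  move=> Sx xy yS.
  have [t||c _] := @MVT R P (fun=> 0) x y xy.
  - by rewrite in_itv/= => /andP[? ?]; apply: dP; apply/andP; split; lra.
  - apply: derivable_within_continuous => t; rewrite in_itv/= => /andP[? ?].
    by have [] := dP t _; first by apply/andP; split; lra.
  - by rewrite mul0r => /eqP; rewrite subr_eq0 => /eqP.
rewrite (cK0 s sS) -/(P s) [in RHS](cK0 0 S00) -/(P 0).
move: sS => /andP[? ?]; have [s0|s0|->//] := ltgtP s 0.
  exact: Peq.
by apply/esym/Peq => //; rewrite oppr_lt0.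
Qed.

End line.

Section gaussian_rigidity.
Context {R : realType} (n : nat).
Local Notation mu := (@lebesgue_rV R n).
Local Notation leb := (@lebesgue_measure R).
Implicit Types (x p : 'rV[R]_n) (i : 'I_n) (s t z : R).

Variable f : 'rV[R]_n -> R.
Hypotheses (cf : sepcont f) (lf : L2 mu f).
Hypothesis lx : forall i, L2 mu (fun x => x ord0 i * f x).
Local Notation e i := (delta_mx ord0 i : 'rV[R]_n).

(** The reciprocal of the Gaussian; on each coordinate line it is, up to a constant, the integrating
    factor for the coefficient [(x_i - p_i + s) / z] of the residual. *)
Definition gweight z p x := expR ((2 * z)^-1 * \sum_j (x ord0 j - p ord0 j) ^+ 2).

Lemma gweight_line z p x i s : gweight z p (x + s *: e i) =
  expR ((2 * z)^-1 * \sum_(j | j != i) (x ord0 j - p ord0 j) ^+ 2) *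
  expR ((2 * z)^-1 * (x ord0 i - p ord0 i + s) ^+ 2).
Proof.
rewrite -expRD -mulrDr /gweight; congr (expR (_ * _)).
rewrite (bigD1 i)//= addrC; congr (_ + _).
  apply: eq_bigr => j /negbTE ji; rewrite !mxE ji andbF mulr0 addr0//.
by rewrite !mxE !eqxx mulr1; congr (_ ^+ 2); ring.
Qed.

Lemma resid_line z p x i k s : resid f z p (step k) i (x + s *: e i) =
  (2 * step k)^-1 * (f (x + (s + step k) *: e i) - f (x + (s - step k) *: e i)) +
  z^-1 * (x ord0 i - p ord0 i + s) * f (x + s *: e i).
Proof.
rewrite /resid /cdiff /xmul !mxE !eqxx mulr1 -mulrA; congr (_ * (f _ - f _) + _ * (_ * _)).
- by rewrite -addrA -scalerDl.
- by rewrite -addrA -scaleNr -scalerDl.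
- ring.
Qed.

(** By Tonelli's theorem and translation invariance, the squared residual integrated over the
    segments [x + [-S, S] e_i], and then over [x], is [2 S] times its squared norm and tends to 0.
    So the argument on lines applies to almost every [x]; [S] exceeds [|s|] because that argument
    lives on an open interval. *)
Lemma gweight_ae_invariant z p i s : z != 0 ->
  ip mu (resid f z p (step k) i) (resid f z p (step k) i) @[k --> \oo] --> (0 : R) ->
  \forall x \ae mu, f (x + s *: e i) * gweight z p (x + s *: e i) = f x * gweight z p x.
Proof.
move=> z0 N0; pose S := `|s| + 1.
have S0 : 0 < S by rewrite ltr_wpDl.
pose r k := resid f z p (step k) i.
have lr k : L2 mu (r k) by exact: L2_resid.
pose G k (q : 'rV[R]_n * measurableTypeR R) :=
  ((r k (q.1 + q.2 *: e i)) ^+ 2 * \1_(`[- S, S]) q.2)%:E.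
have mline : measurable_fun setT (fun q : 'rV[R]_n * measurableTypeR R => q.1 + q.2 *: e i).
  apply: measurable_fun_rVP => j; under eq_fun do rewrite !mxE.
  apply: measurable_funD; first exact: measurableT_comp (measurable_coord j) measurable_fst.
  by apply: measurable_funM => //; exact: measurable_snd.
have mG k : measurable_fun setT (G k).
  apply/measurable_EFinP; apply: measurable_funM.
    by apply: measurable_funX; exact: measurableT_comp (lr k).1 mline.
  by apply: measurableT_comp; [exact: measurable_indic|exact: measurable_snd].
have G0 k q : (0 <= G k q)%E by rewrite lee_fin mulr_ge0 ?sqr_ge0.
have GE k x : (\int[leb]_t G k (x, t) =
    \int[leb]_(t in `[(- S)%R, S]) (r k (x + t *: e i) ^+ 2)%:E)%E.
  rewrite [RHS]integral_mkcond; apply: eq_integral => t _.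
  rewrite /G/= patchE indicE; case: ifP => _; first by rewrite mulr1.
  by rewrite mulr0.
have intG k : (\int[mu]_x \int[leb]_t G k (x, t) <= (2 * S * ip mu (r k) (r k))%:E)%E.
  rewrite (fubini_tonelli (G k))//.
  have -> : (\int[leb]_t \int[mu]_x G k (x, t) =
     \int[leb]_t ((ip mu (r k) (r k))%:E * (\1_(`[(- S)%R, S]) t)%:E))%E.
    apply: eq_integral => t _; rewrite -(ip_sqr (lr k)).
    have mr2 := measurable_sqrr (lr k).1.
    rewrite -(ge0_integral_shift (t *: e i) mr2); last by move=> x; rewrite lee_fin sqr_ge0.
    rewrite -ge0_integralZr//.
    - exact: measurableT_comp mr2 (measurable_shift_rV _).
    - by move=> x _; rewrite lee_fin sqr_ge0.
  rewrite ge0_integralZl//; last 2 first.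
  - by apply/measurable_EFinP; exact: measurable_indic.
  - by rewrite lee_fin ip_ge0.
  rewrite integral_indic// setIT /= lebesgue_measure_itv/= lte_fin.
  rewrite ifT; last by rewrite -subr_gt0 opprK addr_gt0.
  rewrite -EFinD -EFinM lee_fin opprK; lra.
have c0 : 2 * S * ip mu (r k) (r k) @[k --> \oo] --> (0 : R).
  by rewrite -[0](mulr0 (2 * S)); apply: cvgM; [exact: cvg_cst|exact: N0].
have mI k : measurable_fun setT (fun x => \int[leb]_t G k (x, t))%E.
  exact: (measurable_fun_fubini_tonelli_F _ (mG k)).
have I0 k x : (0 <= \int[leb]_t G k (x, t))%E by exact: integral_ge0.
apply: filterS (ae_einfs0 mI I0 intG c0) => x Hx.
pose b t := z^-1 * (x ord0 i - p ord0 i + t).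
pose E t := expR ((2 * z)^-1 * (x ord0 i - p ord0 i + t) ^+ 2).
have cb : continuous b.
  move=> t; apply: cvgM; first exact: cvg_cst.
  by apply: cvgD; [exact: cvg_cst|exact: cvg_id].
have dE t : is_derive t (1 : R) E (b t * E t).
  rewrite /E /b; apply: is_derive_eq; rewrite /GRing.scale /=.
  by field.
have Sd : - S < s < S by have := ler_norm s; have := ler_norm (- s); rewrite normrN /S; lra.
have H : f (x + s *: e i) * E s = f (x + 0 *: e i) * E 0.
  have cx : continuous (fun t : R => f (x + t *: e i)) by exact: cf.
  have L := @line_gaussian R (fun t => f (x + t *: e i)) b S cx cb S0.
  have {}L := L _ E dE s Sd; apply: L => N.
  rewrite -[RHS](Hx N); congr (einfs _ N); apply/funext => k.
  rewrite GE; apply: eq_integral => t _; rewrite /r resid_line.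
  by congr ((_ + _ * f _) ^+ 2)%:E; rewrite /b.
transitivity (f (x + 0 *: e i) * gweight z p (x + 0 *: e i)); last by rewrite scale0r addr0.
by rewrite !gweight_line mulrCA -/(E s) H -/(E 0) mulrCA.
Qed.

Lemma sepcont_gweight z p : sepcont (gweight z p).
Proof.
move=> x i; under eq_fun do rewrite gweight_line.
move=> t; apply: cvgM; first exact: cvg_cst.
apply: (@continuous_comp _ _ _ (fun t => (2 * z)^-1 * (x ord0 i - p ord0 i + t) ^+ 2) (@expR R)).
  apply: cvgM; first exact: cvg_cst.
  apply: (@continuous_comp _ _ _ (fun t => x ord0 i - p ord0 i + t) (fun y => y ^+ 2)).
    by apply: cvgD; [exact: cvg_cst|exact: cvg_id].
  exact: exprn_continuous.
exact: continuous_expR.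
Qed.

Lemma sepcontM (g k : 'rV[R]_n -> R) : sepcont g -> sepcont k -> sepcont (fun y => g y * k y).
Proof. by move=> cg ck y i s; apply: cvgM; [exact: cg|exact: ck]. Qed.

Lemma gaussian_rigidity z p : z != 0 ->
  (forall i, ip mu (resid f z p (step k) i) (resid f z p (step k) i) @[k --> \oo] --> (0 : R)) ->
  forall x, f x = f p * expR (- ((2 * z)^-1 * \sum_j (x ord0 j - p ord0 j) ^+ 2)).
Proof.
move=> z0 N0.
pose h x := f x * gweight z p x.
have ch : sepcont h by apply: sepcontM => //; exact: sepcont_gweight.
(* The exceptional null set depends on [i] and [s]; both are fixed while it is removed. *)
have inv x i s : h (x + s *: e i) = h x.
  apply/eqP; rewrite -subr_eq0; apply/eqP.
  apply: (@ae_eq0_sepcont _ _ (fun x => h (x + s *: e i) - h x)).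
    have csh : sepcont (fun y => h (y + s *: e i)) by apply: sepcont_shift; exact: ch.
    exact: (@sepcontB _ _ (fun y => h (y + s *: e i)) h csh ch).
  have Hae := @gweight_ae_invariant z p i s z0 (N0 i).
  by apply: filterS Hae => y; rewrite /h => ->; rewrite subrr.
have hp x : h x = h p.
  have -> : x = p + (x - p) by rewrite addrC subrK.
  rewrite [X in p + X](row_sum_delta (x - p)).
  elim: (index_enum _) => [|i l IH]; first by rewrite big_nil addr0.
  by rewrite big_cons addrCA addrC inv.
move=> x; have := hp x; rewrite /h /gweight.
rewrite [X in _ = _ * X -> _](_ : _ = 1) ?mulr1; last first.
  by rewrite big1 ?mulr0 ?expR0// => j _; rewrite subrr expr0n.
by move=> <-; rewrite -mulrA -expRD subrr expR0 mulr1.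
Qed.

End gaussian_rigidity.

(** * Moments of Gaussians *)

Section gaussian_moments.
Context {R : realType} (n : nat).
Local Notation mu := (@lebesgue_rV R n).
Implicit Types (x : 'rV[R]_n) (i : 'I_n) (s t : R).

Variables (f : 'rV[R]_n -> R) (c z : R) (p : 'rV[R]_n).
Hypotheses (cf : sepcont f) (lf : L2 mu f).
Hypothesis lx : forall i, L2 mu (fun x => x ord0 i * f x).
Hypothesis z0 : 0 < z.
Hypothesis fE : forall x, f x = c * expR (- ((2 * z)^-1 * \sum_j (x ord0 j - p ord0 j) ^+ 2)).
Local Notation A := (corr f).
Local Notation e i := (delta_mx ord0 i : 'rV[R]_n).

Let zn0 : z != 0. Proof. exact: lt0r_neq0. Qed.

Lemma gaussian_line x i s : f (x + s *: e i) =
  f x * expR (- ((2 * z)^-1 * (s ^+ 2 + 2 * s * (x ord0 i - p ord0 i)))).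
Proof.
rewrite !fE -mulrA -expRD; congr (c * expR _); rewrite -opprD -mulrDr; congr (- (_ * _)).
rewrite (bigD1 i)//= [in RHS](bigD1 i)//= !mxE !eqxx mulr1.
rewrite [X in _ + X = _](eq_bigr (fun j => (x ord0 j - p ord0 j) ^+ 2)); last first.
  by move=> j /negbTE ji; rewrite !mxE ji andbF mulr0 addr0.
ring.
Qed.

(** Completing the square: [f (x + t e_i) f x] is a constant times [f (x + (t/2) e_i) ^ 2], so
    translation invariance applies and no Gaussian integral is evaluated. *)
Lemma gaussian_corr i t : A (t *: e i) = A 0 * expR (- (t ^+ 2 / (4 * z))).
Proof.
have lf2 := L2_shift ((t / 2) *: e i) lf.
rewrite corr0 -(ip_shift ((t / 2) *: e i) lf lf) /corr [RHS]mulrC /ip.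
rewrite -RintegralZl//; last exact: L2M.
apply: eq_Rintegral => x _; rewrite !gaussian_line.
set a := x ord0 i - p ord0 i.
rewrite [LHS]mulrAC -[LHS]mulrA [RHS]mulrC mulrACA -!mulrA; congr (_ * (_ * _)).
rewrite -!expRD; congr expR; field.
by rewrite zn0.
Qed.

(** The bound [1 - expR (- s) <= s] at [s = t ^ 2 / (8 z)] gives the quadratic increments of [A ^ 2]
    required by [wmom_le]. *)
Lemma gaussian_wmom i : (wmom f i <= (A 0 ^+ 2 / (4 * z))%:E)%E.
Proof.
have A00 : 0 <= A 0 by rewrite corr0 ip_ge0.
apply: (wmom_le cf lf (@step_cvg0 R) (@step_neq0 R)) => k.
set t := step k; rewrite scalerA gaussian_corr exprMn -expRM_natl.
have := expR_ge1Dx (- (t ^+ 2 / (8 * z))).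
rewrite (_ : 2%:R * - ((2^-1 * t) ^+ 2 / (4 * z)) = - (t ^+ 2 / (8 * z))); last first.
  by field; rewrite zn0.
move: (expR _) => E H.
rewrite -[X in _ - X * _]mulr1 (_ : t ^+ 2 * _ = 2 * A 0 ^+ 2 * (t ^+ 2 / (8 * z))); last first.
  by field; rewrite zn0.
rewrite (_ : 2 * _ = 2 * A 0 ^+ 2 * (1 - E)); last by ring.
by rewrite ler_wpM2l ?mulr_ge0 ?sqr_ge0//; lra.
Qed.

(** A Gaussian decreases in modulus away from its centre, so the products [F k] are nonnegative.
    Their integrals are known from [ip_cdiff_xmul], and they converge pointwise to
    [z^-1 * xmul f p i x ^ 2]; Fatou's lemma concludes. *)
Lemma gaussian_xmoment i : ip mu (xmul f p i) (xmul f p i) <= z * A 0 / 2.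
Proof.
have lq := L2_xmul lf lx p i.
pose F k x := - ((2 * step k)^-1 * cdiff f (step k) i x * xmul f p i x).
have iF k : mu.-integrable setT (EFin \o (fun x => cdiff f (step k) i x * xmul f p i x)).
  exact: L2M (L2_cdiff lf (step k) i) lq.
have FE k : F k = (fun x => - (2 * step k)^-1 * (cdiff f (step k) i x * xmul f p i x)).
  by apply/funext => x; rewrite /F; ring.
have mF k : measurable_fun setT (F k).
  rewrite FE; apply: measurable_funM => //; exact: measurable_intL (iF k).
have intF k : (\int[mu]_x (F k x)%:E = (A (step k *: e i) / 2)%:E)%E.
  have iFk := integrableZl measurableT (- (2 * step k)^-1) (iF k).
  rewrite FE -EFin_Rintegral// RintegralZl// -/(ip _ _ _) ip_cdiff_xmul//; congr EFin.
  by field; rewrite step_neq0.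
have cdE t x : cdiff f t i x = f x * expR (- ((2 * z)^-1 * t ^+ 2)) *
    (expR (- (z^-1 * t * (x ord0 i - p ord0 i))) - expR (z^-1 * t * (x ord0 i - p ord0 i))).
  rewrite /cdiff -scaleNr !gaussian_line -mulrBr -[RHS]mulrA; congr (_ * _).
  by rewrite [RHS]mulrBr -!expRD; congr (expR _ - expR _); field; rewrite zn0.
have F0 k x : 0 <= F k x.
  have t0 : 0 < step k :> R := step_gt0 k.
  set a := x ord0 i - p ord0 i; set u := z^-1 * step k * a.
  have H : 0 <= a * (expR u - expR (- u)).
    have w0 : 0 < z^-1 * step k by rewrite mulr_gt0 ?invr_gt0.
    have [a0|a0] := leP 0 a.
      have u0 : 0 <= u by rewrite /u mulr_ge0// ltW.
      by rewrite mulr_ge0// subr_ge0 ler_expR; lra.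
    have u0 : u <= 0 by rewrite /u mulr_ge0_le0 ?ltW.
    by apply: mulr_le0; [exact: ltW|rewrite subr_le0 ler_expR; lra].
  rewrite /F cdE /xmul -/a -/u.
  rewrite [X in 0 <= X](_ : _ = f x ^+ 2 * expR (- ((2 * z)^-1 * step k ^+ 2)) * (2 * step k)^-1 *
    (a * (expR u - expR (- u)))); last by ring.
  apply: mulr_ge0 => //; apply: mulr_ge0; first by rewrite mulr_ge0 ?sqr_ge0 ?expR_ge0.
  by rewrite invr_ge0 mulr_ge0// ltW.
have Fcvg x : F ^~ x @ \oo --> z^-1 * xmul f p i x ^+ 2.
  set a := x ord0 i - p ord0 i.
  pose G (s : R) := f x * expR (- ((2 * z)^-1 * (s ^+ 2 + 2 * s * a))).
  have D : is_derive (0 : R) (1 : R) G (- z^-1 * (a * f x)).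
    apply: is_derive_eq; rewrite /GRing.scale /=.
    rewrite (_ : expR _ = 1); last by rewrite expr0n mulr0 mul0r addr0 mulr0 oppr0 expR0.
    by field; rewrite zn0.
  have H : - ((2 * step k)^-1 * (G (0 + step k) - G (0 - step k)) * xmul f p i x) @[k --> \oo] -->
      (- (- z^-1 * (a * f x) * xmul f p i x) : R).
    by apply: cvgN; apply: cvgM; [exact: is_derive_central|exact: cvg_cst].
  rewrite (_ : z^-1 * _ = - (- z^-1 * (a * f x) * xmul f p i x)); last first.
    by rewrite /xmul -/a; ring.
  apply: cvg_trans H; apply: near_eq_cvg; apply: nearW => k.
  have GE r : G r = f (x + r *: e i) by rewrite gaussian_line.
  by rewrite /F /cdiff !GE add0r sub0r scaleNr.
have Acvg : A (step k *: e i) / 2 @[k --> \oo] --> (A 0 / 2 : R).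
  by apply: cvgM; [exact: corr_cvg1 (@step_cvg0 R)|exact: cvg_cst].
have le k : (\int[mu]_x (F k x)%:E <= (A (step k *: e i) / 2)%:E)%E by rewrite intF.
have := fatou_cvg mF F0 Fcvg le Acvg.
have iq2 := L2M lq lq.
under eq_integral do rewrite expr2.
rewrite -EFin_Rintegral; last exact: (integrableZl measurableT z^-1 iq2).
rewrite lee_fin (RintegralZl z^-1 measurableT iq2) -/(ip _ _ _) ler_pdivrMl//; lra.
Qed.

End gaussian_moments.

(** * Spreads and the uncertainty principle *)

Section spreads.
Context {R : realType} (n : nat) d (T : measurableType d).
Variable m : {measure set T -> \bar R}.
Implicit Types (pos : T -> 'rV[R]_n) (rho : T -> R) (c : 'rV[R]_n).

Lemma norm2_sqr (v : 'rV[R]_n) : norm2 v ^+ 2 = \sum_i v ord0 i ^+ 2.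
Proof.
rewrite /norm2 dotE sqr_sqrtr; last by apply: sumr_ge0 => i _; exact: sqr_ge0.
by apply: eq_bigr => i _; rewrite expr2.
Qed.

Definition moment2 pos rho c (i : 'I_n) : \bar R :=
  (\int[m]_t ((pos t ord0 i - c ord0 i) ^+ 2 * rho t)%:E)%E.

Lemma integral_norm2 pos rho c :
  (forall i, measurable_fun setT (fun t => pos t ord0 i)) ->
  measurable_fun setT rho -> (forall t, 0 <= rho t) ->
  (\int[m]_t (norm2 (pos t - c) ^+ 2 * rho t)%:E = \sum_i moment2 pos rho c i)%E.
Proof.
move=> mp mr r0; rewrite -ge0_integral_sum//.
- apply: eq_integral => t _; rewrite norm2_sqr mulr_suml -sumEFin.
  by apply: eq_bigr => i _; rewrite !mxE.
- move=> i; apply/measurable_EFinP; apply: measurable_funM => //.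
  by apply: measurable_funX; apply: measurable_funB.
- by move=> i t _; rewrite lee_fin mulr_ge0// sqr_ge0.
Qed.

(** The parallel axis identity: passing from [c] to the mean subtracts [dlt ^ 2 * I]. If the moment
    about [c] is finite, the first moment is integrable, and [centroid] is the true mean and not a
    default value; otherwise the bound is trivial. *)
Lemma moment2_centroid_le pos rho c i (I : R) :
  (forall i, measurable_fun setT (fun t => pos t ord0 i)) ->
  measurable_fun setT rho -> (forall t, 0 <= rho t) ->
  (\int[m]_t (rho t)%:E = I%:E)%E -> 0 < I ->
  (moment2 pos rho (centroid m pos rho) i <= moment2 pos rho c i)%E.
Proof.
move=> mp mr r0 rI I0.
have [->|fin] := eqVneq (moment2 pos rho c i) +oo%E; first exact: leey.
pose u t := pos t ord0 i - c ord0 i.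
have mu : measurable_fun setT u by exact: measurable_funB.
have i2 : m.-integrable setT (EFin \o (fun t => u t ^+ 2 * rho t)).
  apply/integrableP; split.
    by apply/measurable_EFinP; apply: measurable_funM => //; exact: measurable_funX.
  rewrite (_ : (\int[m]_t _ = moment2 pos rho c i)%E); first by rewrite ltey.
  by apply: eq_integral => t _ /=; rewrite ger0_norm// mulr_ge0// sqr_ge0.
have ir : m.-integrable setT (EFin \o rho).
  apply/integrableP; split; first exact/measurable_EFinP.
  rewrite (_ : (\int[m]_t _ = I%:E)%E) ?ltry// -rI.
  by apply: eq_integral => t _ /=; rewrite ger0_norm.
have i1 : m.-integrable setT (EFin \o (fun t => u t * rho t)).
  apply: (@le_Rintegrable _ _ _ m _ (fun t => u t ^+ 2 * rho t + rho t)).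
  - exact: measurable_funM.
  - move=> t; rewrite normrM (ger0_norm (r0 t)) -[X in _ + X]mul1r -mulrDl ler_wpM2r//.
    by rewrite -(real_normK (num_real (u t))); have := sqr_ge0 (`|u t| - 1);
      have := normr_ge0 (u t); nra.
  - exact: (integrableD measurableT i2 ir).
have IE : \int[m]_t rho t = I by rewrite /Rintegral rI.
have ip : m.-integrable setT (EFin \o (fun t => pos t ord0 i * rho t)).
  have := integrableD measurableT i1 (integrableZl measurableT (c ord0 i) ir).
  apply: eq_integrable => // t _ /=; rewrite -EFinM -EFinD /u; congr EFin; ring.
set p := centroid m pos rho.
have u1 : \int[m]_t (u t * rho t) = (p ord0 i - c ord0 i) * I.
  transitivity (\int[m]_t (pos t ord0 i * rho t - c ord0 i * rho t)).
    by apply: eq_Rintegral => t _; rewrite /u mulrBl.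
  rewrite RintegralB//; last exact: (integrableZl measurableT (c ord0 i) ir).
  rewrite RintegralZl// IE mulrBl; congr (_ - _).
  by rewrite /p mxE IE divfK// lt0r_neq0.
pose dlt := p ord0 i - c ord0 i.
have iA := integrableZl measurableT (- (2 * dlt)) i1.
have iB := integrableZl measurableT (dlt ^+ 2) ir.
have i12 := integrableD measurableT i2 iA.
have -> : moment2 pos rho p i =
    (\int[m]_t ((u t ^+ 2 * rho t + - (2 * dlt) * (u t * rho t)) + dlt ^+ 2 * rho t)%:E)%E.
  by apply: eq_integral => t _; congr EFin; rewrite /u /dlt; ring.
rewrite -EFin_Rintegral; last exact: (integrableD measurableT i12 iB).
rewrite (RintegralD measurableT i12 iB) (RintegralD measurableT i2 iA).
rewrite (RintegralZl (- (2 * dlt)) measurableT i1) (RintegralZl (dlt ^+ 2) measurableT ir).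
rewrite IE u1 /moment2 -EFin_Rintegral// lee_fin -/dlt.
rewrite -addrA gerDl (_ : _ + _ = - (dlt ^+ 2 * I)); last by ring.
by rewrite oppr_le0 mulr_ge0 ?sqr_ge0// ltW.
Qed.

Lemma spreadE pos rho (I : R) :
  (forall i, measurable_fun setT (fun t => pos t ord0 i)) ->
  measurable_fun setT rho -> (forall t, 0 <= rho t) ->
  (\int[m]_t (rho t)%:E = I%:E)%E -> 0 < I ->
  (spread m pos rho = (\sum_i moment2 pos rho (centroid m pos rho) i) * (I^-1)%:E)%E.
Proof.
move=> mp mr r0 rI I0; rewrite /spread rI integral_norm2//.
by rewrite inver gt_eqF.
Qed.

End spreads.

Local Open Scope complex_scope.

Section time_frequency_distribution.
Context {R : realType} (n : nat).
Local Notation mu := (@lebesgue_rV R n).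
Implicit Types (x w : 'rV[R]_n).

Lemma normc_C_UMITRSK (f : 'rV[R]_n -> R) (phi1 : 'rV[R]_n -> R[i]) (r : R) x w :
  L2 mu f -> r ^+ 2 = 1 -> (forall y, phi1 y = r%:C) ->
  normc (C_UMITRSK phi1 (fun x => (f x)%:C) x w) ^+ 2 = spec f x w.
Proof.
move=> lf r1 phiE.
have ic := integrable_cross lf x.
have igc : mu.-integrable setT (EFin \o (fun y => cross f x y * cos (2 * pi * dot y w))).
  by apply: integrableMbounded ic _ _ => [|y]; [exact: measurable_cos_dot|exact: normr_cos].
have igs : mu.-integrable setT (EFin \o (fun y => cross f x y * sin (2 * pi * dot y w))).
  by apply: integrableMbounded ic _ _ => [|y]; [exact: measurable_sin_dot|exact: normr_sin].
rewrite /C_UMITRSK /cintegral.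
set a := Rintegral _ _ _; set b := Rintegral _ _ _.
have aE : a = r * Fcos (cross f x) w.
  rewrite /Fcos -RintegralZl//; apply: eq_Rintegral => y _.
  rewrite phiE /cis cosN sinN /cross /=; ring.
have bE : b = - r * Fsin (cross f x) w.
  rewrite /Fsin -RintegralZl//; apply: eq_Rintegral => y _.
  rewrite phiE /cis cosN sinN /cross /=; ring.
rewrite /normc /= sqr_sqrtr; last by rewrite addr_ge0 ?sqr_ge0.
by rewrite aE bE !exprMn sqrrN r1 !mul1r.
Qed.

Lemma UMITRSK_constant (phi : 'rV[R]_n -> 'rV[R]_n -> R[i]) (phi1 : 'rV[R]_n -> R[i]) :
  UMITRSK phi phi1 -> (forall v y, phi v y = 1 \/ phi v y = -1) ->
  exists2 r : R, r ^+ 2 = 1 & forall y, phi1 y = r%:C.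
Proof.
move=> [_ H] pm.
have E y : phi1 y = phi 0 0 by rewrite -(H 0 y y) subrr scaler0.
have [h|h] := pm 0 0.
  by exists 1 => [|y]; rewrite ?expr1n// E h.
by exists (-1) => [|y]; rewrite ?sqrrN ?expr1n// E h rmorphN.
Qed.

(** [cross f x] is real, so [Fcos] is even and [Fsin] is odd in the frequency. *)
Lemma spec_opp (f : 'rV[R]_n -> R) x w : L2 mu f -> spec f x (- w) = spec f x w.
Proof.
move=> lf; have ic := integrable_cross lf x.
have dotN y : dot y (- w) = - dot y w.
  by rewrite dotC -scaleN1r dotZl dotC mulN1r.
have igs : mu.-integrable setT (EFin \o (fun y => cross f x y * sin (2 * pi * dot y w))).
  by apply: integrableMbounded ic _ _ => [|y]; [exact: measurable_sin_dot|exact: normr_sin].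
rewrite /spec; congr (_ ^+ 2 + _).
  by apply: eq_Rintegral => y _; rewrite dotN mulrN cosN.
rewrite -[RHS]sqrrN; congr (_ ^+ 2).
rewrite -[RHS]mulN1r /Fsin -RintegralZl//; apply: eq_Rintegral => y _.
by rewrite dotN mulrN sinN mulN1r mulrN.
Qed.

Lemma moment2_w_ge (f : 'rV[R]_n -> R) (c : 'rV[R]_n) i : L2 mu f ->
  (moment2 (mu \x mu)%E snd (fun z : 'rV[R]_n * 'rV[R]_n => spec f z.1 z.2) 0 i <=
   moment2 (mu \x mu)%E snd (fun z : 'rV[R]_n * 'rV[R]_n => spec f z.1 z.2) c i)%E.
Proof.
move=> lf.
have ms := measurable_spec lf.
have mi (a : R) : measurable_fun setT
    (fun z : 'rV[R]_n * 'rV[R]_n => (z.2 ord0 i - a) ^+ 2 * spec f z.1 z.2).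
  apply: measurable_funM => //; apply: measurable_funX; apply: measurable_funB => //.
  exact: measurableT_comp (measurable_coord i) measurable_snd.
have m0 (a : R) (z : 'rV[R]_n * 'rV[R]_n) : (0 <= ((z.2 ord0 i - a) ^+ 2 * spec f z.1 z.2)%:E)%E.
  by rewrite lee_fin mulr_ge0 ?sqr_ge0 ?spec_ge0.
pose g (a : R) (z : 'rV[R]_n * 'rV[R]_n) := ((z.2 ord0 i - a) ^+ 2 * spec f z.1 z.2)%:E.
have g0 a z : (0 <= g a z)%E by exact: m0.
have mg a : measurable_fun setT (g a) by apply/measurable_EFinP; exact: mi.
(* The spectrum is even in [w], so a moment about [c] averages with that about [-c]. *)
have sym a : (\int[mu \x mu]_z g a z = \int[mu \x mu]_z g (- a)%R z)%E.
  apply: etrans; first exact: (fubini_tonelli1 _ (mg a) (g0 a)).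
  apply: esym; apply: etrans; first exact: (fubini_tonelli1 _ (mg (- a)) (g0 (- a))).
  apply: esym.
  apply: eq_integral => x _; rewrite /fubini_F.
  rewrite -[LHS](ge0_integral_opp (F := fun w => g a (x, w))); last 2 first.
  - exact: measurableT_comp (mg a) (@pair1_measurable _ _ _ _ x).
  - by move=> w; exact: m0.
  apply: eq_integral => w _; rewrite /g /= spec_opp// mxE; congr EFin; ring.
rewrite /moment2 mxE -/(g 0) -/(g (c ord0 i)).
have two : (0 < 2%:E :> \bar R)%E by [].
rewrite -(@lee_pmul2l _ 2%:E)//.
have -> : (2%:E * \int[mu \x mu]_z g (c ord0 i) z =
    \int[mu \x mu]_z (g (c ord0 i) z + g (- c ord0 i)%R z))%E.
  by rewrite ge0_integralD// -sym -mule2n mule_natl.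
rewrite -ge0_integralZl//; last exact: (mg 0).
apply: ge0_le_integral => //.
- by move=> z _; rewrite mule_ge0.
- exact: (emeasurable_funM (measurable_cst _) (mg 0)).
- exact: (emeasurable_funD (mg _) (mg _)).
- move=> z _; rewrite /g -EFinM -EFinD lee_fin.
  rewrite -mulrDl mulrA ler_wpM2r ?spec_ge0//.
  by have := sqr_ge0 (c ord0 i); lra.
Qed.

End time_frequency_distribution.

(** * The inequality and the case of equality *)

Section uncertainty.
Context {R : realType} (n : nat).
Local Notation mu := (@lebesgue_rV R n).
Local Notation mu2 := (mu \x mu)%E.
Local Notation V2 := ('rV[R]_n * 'rV[R]_n)%type.
Implicit Types (x w p : 'rV[R]_n) (i : 'I_n).

Lemma derivable_sepcont (f : 'rV[R]_n -> R) :
  (forall x i, derivable f x (delta_mx ord0 i)) -> sepcont f.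
Proof.
move=> df x i s.
apply: differentiable_continuous; apply/derivable1_diffP.
have := df (x + s *: delta_mx ord0 i) i; rewrite /derivable.
set F := (X in cvg (X @ _)) => H; set G := (X in cvg (X @ _)).
suff -> : G = F by [].
apply/funext => h; rewrite /F /G; congr (_ *: (f _ - _)).
transitivity (x + (h + s) *: delta_mx ord0 i); last by rewrite scalerDl addrCA.
by congr (_ + _ *: _); rewrite /GRing.scale /= mulr1.
Qed.

Lemma Lfun2_L2 d (T : measurableType d) (m : {measure set T -> \bar R}) (f : T -> R) :
  f \in Lfun m 2%:E -> L2 m f.
Proof.
move=> fL; split; last exact: Lfun2_integrable_sqr.
by move: fL; rewrite inE => /andP[+ _]; rewrite inE.
Qed.

Lemma L2_coordM (f : 'rV[R]_n -> R) i : L2 mu f -> L2 mu (fun x => norm2 x * f x) ->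
  L2 mu (fun x => x ord0 i * f x).
Proof.
move=> [mf _] [_ fi].
have m1 : measurable_fun setT (fun x : 'rV[R]_n => x ord0 i * f x).
  by apply: measurable_funM => //; exact: measurable_coord.
split => //; apply: (@le_Rintegrable _ _ _ mu _ (fun x => (norm2 x * f x) ^+ 2)) => //.
  exact: measurable_funX.
move=> x; rewrite ger0_norm ?sqr_ge0// !exprMn ler_wpM2r ?sqr_ge0// norm2_sqr.
by rewrite (bigD1 i)//= lerDl sumr_ge0// => j _; exact: sqr_ge0.
Qed.

Variable f : 'rV[R]_n -> R.
Hypotheses (n0 : (0 < n)%N) (cf : sepcont f) (lf : L2 mu f).
Hypothesis lx : forall i, L2 mu (fun x => x ord0 i * f x).
Hypothesis f_neq0 : exists x, f x != 0.
Local Notation A := (corr f).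
Local Notation X p i := (ip mu (xmul f p i) (xmul f p i)).
Local Notation M p i := (ip mu f (xmul f p i)).
Local Notation rho := (fun z : V2 => spec f z.1 z.2).
Local Notation Sx := (spread mu2 fst rho).
Local Notation Sw := (spread mu2 snd rho).
Local Notation cx := (centroid mu2 fst rho).
Local Notation p_f := (centroid mu id (fun y => `|f y| ^+ 2)).

(** One point with [f x != 0] is enough: a zero norm would make [f] vanish almost everywhere, hence
    everywhere by separate continuity. *)
Lemma corr0_gt0 : 0 < A 0.
Proof.
rewrite lt_neqAle corr0 ip_ge0 andbT eq_sym; apply/eqP => f0.
have [x] := f_neq0; apply/negP; rewrite negbK; apply/eqP; move: x.
apply: ae_eq0_sepcont => //.
have m2 := measurable_sqrr lf.1.
have : (\int[mu]_x `|(f x ^+ 2)%:E| = 0)%E.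
  rewrite -[RHS]/(0%:E) -f0 -(ip_sqr lf).
  by apply: eq_integral => x _; rewrite gee0_abs// lee_fin sqr_ge0.
move/(ae_eq_integral_abs mu measurableT m2).
apply: filterS => x /(_ I) /= /eqP.
by rewrite eqe sqrf_eq0 => /eqP.
Qed.

Let mfst i : measurable_fun setT (fun z : V2 => z.1 ord0 i).
Proof. exact: measurableT_comp (measurable_coord i) measurable_fst. Qed.

Let msnd i : measurable_fun setT (fun z : V2 => z.2 ord0 i).
Proof. exact: measurableT_comp (measurable_coord i) measurable_snd. Qed.

Let mrho : measurable_fun setT rho. Proof. exact: measurable_spec. Qed.

Let rho0 z : 0 <= rho z. Proof. exact: spec_ge0. Qed.

Let A20 : 0 < A 0 ^+ 2. Proof. by rewrite exprn_gt0// corr0_gt0. Qed.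

(** The centroid [cx] is not identified with that of [f] at this point; their distance enters
    through [M cx i]. These squares are dropped in the inequality and forced to vanish by
    equality. *)
Lemma spread_xE :
  Sx = ((\sum_i (2^-1 * A 0 * X cx i + 2^-1 * M cx i ^+ 2)) / A 0 ^+ 2)%:E.
Proof.
rewrite (spreadE mfst mrho rho0 (integral_spec_total cf lf) A20) EFinM -sumEFin.
by congr (_ * _)%E; apply: eq_bigr => i _; exact: integral_spec_xmoment.
Qed.

Lemma spread_x_le p :
  (Sx <= ((\sum_i (2^-1 * A 0 * X p i + 2^-1 * M p i ^+ 2)) / A 0 ^+ 2)%:E)%E.
Proof.
rewrite (spreadE mfst mrho rho0 (integral_spec_total cf lf) A20) EFinM -sumEFin.
rewrite lee_pmul2r// ?lte_fin ?invr_gt0//.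
apply: lee_sum => i _; rewrite -(integral_spec_xmoment cf lf lx).
exact: (moment2_centroid_le _ _ mfst mrho rho0 (integral_spec_total cf lf) A20).
Qed.

Lemma moment2_wmom i : (moment2 mu2 snd rho 0 i = ((2 * pi) ^- 2)%:E * wmom f i)%E.
Proof.
rewrite /wmom -ge0_integralZl//.
- apply: eq_integral => z _; rewrite mxE subr0 -EFinM; congr EFin.
  have := lt0r_neq0 (@pi2_gt0 R); move: (2 * pi) => c c0.
  by rewrite exprMn -(mulrA (c ^+ 2)) mulKf// expf_neq0.
- by apply/measurable_EFinP; exact: measurable_wmom.
- by move=> z _; rewrite lee_fin mulr_ge0 ?sqr_ge0.
- by rewrite lee_fin invr_ge0 sqr_ge0.
Qed.

Lemma spread_w_ge :
  (((2 * pi) ^- 2 / A 0 ^+ 2)%:E * (\sum_i wmom f i) <= Sw)%E.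
Proof.
rewrite (spreadE msnd mrho rho0 (integral_spec_total cf lf) A20).
rewrite mulrC EFinM -muleA [leRHS]muleC lee_pmul2l ?lte_fin ?invr_gt0//.
rewrite ge0_sume_distrr; last by move=> i _; exact: wmom_ge0.
by apply: lee_sum => i _; rewrite -moment2_wmom moment2_w_ge.
Qed.

Lemma spread_w_le :
  (Sw <= ((2 * pi) ^- 2 / A 0 ^+ 2)%:E * (\sum_i wmom f i))%E.
Proof.
rewrite (spreadE msnd mrho rho0 (integral_spec_total cf lf) A20).
rewrite mulrC EFinM -muleA [leLHS]muleC lee_pmul2l ?lte_fin ?invr_gt0//.
rewrite ge0_sume_distrr; last by move=> i _; exact: wmom_ge0.
apply: lee_sum => i _; rewrite -moment2_wmom.
exact: (moment2_centroid_le _ _ msnd mrho rho0 (integral_spec_total cf lf) A20).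
Qed.

(** By evenness no centre does better than 0, and the centroid does at least as well as 0. So the
    two moments agree, even when infinite, without computing the centroid. *)
Lemma spread_wE : Sw = (((2 * pi) ^- 2 / A 0 ^+ 2)%:E * (\sum_i wmom f i))%E.
Proof. by apply/eqP; rewrite eq_le spread_w_le spread_w_ge. Qed.

Local Notation bound := (4^-1 * (n%:R ^+ 2 / (16 * pi ^+ 2)) : R).

Lemma mean_xmul p i : M p i = \int[mu]_x (x ord0 i * `|f x| ^+ 2) - p ord0 i * A 0.
Proof.
have i1 : mu.-integrable setT (EFin \o (fun x => x ord0 i * f x * f x)) by exact: L2M.
rewrite corr0 /ip -(RintegralZl (p ord0 i) measurableT (L2M lf lf)).
rewrite (_ : \int[mu]_x (x ord0 i * `|f x| ^+ 2) = \int[mu]_x (x ord0 i * f x * f x)); last first.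
  by apply: eq_Rintegral => x _; rewrite real_normK ?num_real// expr2 mulrA.
rewrite -RintegralB//; last exact: (integrableZl measurableT (p ord0 i) (L2M lf lf)).
by apply: eq_Rintegral => x _; rewrite /xmul; ring.
Qed.

Let total : \int[mu]_x `|f x| ^+ 2 = A 0.
Proof.
rewrite corr0; apply: eq_Rintegral => x _.
by rewrite real_normK ?num_real// expr2.
Qed.

Lemma mean_xmul_eq0 p : (forall i, M p i = 0) <->
  p = p_f.
Proof.
have An0 : A 0 != 0 := lt0r_neq0 corr0_gt0.
split=> [M0|-> i]; last by rewrite mean_xmul mxE total divfK// subrr.
apply/rowP => i; rewrite mxE total; apply: (mulIf An0); rewrite divfK//.
by apply/esym/eqP; rewrite -subr_eq0 -mean_xmul M0.
Qed.

Lemma uncertainty_finite (v : 'I_n -> R) : (forall i, wmom f i = (v i)%:E) ->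
  Sw = ((2 * pi) ^- 2 / A 0 ^+ 2 * \sum_i v i)%:E.
Proof.
move=> Vv; rewrite spread_wE; under eq_bigr do rewrite Vv.
by rewrite sumEFin.
Qed.

Lemma wmom_dichotomy : (\sum_i wmom f i = +oo)%E \/
  exists v : 'I_n -> R, forall i, wmom f i = (v i)%:E.
Proof.
have [/existsP[i /eqP wi]|H] := boolP [exists i, wmom f i == +oo%E].
  left; apply/eqP; rewrite esum_eqy; last first.
    by move=> j _; rewrite gt_eqF// (lt_le_trans _ (wmom_ge0 f j)).
  by apply/existsP; exists i; rewrite wi eqxx.
right; exists (fun i => fine (wmom f i)) => i; rewrite fineK// ge0_fin_numE ?wmom_ge0//.
by rewrite ltey; apply: contra H => wi; apply/existsP; exists i.
Qed.

Let sX_gt0 p : 0 < \sum_i X p i.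
Proof.
rewrite (bigD1 (Ordinal n0))//=; apply: ltr_wpDr; last exact: (xmul_ip_gt0 cf lf lx p _ corr0_gt0).
by apply: sumr_ge0 => i _; exact: ip_ge0.
Qed.

Let sxE : (\sum_i (2^-1 * A 0 * X cx i + 2^-1 * M cx i ^+ 2)) / A 0 ^+ 2 =
  2^-1 * (\sum_i X cx i) / A 0 + 2^-1 * (\sum_i M cx i ^+ 2) / A 0 ^+ 2.
Proof.
have := lt0r_neq0 corr0_gt0.
rewrite big_split/= -!mulr_sumr; move: (\sum_i _) (\sum_i _) (A 0) => a b c c0.
by field.
Qed.

Let sM_ge0 : 0 <= \sum_i M cx i ^+ 2.
Proof. by apply: sumr_ge0 => i _; exact: sqr_ge0. Qed.

Let sx_gt0 : 0 < 2^-1 * (\sum_i X cx i) / A 0 + 2^-1 * (\sum_i M cx i ^+ 2) / A 0 ^+ 2.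
Proof.
have A00 := corr0_gt0; have X0 := sX_gt0 cx.
apply: ltr_wpDr; first by rewrite divr_ge0 ?mulr_ge0// ltW.
by rewrite divr_gt0 ?mulr_gt0.
Qed.

Lemma uncertainty_inequality : (bound%:E <= Sx * Sw)%E.
Proof.
have A00 := corr0_gt0; have X0 := sX_gt0 cx; have s0 := sx_gt0.
rewrite spread_xE sxE.
have [oo|[v Vv]] := wmom_dichotomy.
  rewrite spread_wE oo gt0_muley ?lte_fin ?divr_gt0 ?invr_gt0 ?exprn_gt0 ?pi2_gt0//.
  by rewrite gt0_muley ?lte_fin// leey.
have [H _] := heisenberg cf lf lx cx n0 A00 Vv.
rewrite (uncertainty_finite Vv) -EFinM lee_fin.
have v0 : 0 <= \sum_i v i.
  by apply: sumr_ge0 => i _; rewrite -lee_fin -Vv wmom_ge0.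
apply: (@le_trans _ _ (2^-1 * (\sum_i X cx i) / A 0 * ((2 * pi) ^- 2 / A 0 ^+ 2 * \sum_i v i))).
  (* The gap is that of [heisenberg], over the common denominator [64 pi^2 (A 0)^3]. *)
  rewrite -subr_ge0 (_ : _ - _ = (8 * (\sum_i v i) * (\sum_i X cx i) - n%:R ^+ 2 * A 0 ^+ 3) /
     (64 * pi ^+ 2 * A 0 ^+ 3)).
    apply: divr_ge0; first by rewrite subr_ge0.
    by rewrite ltW// mulr_gt0 ?exprn_gt0 ?mulr_gt0// pi_gt0.
  have := lt0r_neq0 A00; have := @pi_neq0 R.
  move: (A 0) (\sum_i v i) (\sum_i X cx i) (@pi R) => a s t q q0 a0.
  by field; rewrite q0 a0.
apply: ler_wpM2r.
  by rewrite mulr_ge0// divr_ge0 ?invr_ge0 ?sqr_ge0.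
by rewrite lerDl divr_ge0 ?mulr_ge0// ltW.
Qed.


Lemma equality_gaussian : (Sx * Sw)%E = bound%:E ->
  p_f = cx /\ exists2 z, 0 < z &
  forall x, f x = f cx * expR (- ((2 * z)^-1 * \sum_j (x ord0 j - cx ord0 j) ^+ 2)).
Proof.
have A00 := corr0_gt0; have X0 := sX_gt0 cx; have s0 := sx_gt0.
rewrite spread_xE sxE.
have [oo|[v Vv]] := wmom_dichotomy.
  (* An infinite w-moment would make the product infinite, as the x-spread is positive. *)
  rewrite spread_wE oo gt0_muley ?lte_fin ?divr_gt0 ?invr_gt0 ?exprn_gt0 ?pi2_gt0//.
  by rewrite gt0_muley ?lte_fin.
have [H Heq] := heisenberg cf lf lx cx n0 A00 Vv.
rewrite (uncertainty_finite Vv) -EFinM => -[].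
move/(congr1 (fun t => 64 * pi ^+ 2 * A 0 ^+ 3 * t)) => E.
have E2 : n%:R ^+ 2 * A 0 ^+ 3 = 8 * (\sum_i v i) * (\sum_i X cx i) +
    8 * (\sum_i v i) * (\sum_i M cx i ^+ 2) / A 0.
  transitivity (64 * pi ^+ 2 * A 0 ^+ 3 * bound).
    by have := @pi_neq0 R; move: (@pi R) => q q0; field.
  rewrite -E; have := lt0r_neq0 A00; have := @pi_neq0 R.
  move: (A 0) (\sum_i v i) (\sum_i X cx i) (\sum_i _) (@pi R) => a s t u q q0 a0.
  by field; rewrite q0 a0.
have V0 : 0 < \sum_i v i.
  have : 0 < 8 * (\sum_i v i) * (\sum_i X cx i).
    by apply: lt_le_trans H; rewrite mulr_gt0 ?exprn_gt0 ?ltr0n.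
  by rewrite pmulr_lgt0// pmulr_rgt0.
(* By [heisenberg] the first term on the right of [E2] is already at least the left side, so the
   second, which is nonnegative, vanishes. *)
have M0 : \sum_i M cx i ^+ 2 = 0.
  apply/eqP; rewrite eq_le sM_ge0 andbT.
  move: H; rewrite E2 gerDl pmulr_lle0 ?invr_gt0// pmulr_rle0// mulr_gt0//.
have Mi i : M cx i = 0.
  have /(_ i isT)/eqP := psumr_eq0P (fun i _ => sqr_ge0 (M cx i)) M0.
  by rewrite sqrf_eq0 => /eqP.
split; first exact/esym/mean_xmul_eq0.
have [|z z0 Hz] := Heq; first by rewrite E2 M0 mulr0 mul0r addr0.
by exists z => //; exact: (gaussian_rigidity cf lf lx (lt0r_neq0 z0) Hz).
Qed.

(** The amplitude [expR eps] of an optimal Gaussian is positive, while the spreads see [f] only up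
    to sign; the alternative with [- f] covers the negative amplitudes. The centre is the same for
    both, as it depends on the modulus of [f] alone. *)
Lemma optimal_gaussianP : optimal_gaussian f \/ optimal_gaussian (fun x => - f x) <->
  exists2 z, 0 < z & exists2 c, c != 0 &
  forall x, f x = c * expR (- ((2 * z)^-1 * \sum_j (x ord0 j - p_f ord0 j) ^+ 2)).
Proof.
have exponent z (x : 'rV[R]_n) : - (1 / (2 * z)) * norm2 (x - p_f) ^+ 2 =
    - ((2 * z)^-1 * \sum_j (x ord0 j - p_f ord0 j) ^+ 2).
  rewrite norm2_sqr div1r mulNr; congr (- (_ * _)).
  by apply: eq_bigr => j _; rewrite !mxE.
have opp : (fun y => `|- f y| ^+ 2) = (fun y => `|f y| ^+ 2).
  by apply/funext => y; rewrite normrN.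
split.
  case=> -[z [eps [z0 fE]]]; exists z => //.
    exists (expR eps) => [|x]; first by rewrite gt_eqF ?expR_gt0.
    by rewrite fE exponent expRD mulrC.
  exists (- expR eps) => [|x]; first by rewrite oppr_eq0 gt_eqF ?expR_gt0.
  by rewrite -[LHS]opprK fE opp exponent expRD mulrC mulNr.
move=> [z z0 [c c0 fE]].
have [cp|cn] := ltP 0 c; [left|right]; exists z.
  by exists (ln c); split => // x; rewrite exponent expRD lnK ?posrE// mulrC fE.
have cn' : 0 < - c by rewrite oppr_gt0 lt_neqAle c0.
exists (ln (- c)); split => // x.
by rewrite opp exponent expRD lnK ?posrE// mulrC mulNr fE.
Qed.

(** Upper bounds suffice, since the general inequality is the other half. The x-moments may be taken
    about [p_f], where the mean terms vanish, because the centroid only lowers them; [z] cancels in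
    the product. *)
Lemma gaussian_equality z c : 0 < z ->
  (forall x, f x = c * expR (- ((2 * z)^-1 * \sum_j (x ord0 j - p_f ord0 j) ^+ 2))) ->
  (Sx * Sw = bound%:E)%E.
Proof.
move=> z0 fE; have A00 := corr0_gt0.
apply/eqP; rewrite eq_le uncertainty_inequality andbT.
have Mi i : M p_f i = 0 by move: i; exact/mean_xmul_eq0.
have Sx_le : (Sx <= (n%:R * z / 4)%:E)%E.
  apply: le_trans (spread_x_le p_f) _; rewrite lee_fin.
  rewrite ler_pdivrMr//.
  rewrite (_ : n%:R * z / 4 * A 0 ^+ 2 = \sum_(i < n) (2^-1 * A 0 * (z * A 0 / 2))); last first.
    by rewrite sumr_const card_ord -mulr_natl; field.
  apply: ler_sum => i _; rewrite Mi expr0n mulr0 addr0 ler_pM2l ?mulr_gt0//.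
  exact: (gaussian_xmoment cf lf lx z0 fE).
have Sw_le : (Sw <= (n%:R / (16 * pi ^+ 2 * z))%:E)%E.
  rewrite spread_wE.
  have -> : n%:R / (16 * pi ^+ 2 * z) =
      (2 * pi) ^- 2 / A 0 ^+ 2 * (\sum_(i < n) (A 0 ^+ 2 / (4 * z))).
    rewrite sumr_const card_ord -[(_ / _) *+ n]mulr_natl.
    have := lt0r_neq0 A00; have := @pi_neq0 R; have := lt0r_neq0 z0.
    move: (A 0) (@pi R) => a q zn0 q0 a0.
    by field; rewrite q0 a0 zn0.
  rewrite [leRHS]EFinM lee_pmul2l ?lte_fin ?divr_gt0 ?invr_gt0 ?exprn_gt0 ?pi2_gt0//.
  rewrite -sumEFin; apply: lee_sum => i _.
  exact: (gaussian_wmom cf lf z0 fE).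
apply: le_trans (lee_pmul _ _ Sx_le Sw_le) _.
- rewrite spread_xE lee_fin sxE addr_ge0// divr_ge0 ?mulr_ge0// ltW//.
- rewrite spread_wE mule_ge0// ?lee_fin ?divr_ge0 ?invr_ge0 ?sqr_ge0//.
  by apply: sume_ge0 => i _; exact: wmom_ge0.
rewrite -EFinM lee_fin le_eqVlt; apply/orP; left; apply/eqP.
have := @pi_neq0 R; have := lt0r_neq0 z0; move: (@pi R) => q zn0 q0.
by field; rewrite q0 zn0.
Qed.

Lemma uncertainty_equality :
  (Sx * Sw)%E = bound%:E <-> optimal_gaussian f \/ optimal_gaussian (fun x => - f x).
Proof.
split; last by move/optimal_gaussianP => [z z0 [c _ fE]]; exact: (gaussian_equality z0 fE).
move/equality_gaussian => [pE [z z0 fE]]; apply/optimal_gaussianP.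
exists z => //; rewrite pE; exists (f cx) => //.
(* The amplitude [f cx] cannot be 0, since then [f] would vanish identically. *)
have [x] := f_neq0; apply: contra => /eqP fp.
by rewrite fE fp mul0r.
Qed.

End uncertainty.

Theorem theorem6p1 (R : realType) (N : nat) (hN : (0 < N)%N)
    (f : 'rV[R]_N -> R) (Ff : 'rV[R]_N -> R[i])
    (phi : 'rV[R]_N -> 'rV[R]_N -> R[i]) (phi1 : 'rV[R]_N -> R[i])
    (f_neq0 : exists x, f x != 0)
    (phi_umitrsk : UMITRSK phi phi1)
    (phi_pm1 : forall v y, phi v y = 1 \/ phi v y = -1)
    (fL2 : f \in Lfun (lebesgue_rV N) 2%:E)
    (xfL2 : (fun x => norm2 x * f x) \in Lfun (lebesgue_rV N) 2%:E)
    (FfE : is_fourier_transform (fun x => (f x)%:C) Ff)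
    (wFfL2 : square_integrable (fun w => (norm2 w)%:C * Ff w))
    (grad_f : forall (x : 'rV[R]_N) (i : 'I_N), derivable f x (delta_mx ord0 i)) :
  let C := C_UMITRSK phi1 (fun x => (f x)%:C) in
  let bound := 4^-1 * (N%:R ^+ 2 / (16 * pi ^+ 2)) : R in
  (bound%:E <= spread_x C * spread_w C)%E /\
  ({ae (lebesgue_rV N : {measure set 'rV[R]_N -> \bar R}), forall x, f x != 0} ->
    ((spread_x C * spread_w C)%E = bound%:E <->
      optimal_gaussian f \/ optimal_gaussian (fun x => - f x))).
Proof.
move=> C bound.
have lf := Lfun2_L2 fL2.
have lx i := L2_coordM i lf (Lfun2_L2 xfL2).
have cf := derivable_sepcont grad_f.
have [r r1 phiE] := UMITRSK_constant phi_umitrsk phi_pm1.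
have CE : (fun z : 'rV[R]_N * 'rV[R]_N => normc (C z.1 z.2) ^+ 2) =
    fun z => spec f z.1 z.2.
  by apply/funext => z; exact: normc_C_UMITRSK lf r1 phiE.
rewrite /spread_x /spread_w CE; split; first exact: uncertainty_inequality.
by move=> _; exact: uncertainty_equality.
Qed.
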